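(* Assume that the base flow $(\Omega,\sigma,\mathbb{R})$ is minimal, that H1 and H2 hold, and that $\mathcal{M}\subset\Omega\times W^{1,\infty}$ is a minimal set (for $\Pi$) with $\lambda_{\mathcal{M}}<0$. Then: (i) The domain of attraction $\mathcal{D}(\mathcal{M})$ of $\mathcal{M}$ is an open and connected positively $\Pi$-invariant subset of $\Omega\times W^{1,\infty}$. (ii) For all $\beta\in(0,-\lambda_{\mathcal{M}})$ and all compact sets $\mathcal{P}\subset\mathcal{D}(\mathcal{M})$ there exists a constant $k=k(\beta,\mathcal{P})$ such that, for every $(\omega,x)\in\mathcal{P}$, there exists $(\omega,\bar x)\in\mathcal{M}$ with $$\|u(t,\omega,x)-u(t,\omega,\bar x)\|_{W^{1,\infty}}\le k\,e^{-\beta t}\quad\text{for }t\ge0.$$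
   Context: Fix $r>0$ and $n\ge1$. $C=C([-r,0],\mathbb{R}^n)$ with the supremum norm $\|\cdot\|_C$; $W^{1,\infty}$ is the Banach space of Lipschitz functions $\psi:[-r,0]\to\mathbb{R}^n$ with norm $\|\psi\|_{W^{1,\infty}}=\max\{\|\psi\|_C,\|\dot\psi\|_{L^\infty}\}$. For a continuous function $y$ on $[t-r,t]$, $y_t(s)=y(t+s)$, $s\in[-r,0]$. $(\Omega,\sigma,\mathbb{R})$ is a continuous flow on a compact metric space, and $\omega\cdot t=\sigma(t,\omega)$; it is minimal if every orbit is dense in $\Omega$. $\mathrm{Lin}(X,Y)$ is the space of bounded linear maps with the operator norm. Consider the family of equations, for $\omega\in\Omega$, $$\dot y(t)=F(\omega\cdot t,\,y(t),\,y(t-\tau(\omega\cdot t,y_t))),\quad t\ge0,$$ with $F:\Omega\times\mathbb{R}^n\times\mathbb{R}^n\to\mathbb{R}^n$ and $\tau:\Omega\times C\to[0,r]$. Conditions: H1: $F$ is continuous and its partial derivatives with respect to the second and third arguments exist and are continuous on $\Omega\times\mathbb{R}^n\times\mathbb{R}^n$. H2: (1) $\tau$ is continuous and differentiable with respect to its second argument, with $D_2\tau:\Omega\times C\to\mathrm{Lin}(C,\mathbb{R})$ continuous. (2) For every compact subset $\mathcal{C}\subset\Omega\times C$ there is $L_2=L_2(\mathcal{C})>0$ with $\|D_2\tau(\omega,x_1)-D_2\tau(\omega,x_2)\|_{\mathrm{Lin}(C,\mathbb{R})}\le L_2\|x_1-x_2\|_C$ for all $(\omega,x_1),(\omega,x_2)\in\mathcal{C}$.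 Under these conditions, for each $\omega\in\Omega$ and $x\in W^{1,\infty}$ there is a unique maximal solution $y(t,\omega,x)$ with $y(s,\omega,x)=x(s)$ for $s\in[-r,0]$, defined on $[-r,\beta_{\omega,x})$, $0<\beta_{\omega,x}\le\infty$. Put $u(t,\omega,x)(s)=y(t+s,\omega,x)$, which belongs to $W^{1,\infty}$, and $\Pi(t,\omega,x)=(\omega\cdot t,u(t,\omega,x))$ for $t\in[0,\beta_{\omega,x})$. A set $\mathcal{P}$ is positively $\Pi$-invariant if $\beta_{\omega,x}=\infty$ and $\Pi(t,\omega,x)\in\mathcal{P}$ for all $(\omega,x)\in\mathcal{P}$, $t\ge0$. A minimal set is a nonempty positively $\Pi$-invariant compact set containing properly no nonempty positively $\Pi$-invariant compact set. Every point $(\omega,\bar x)$ of a minimal set $\mathcal{M}$ admits a backward extension in $\mathcal{M}$ (a continuous $\theta:(-\infty,0]\to\mathcal{M}$ with $\theta(0)=(\omega,\bar x)$ and $\Pi(t,\theta(s))=\theta(t+s)$ whenever $s\le-t\le0$), and hence $\bar x$ is $C^1$. For $(\omega,\bar x)\in\mathcal{M}$ and $\phi\in C$ define $$\begin{aligned}L(\omega,\bar x)\phi={}&D_2F(\omega,\bar x(0),\bar x(-\tau(\omega,\bar x)))\phi(0)+D_3F(\omega,\bar x(0),\bar x(-\tau(\omega,\bar x)))\phi(-\tau(\omega,\bar x))\\&-D_3F(\omega,\bar x(0),\bar x(-\tau(\omega,\bar x)))\,\dot{\bar x}(-\tau(\omega,\bar x))\cdot D_2\tau(\omega,\bar x)\phi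 .\end{aligned}$$ For $v\in C$ let $z(t,\omega,\bar x,v)$, $t\ge-r$, be the solution of $\dot z(t)=L(\Pi(t,\omega,\bar x))z_t$, $t\ge0$, with $z(s)=v(s)$ on $[-r,0]$, and let $w(t,\omega,\bar x,v)(s)=z(t+s,\omega,\bar x,v)$, $s\in[-r,0]$ (which lies in $W^{1,\infty}$ if $v$ does). The upper Lyapunov exponent of $\mathcal{M}$ is (with $\ln0=-\infty$) $$\lambda_{\mathcal{M}}=\sup_{(\omega,\bar x)\in\mathcal{M}}\ \sup_{0\ne v\in W^{1,\infty}}\limsup_{t\to\infty}\tfrac1t\ln\|w(t,\omega,\bar x,v)\|_{W^{1,\infty}},$$ which coincides with the analogous quantity $\sup_{(\omega,\bar x)\in\mathcal{M}}\sup_{0\ne v\in C}\limsup_{t\to\infty}\frac1t\ln\|w(t,\omega,\bar x,v)\|_C$. The domain of attraction of $\mathcal{M}$ is the set $\mathcal{D}(\mathcal{M})$ of all $(\omega,x)\in\Omega\times W^{1,\infty}$ (with $\beta_{\omega,x}=\infty$) for which there exists $(\omega,\bar x)\in\mathcal{M}$ with $\lim_{t\to\infty}\|u(t,\omega,x)-u(t,\omega,\bar x)\|_{W^{1,\infty}}=0$. *)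

(* Defs.v *)
From HB Require Import structures.
From mathcomp Require Import all_boot all_order all_algebra.
From mathcomp Require Import all_classical all_reals all_analysis.
From mathcomp Require Import ess_sup_inf.
From mathcomp Require Import ring lra.
Set Implicit Arguments. Unset Strict Implicit. Unset Printing Implicit Defensive.
Import Order.TTheory GRing.Theory Num.Theory numFieldNormedType.Exports.
Local Open Scope classical_set_scope.
Local Open Scope ring_scope.

Section Slope.
Context {R : realType} {V : normedModType R}.
Implicit Types (A : set R) (f : R -> V) (t : R) (d : V).

(* Difference quotient and derivative relative to a set A: one-sided when t is an
   end point of the interval A. *)
Definition slope f t : R -> V := fun s => (s - t)^-1 *: (f s - f t).
Definition has_deriv_within A f t d := slope f t s @[s --> within A t^'] --> d.
Definition deriv_within A f t : V := lim (slope f t s @[s --> within A t^']).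

Lemma within_dnbhs_itvoo (a b : R) t : t \in `]a, b[ ->
  within `[a, b]%classic t^' = t^'.
Proof.
move=> tab.
have tn : nbhs t^' `[a, b]%classic.
  apply: nbhs_dnbhs.
  have := near_in_itvoo tab; apply: filterS => s.
  by apply: subset_itv_oo_cc.
apply/seteqP; split => A; rewrite /within /=.
  by move=> H; near=> s; apply: (near H s) => //; near: s.
by move=> H; near=> s => _; near: s.
Unshelve. all: by end_near. Qed.

Lemma derivable_within (a b : R) f t : t \in `]a, b[ -> derivable f t 1 ->
  has_deriv_within `[a, b]%classic f t ('D_1 f t) /\
  deriv_within `[a, b]%classic f t = 'D_1 f t.
Proof.
move=> tab dft.
have ft : slope f t s @[s --> t^'] --> 'D_1 f t.
  have df : h^-1 *: ((f \o shift t) (h *: 1) - f t) @[h --> 0^'] --> 'D_1 f t by exact: dft.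
  have {}df : (h^-1 *: (f (h + t) - f t)) @[h --> 0^'] --> 'D_1 f t.
    apply: cvg_trans df; apply: near_eq_cvg; near=> h.
    by rewrite /= scaler1.
  apply/cvgrPdist_le => e e0.
  move/cvgrPdist_le : df => /(_ e e0) [d /= d0 dP].
  exists d => //= s; rewrite /ball_ => st snt.
  have := dP (s - t); rewrite /ball_/= sub0r normrN distrC subrK => /(_ st).
  by apply; rewrite subr_eq0.
have sub := within_dnbhs_itvoo tab.
split; first by rewrite /has_deriv_within sub.
by rewrite /deriv_within sub; apply/cvg_lim.
Unshelve. all: by end_near. Qed.

Lemma derive_lip_le f t k : (forall s u, `|f s - f u| <= k * `|s - u|) ->
  derivable f t 1 -> `|'D_1 f t| <= k.
Proof.
move=> fk dft; apply/ler_addgt0Pl => e e0.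
have : h^-1 *: ((f \o shift t) (h *: 1) - f t) @[h --> 0^'] --> 'D_1 f t by exact: dft.
move=> /cvgrPdist_le /(_ e e0) H.
near (0 : R)^' => h.
have h0 : h != 0 by near: h; exact: nbhs_dnbhs_neq.
rewrite -(subrK (h^-1 *: ((f \o shift t) (h *: 1) - f t)) ('D_1 f t)).
rewrite (le_trans (ler_normD _ _))// lerD//; first by near: h.
rewrite normrZ normfV ler_pdivrMl ?normr_gt0// mulrC.
by rewrite (le_trans (fk _ _))//= scaler1 addrK.
Unshelve. all: by end_near. Qed.

Lemma has_deriv_withinZ A a f t d : has_deriv_within A f t d ->
  has_deriv_within A (a \*: f) t (a *: d).
Proof.
move=> fd; rewrite /has_deriv_within.
rewrite (_ : slope _ _ = a \*: slope f t); first exact: cvgZr.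
by apply/funext => s; rewrite /slope /= -scalerBr !scalerA mulrC.
Qed.

Lemma has_deriv_withinD A f g t d e : has_deriv_within A f t d ->
  has_deriv_within A g t e -> has_deriv_within A (f \+ g) t (d + e).
Proof.
move=> fd ge; rewrite /has_deriv_within.
rewrite (_ : slope _ _ = slope f t \+ slope g t); first exact: cvgD.
by apply/funext => s; rewrite /slope /= -scalerDr opprD addrACA.
Qed.

End Slope.

Section LipschitzDerivable.
Context {R : realType}.
Let mu := @lebesgue_measure R.

Lemma lip_halves_cumulative (f : R -> R) :
  (forall x y, `|f x - f y| <= `|x - y|) ->
  let g := fun x => (x + f x) / 2 in
  nondecreasing g /\ (forall x, g @ at_right x --> g x).
Proof.
move=> lf g; split.
  move=> x y xy; rewrite /g ler_pM2r ?invr_gt0//.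
  have := lf x y; rewrite (distrC x) (ger0_norm (_ : 0 <= y - x)) ?subr_ge0//.
  by rewrite ler_norml => /andP[? ?]; lra.
apply: right_continuousW => x; apply/cvgrPdist_lt => e e0.
near=> t.
apply: (@le_lt_trans _ _ `|x - t|).
  have -> : g x - g t = ((x - t) + (f x - f t)) / 2 by rewrite /g; ring.
  rewrite normrM (ger0_norm (_ : 0 <= 2^-1 :> R))// ler_pdivrMr//.
  rewrite (le_trans (ler_normD _ _))// mulr_natr mulr2n lerD2l.
  exact: lf.
by near: t; apply/nbhs_ballP; exists e.
Unshelve. all: by end_near. Qed.

(* Rademacher's theorem on the line, via Radon-Nikodym for the Stieltjes measures
   of (x + f x)/2 and (x - f x)/2, whose sum is the Lebesgue measure. *)
Lemma lip1_ae_derivable (f : R -> R) (a b : R) : a <= b ->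
  (forall x y, `|f x - f y| <= `|x - y|) ->
  {ae mu, forall x, x \in `]a, b[ -> derivable f x 1}.
Proof.
move=> ab lf.
have lNf : forall x y, `|(- f x) - (- f y)| <= `|x - y|.
  by move=> x y; rewrite -opprD normrN lf.
pose g x := (x + f x) / 2.
pose g' x := (x + - f x) / 2.
have [gnd grc] := lip_halves_cumulative lf.
have [gnd' grc'] := lip_halves_cumulative lNf.
pose G : cumulative R R := HB.pack g (isCumulative.Build R _ R g gnd grc).
pose G' : cumulative R R := HB.pack g' (isCumulative.Build R _ R g' gnd' grc').
pose LG := lebesgue_stieltjes_measure G.
pose LG' := lebesgue_stieltjes_measure G'.
have LGitv (H : cumulative R R) x y : x <= y ->
    lebesgue_stieltjes_measure H `]x, y]%classic = (H y - H x)%:E.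
  move=> xy; rewrite /lebesgue_stieltjes_measure /measure_extension measurable_mu_extE/=.
    by rewrite wlength_itv_bnd.
  by exists (x, y).
have muE A : measurable A -> (mu A = LG A + LG' A)%E.
  move=> mA; 
  rewrite -(measure_addE LG LG' A).
  apply: (@lebesgue_measure_unique R (measure_add LG LG')) => //.
  move=> X [[x y] _ <-]; transitivity (LG `]x, y]%classic + LG' `]x, y]%classic)%E;
    last by rewrite -(measure_addE LG LG' _).
  have [xy|yx] := leP x y; last first.
    have -> : `]x, y]%classic = set0 :> set R by rewrite set_itv_ge//= bnd_simp -leNgt ltW.
    by rewrite /LG /LG' !measure0 adde0.
  have eG : LG `]x, y]%classic = (g y - g x)%:E by exact: (LGitv G _ _ xy).
  have eG' : LG' `]x, y]%classic = (g' y - g' x)%:E by exact: (LGitv G' _ _ xy).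
  rewrite [X in (X + _)%E]eG [X in (_ + X)%E]eG' -EFinD /mu lebesgue_measure_itv/= lte_fin.
  case: ltP => [_|yx]; first by rewrite -EFinD; congr EFin; rewrite /g /g'; lra.
  have -> : x = y by apply/eqP; rewrite eq_le xy.
  by rewrite !subrr addr0.
have mab : measurable (`]a, b]%classic : set (measurableTypeR R)) by exact: measurable_itv.
have LGoo : (LG `]a, b]%classic < +oo)%E by rewrite /LG LGitv// ltry.
pose nu := mfrestr mab LGoo.
have dom : nu `<< mu.
  apply/null_content_dominatesP => A mA /= muA0.
  have : (nu A <= mu A)%E.
    rewrite muE//; apply: le_trans (_ : LG A <= _)%E; last by rewrite leeDl.
    by apply: le_measure; rewrite ?inE//; exact: measurableI.
  rewrite [X in (_ <= X)%E](_ : _ = 0%E); last exact: muA0.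
  by rewrite measure_le0 => /eqP.
have [h [h0 hfin hint hE]] := radon_nikodym_sigma_finite dom.
pose h' x := fine (h x).
have hE' : h = EFin \o h' by apply/funext => x /=; rewrite fineK.
rewrite hE' in hint hE.
have intA A : measurable A -> mu.-integrable A (EFin \o h').
  by move=> mA; exact: (integrableS measurableT).
have loc : locally_integrable [set: R] h'.
  have := @integrable_locally R h' setT measurableT hint.
  by rewrite patch_setT.
have := FTC1 (fun y => intA [set` Interval (BRight a) (BRight y)] (measurable_itv _)) loc.
apply: filterS; first exact: (ae_filter_ringOfSetsType mu).
move=> x Hx; rewrite in_itv/= => /andP[ax xb].
have [] := Hx; first by rewrite lte_fin.
set H := (fun _ => _) => dH _.
have gH y : a <= y -> y <= b -> g y = g a + H y.
  move=> ay yb.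
  have : nu `]a, y]%classic = (g y - g a)%:E.
    have -> : nu `]a, y]%classic = LG `]a, y]%classic.
      rewrite /nu /mfrestr /mrestr; congr (LG _).
      apply: setIidl => z /=; rewrite !in_itv/= => /andP[-> /=] zy.
      exact: le_trans yb.
    exact: (LGitv G).
  move=> e.
  have -> : H y = g y - g a.
    have /esym e1 := hE `]a, y]%classic (measurable_itv _).
    by rewrite /H /Rintegral; apply: (congr1 fine (etrans e1 e)).
  by rewrite addrCA subrr addr0.
have dg : derivable g x 1.
  have : derivable (fun y => g a + H y) x 1 by apply: derivableD => //; exact: derivable_cst.
  apply: near_eq_derivable.
  near=> y.
  have /[!in_itv]/= /andP[/ltW ay /ltW yb] : y \in `]a, b[.
    by near: y; apply: near_in_itvoo; rewrite in_itv/= ax xb.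
  exact/esym/gH.
have -> : f = (2 *: g) - id.
  by apply/funext => y; rewrite !fctE /= /g /GRing.scale/=; lra.
by apply: derivableB => //; exact: derivableZ.
Unshelve. all: by end_near. Qed.
End LipschitzDerivable.

Section Spaces.
Context {R : realType} (r : {posnum R}) (n : nat).
Implicit Types (f : R -> 'rV[R]_n) (s t : R).

(* C([-r,0], R^n): a function on [-r,0] is represented by its unique extension to
   R that is constant on ]-oo,-r] and on [0,+oo[. R^n carries the max norm of
   ['rV[R]_n]. *)
Definition seg : set R := `[- r%:num, 0]%classic.
Definition clamp s : R := Num.max (- r%:num) (Num.min s 0).

Definition contseg : {pred R -> 'rV[R]_n} :=
  [pred f | `[< continuous f /\ f \o clamp = f >]].

Record Cspace := MkCspace { Cfun :> R -> 'rV[R]_n ; _ : Cfun \in contseg }.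

HB.instance Definition _ := [isSub for Cfun].
HB.instance Definition _ := [Choice of Cspace by <:].

Lemma contseg_submod : submod_closed contseg.
Proof.
split=> [|a f g]; rewrite !inE.
  by split=> [x|]; [exact: cvg_cst|exact/funext].
move=> [cf ef] [cg eg]; split.
  move=> x; apply: cvgD; last exact: cg.
  by apply: cvgZr; exact: cf.
by rewrite -[in RHS]ef -[in RHS]eg.
Qed.

HB.instance Definition _ := GRing.isSubmodClosed.Build R (R -> 'rV[R]_n) contseg contseg_submod.
HB.instance Definition _ := [SubChoice_isSubLmodule of Cspace by <:].

Definition supnorm (x : Cspace) : R := sup [set `|x s| | s in seg].

Lemma seg0 : 0 \in seg.
Proof. by rewrite inE /seg/= in_itv/= oppr_le0 lexx andbT. Qed.

Lemma clamp_seg s : clamp s \in seg.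
Proof.
rewrite inE /seg/= in_itv/= /clamp le_max lexx/= ge_max ge_min lexx orbT andbT.
by rewrite oppr_le0.
Qed.

Lemma clamp_id s : s \in seg -> clamp s = s.
Proof.
by rewrite inE /seg/= in_itv/= /clamp => /andP[s1 s2]; rewrite min_l// max_r.
Qed.

Lemma clamp_lip s t : `|clamp s - clamp t| <= `|s - t|.
Proof.
wlog st : s t / s <= t.
  by move=> H; have [/H//|/ltW/H] := leP s t; rewrite distrC (distrC t).
rewrite (distrC s) (ger0_norm (_ : 0 <= t - s)) ?subr_ge0// ler_norml.
have r0 : 0 < r%:num by [].
have cl u : [\/ u <= - r%:num /\ clamp u = - r%:num,
    (- r%:num <= u /\ u <= 0) /\ clamp u = u | 0 <= u /\ clamp u = 0].
  rewrite /clamp; have [u0|/ltW u0] := leP 0 u.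
    by apply: Or33; split; rewrite // max_r// oppr_le0.
  have [ur|/ltW ur] := leP u (- r%:num); first by apply: Or31.
  by apply: Or32.
case: (cl s) => -[? ->]; case: (cl t) => -[? ->]; apply/andP; split; lra.
Qed.

Lemma Cfun_clamp (x : Cspace) s : x (clamp s) = x s.
Proof. by have /[!inE]-[_ e] := valP x; rewrite -[in RHS]e. Qed.

Lemma Cfun_continuous (x : Cspace) : continuous x.
Proof. by have /[!inE]-[] := valP x. Qed.

Lemma Cspace_eq (x y : Cspace) : {in seg, x =1 y} -> x = y.
Proof.
move=> xy; apply/val_inj/funext => s /=.
by rewrite -Cfun_clamp -(Cfun_clamp y) xy// clamp_seg.
Qed.

Lemma Cspace_bounded (x : Cspace) : has_sup [set `|x s| | s in seg].
Proof.
split; first by exists `|x 0|; exists 0 => //; rewrite /seg/= in_itv/= oppr_le0 lexx andbT.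
have : compact [set `|x s| | s in seg].
  apply: (@continuous_compact _ _ (fun s => `|x s|)).
    apply: continuous_subspaceT => s.
    apply: cvg_norm; exact: Cfun_continuous.
  exact: segment_compact.
move=> /compact_bounded[M [_ /(_ (M + 1))]]; rewrite ltrDl => /(_ ltr01) H.
exists (M + 1) => _ [s ss <-].
by apply: le_trans (ler_norm _) (H `|x s| _); exists s.
Qed.

Lemma supnorm_ub (x : Cspace) s : s \in seg -> `|x s| <= supnorm x.
Proof.
move=> /[!inE] ss; apply: sup_upper_bound; first exact: Cspace_bounded.
by exists s.
Qed.

Lemma supnorm_le (x : Cspace) k :
  (forall s, s \in seg -> `|x s| <= k) -> supnorm x <= k.
Proof.
move=> xk; apply: ge_sup; first by have [] := Cspace_bounded x.
by move=> _ [s ss <-]; apply: xk; rewrite inE.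
Qed.

Lemma ler_supnormD x y : supnorm (x + y) <= supnorm x + supnorm y.
Proof.
apply: supnorm_le => s ss.
by rewrite (le_trans (ler_normD _ _))// lerD// supnorm_ub.
Qed.

Lemma supnorm0 : supnorm 0 = 0.
Proof.
apply/eqP; rewrite eq_le; apply/andP; split.
  by apply: supnorm_le => s _; rewrite normr0.
by rewrite (le_trans (normr_ge0 ((0 : Cspace) 0)))// supnorm_ub// seg0.
Qed.

Lemma supnormZ a x : supnorm (a *: x) = `|a| * supnorm x.
Proof.
have le b z : supnorm (b *: z) <= `|b| * supnorm z.
  by apply: supnorm_le => s ss; rewrite normrZ ler_wpM2l// supnorm_ub.
apply/eqP; rewrite eq_le le/=.
have [->|a0] := eqVneq a 0; first by rewrite normr0 mul0r scale0r supnorm0.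
by rewrite -ler_pdivlMl ?normr_gt0// -normfV -[leLHS](_ : supnorm (a^-1 *: (a *: x)) = _) ?le// scalerA mulVf// scale1r.
Qed.

Lemma supnorm_eq0 x : supnorm x = 0 -> x = 0.
Proof.
move=> x0; apply: Cspace_eq => s ss.
by apply/eqP; rewrite -normr_le0 -x0 supnorm_ub.
Qed.

HB.instance Definition _ :=
  Lmodule_isNormed.Build R Cspace ler_supnormD supnormZ supnorm_eq0.

Definition lipseg : {pred Cspace} :=
  [pred x : Cspace | `[< [lipschitz x s | s in seg] >]].

Lemma lipsegP (x : Cspace) : reflect (exists2 k, 0 < k &
  forall s t, `|x s - x t| <= k * `|s - t|) (x \in lipseg).
Proof.
apply: (iffP idP).
  rewrite inE => -[M [_ HM]]; exists (Num.max M 0 + 1).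
    by rewrite ltr_pwDr// le_max lexx orbT.
  move=> s t.
  have Mlt : M < Num.max M 0 + 1 by rewrite ltr_pwDr// le_max lexx.
  have k0 : 0 <= Num.max M 0 + 1 by rewrite addr_ge0// le_max lexx orbT.
  rewrite -(Cfun_clamp x s) -(Cfun_clamp x t).
  apply: (@le_trans _ _ ((Num.max M 0 + 1) * `|clamp s - clamp t|)).
    apply: (HM _ Mlt (clamp s, clamp t)).
    by split; rewrite /= -inE clamp_seg.
  by rewrite ler_wpM2l// clamp_lip.
move=> [k k0 H]; rewrite inE.
have F : ProperFilter (globally (seg `*` seg)).
  by apply: (@globally_properfilter _ _ (0, 0)); split; rewrite /= -inE seg0.
by apply: klipschitzW => -[s t] _; exact: H.
Qed.

Lemma lipseg_submod : submod_closed lipseg.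
Proof.
split.
  by apply/lipsegP; exists 1 => // s t; rewrite subrr normr0 mul1r.
move=> a x y /lipsegP[k k0 xk] /lipsegP[l l0 yl]; apply/lipsegP.
exists (`|a| * k + l); first by rewrite ltr_wpDl// mulr_ge0// ltW.
move=> s t.
rewrite (_ : _ - _ = a *: (x s - x t) + (y s - y t)); last first.
  by rewrite scalerBr opprD addrACA.
rewrite (le_trans (ler_normD _ _))// mulrDl lerD// normrZ -mulrA ler_wpM2l//.
Qed.

HB.instance Definition _ :=
  GRing.isSubmodClosed.Build R Cspace lipseg lipseg_submod.

(* W^{1,oo}: the Lipschitz elements of C. *)
Record Wspace := MkWspace { Wfun :> Cspace ; _ : Wfun \in lipseg }.

HB.instance Definition _ := [isSub for Wfun].
HB.instance Definition _ := [Choice of Wspace by <:].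
HB.instance Definition _ := [SubChoice_isSubLmodule of Wspace by <:].

Definition dot (x : Cspace) s : 'rV[R]_n := deriv_within seg x s.

(* L^oo norm over [-r,0] of the almost everywhere defined derivative. *)
Definition essdot (x : Cspace) : \bar R :=
  ('N[lebesgue_measure]_+oo[(fun s => `|dot x s|%:E) \_ seg])%E.

Let mu := @lebesgue_measure R.

Let aeS (P Q : R -> Prop) : (forall s, P s -> Q s) ->
  {ae mu, forall s, P s} -> {ae mu, forall s, Q s}.
Proof. by move=> PQ; apply: filterS; first exact: (ae_filter_ringOfSetsType mu). Qed.

Let aeI (P Q : R -> Prop) : {ae mu, forall s, P s} -> {ae mu, forall s, Q s} ->
  {ae mu, forall s, P s /\ Q s}.
Proof. by move=> HP HQ; apply: filterI; first exact: (ae_filter_ringOfSetsType mu). Qed.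

Lemma ae_interior : {ae mu, forall s, s \in seg -> s \in `]- r%:num, 0[}.
Proof.
exists [set - r%:num; 0]; split.
- by apply: measurableU; exact: measurable_set1.
- by rewrite -[LHS]/(lebesgue_measure _) countable_lebesgue_measure0//; apply: finite_set_countable.
- move=> s /= /not_implyP[]; rewrite inE /seg/= !in_itv/= => /andP[].
  rewrite le_eqVlt => /predU1P[<-|rs]; first by left.
  by rewrite le_eqVlt => /predU1P[->|s0]; [right|rewrite rs s0].
Qed.

Lemma ae_has_dot (x : Cspace) k : 0 < k ->
  (forall s t, `|x s - x t| <= k * `|s - t|) ->
  {ae mu, forall s, s \in seg ->
    has_deriv_within seg x s (dot x s) /\ `|dot x s| <= k}.
Proof.
move=> k0 xk.
have ae j : {ae mu, forall s, s \in `]- r%:num, 0[ -> derivable (fun s => x s 0 j) s 1}.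
  have := @lip1_ae_derivable R (fun s => k^-1 * x s 0 j) (- r%:num) 0.
  rewrite oppr_le0 => /(_ (ltW (gt0 r))) H.
  have {}H : {ae mu, forall s, s \in `]- r%:num, 0[ ->
      derivable (fun s => k^-1 * x s 0 j) s 1}.
    apply: H => s t; rewrite -mulrBr normrM gtr0_norm ?invr_gt0// ler_pdivrMl//.
    rewrite (le_trans _ (xk s t))// [leRHS]/Num.Def.normr/= mx_normrE.
    apply: le_trans; last exact: (le_bigmax _ _ (0, j)).
    by rewrite !mxE.
  apply: aeS H => s + ss => /(_ ss) d.
  have -> : (fun s => x s 0 j) = k *: (fun s => k^-1 * x s 0 j).
    by apply/funext => t; rewrite !fctE /GRing.scale/= mulVKf// gt_eqF.
  exact: derivableZ.
have {}ae : {ae mu, forall s, s \in `]- r%:num, 0[ -> derivable x s 1}.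
  have F := ae_filter_ringOfSetsType mu.
  have {}ae := @filter_forall _ _ _ _ F ae.
  apply: aeS ae => s H ss.
  by apply/derivable_mxP => i j; rewrite (ord1 i); exact: H.
apply: aeS (aeI ae ae_interior) => s [xs ss] /ss sin.
have [] := derivable_within sin (xs sin).
rewrite /dot /seg => H ->; split => //; exact: derive_lip_le (xs sin).
Qed.

Lemma essdot_leP (x : Cspace) (c : R) : 0 <= c ->
  (essdot x <= c%:E)%E <-> {ae mu, forall s, s \in seg -> `|dot x s| <= c}.
Proof.
move=> c0; rewrite /essdot unlock ifT; last first.
  have mi : measurable (`[0, 1]%classic : set (measurableTypeR R)).
    exact: measurable_itv.
  apply: (@lt_le_trans _ _ (lebesgue_measure (`[0, 1]%classic : set R))).
    by rewrite lebesgue_measure_itv/= lte_fin ltr01 oppr0 adde0 lte_fin.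
  by apply: le_measure; rewrite ?inE//; exact: measurableT.
split.
  move=> /ess_supP; apply: aeS => s /= + ss.
  by rewrite patchE ss /= lee_fin normr_id.
move=> H; apply/ess_supP; apply: aeS H => s /=.
rewrite patchE; case: ifPn => ss; last by rewrite /= /point/= normr0 lee_fin.
by move=> /(_ isT); rewrite /= lee_fin normr_id.
Qed.

Lemma essdot_fin (x : Wspace) : essdot x \is a fin_num.
Proof.
have /lipsegP[k k0 xk] := valP x.
rewrite ge0_fin_numE ?Lnorm_ge0//; apply: le_lt_trans (ltry k).
apply/essdot_leP; first exact: ltW.
by apply: aeS (ae_has_dot k0 xk) => s H ss; have [] := H ss.
Qed.

Definition wnorm (x : Wspace) : R := Num.max `|x : Cspace| (fine (essdot x)).

Lemma fine_essdot_ge0 (x : Cspace) : 0 <= fine (essdot x).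
Proof. by rewrite fine_ge0 ?Lnorm_ge0. Qed.

Lemma ae_dot_le (x : Wspace) :
  {ae mu, forall s, s \in seg -> `|dot x s| <= fine (essdot x)}.
Proof.
by apply/essdot_leP; rewrite ?fine_essdot_ge0// fineK// essdot_fin.
Qed.

Lemma fine_essdot_le (x : Wspace) c : 0 <= c ->
  {ae mu, forall s, s \in seg -> `|dot x s| <= c} -> fine (essdot x) <= c.
Proof. by move=> c0 /(essdot_leP _ c0); rewrite -lee_fin fineK// essdot_fin. Qed.

Lemma ae_has_dotW (x : Wspace) :
  {ae mu, forall s, s \in seg -> has_deriv_within seg x s (dot x s)}.
Proof.
have /lipsegP[k k0 xk] := valP x.
by apply: aeS (ae_has_dot k0 xk) => s H ss; have [] := H ss.
Qed.

Lemma dot_uniq (x : Cspace) s d : s \in `]- r%:num, 0[ ->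
  has_deriv_within seg x s d -> dot x s = d.
Proof.
move=> ss; rewrite /has_deriv_within /dot /deriv_within within_dnbhs_itvoo// => H.
by apply/cvg_lim. (* /dot /deriv_within; apply: cvg_lim => //; rewrite within_dnbhs_itvoo. *)
Qed.

Lemma ler_wnormD x y : wnorm (x + y) <= wnorm x + wnorm y.
Proof.
rewrite /wnorm ge_max; apply/andP; split.
  by rewrite (le_trans (ler_normD _ _))// lerD// le_max lexx.
apply: (@le_trans _ _ (fine (essdot x) + fine (essdot y))); last first.
  by rewrite lerD// le_max lexx orbT.
apply: fine_essdot_le; first by rewrite addr_ge0 ?fine_essdot_ge0.
have := aeI (aeI (ae_has_dotW x) (ae_has_dotW y))
  (aeI ae_interior (aeI (ae_dot_le x) (ae_dot_le y))).
apply: aeS => s [[dx dy] [si [lx ly]]] ss.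
rewrite (@dot_uniq (x + y : Wspace) s _ (si ss) (has_deriv_withinD (dx ss) (dy ss))).
by rewrite (le_trans (ler_normD _ _))// lerD// ?lx ?ly.
Qed.

Lemma wnormZ a x : wnorm (a *: x) = `|a| * wnorm x.
Proof.
have le b z : fine (essdot (b *: z : Wspace)) <= `|b| * fine (essdot z).
  apply: fine_essdot_le; first by rewrite mulr_ge0 ?fine_essdot_ge0.
  have := aeI (ae_has_dotW z) (aeI ae_interior (ae_dot_le z)).
  apply: aeS => s [dz [si lz]] ss.
  rewrite (@dot_uniq (b *: z : Wspace) s _ (si ss) (has_deriv_withinZ (a := b) (dz ss))).
  by rewrite normrZ ler_wpM2l// lz.
rewrite /wnorm maxr_pMr// normrZ; congr Num.max.
apply/eqP; rewrite eq_le le/=.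
have [->|a0] := eqVneq a 0; first by rewrite normr0 mul0r fine_essdot_ge0.
rewrite -ler_pdivlMl ?normr_gt0// -normfV.
by have := le a^-1 (a *: x); rewrite scalerA mulVf// scale1r.
Qed.

Lemma wnorm_eq0 x : wnorm x = 0 -> x = 0.
Proof.
move=> x0; apply/val_inj => /=; apply/eqP; rewrite -normr_le0 -x0.
by rewrite /wnorm le_max lexx.
Qed.

HB.instance Definition _ :=
  Lmodule_isNormed.Build R Wspace ler_wnormD wnormZ wnorm_eq0.

End Spaces.

Definition opnorm {R : realType} {U V : normedModType R} (g : U -> V) : R :=
  sup [set `|g v| | v in [set v : U | `|v| <= 1]].

Section Flow.
Context {R : realType} {Omega : metricType R}.
Implicit Type sigma : R -> Omega -> Omega.

Definition continuous_flow sigma : Prop :=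
  [/\ continuous (fun p : R * Omega => sigma p.1 p.2),
      forall w, sigma 0 w = w &
      forall s t w, sigma (s + t) w = sigma s (sigma t w)].

Definition minimal_flow sigma : Prop :=
  forall w, dense (range (fun t => sigma t w)).

End Flow.

Section DelayEquation.
Context {R : realType} {r : {posnum R}} {n : nat} {Omega : metricType R}.
Notation E := 'rV[R]_n.
Notation C := (Cspace r n).
Notation W := (Wspace r n).

(* [histC y t] and [histW y t] are the segment y_t as an element of C, resp. W;
   they are 0 when y_t is not continuous, resp. not Lipschitz. *)
Definition histC (y : R -> E) (t : R) : C := insubd 0 (fun s => y (t + clamp r s)).
Definition histW (y : R -> E) (t : R) : W := insubd 0 (histC y t).

Definition H1 (F : Omega -> E -> E -> E) : Prop :=
  [/\ continuous (fun p : Omega * E * E => F p.1.1 p.1.2 p.2),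
      forall w a b, differentiable (fun c => F w c b) a,
      forall w a b, differentiable (F w a) b,
      continuous (fun p : Omega * E * E => 'J (fun c => F p.1.1 c p.2) p.1.2) &
      continuous (fun p : Omega * E * E => 'J (F p.1.1 p.1.2) p.2)].

Definition H2 (tau : Omega -> C -> R) : Prop :=
  [/\ continuous (fun p : Omega * C => tau p.1 p.2),
      forall w x, differentiable (tau w) x,
      forall p : Omega * C,
        (fun q : Omega * C => opnorm ('d (tau q.1) (q.2) \- 'd (tau p.1) (p.2))) @ p
          --> (0 : R) &
      forall K : set (Omega * C), compact K -> exists2 L2 : R, 0 < L2 &
        forall w x1 x2, K (w, x1) -> K (w, x2) ->
          opnorm ('d (tau w) x1 \- 'd (tau w) x2) <= L2 * `|x1 - x2|].

Variables (sigma : R -> Omega -> Omega) (F : Omega -> E -> E -> E).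
Variable tau : Omega -> C -> R.

(* y solves the equation on [0, b) with initial data x; at t = 0 the derivative
   is one-sided, and the values of y outside [-r, b) are irrelevant. *)
Definition solution (w : Omega) (x : W) (b : \bar R) (y : R -> E) : Prop :=
  [/\ (0 < b)%E,
      {in seg r, y =1 x},
      {within [set t | - r%:num <= t /\ (t%:E < b)%E], continuous y} &
      forall t, 0 <= t -> (t%:E < b)%E ->
        has_deriv_within [set s | 0 <= s /\ (s%:E < b)%E] y t
          (F (sigma t w) (y t) (y (t - tau (sigma t w) (histC y t))))].

Definition maximal_solution w x b y : Prop :=
  solution w x b y /\
  forall b' y', solution w x b' y' -> (b <= b')%E ->
    (forall t, - r%:num <= t -> (t%:E < b)%E -> y' t = y t) -> b' = b.

(* Under H1 and H2 the maximal solution exists and is unique on its interval. *)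
Definition max_sol w x : \bar R * (R -> E) :=
  xget (0%E, 0) [set p | maximal_solution w x p.1 p.2].
Definition beta w x : \bar R := (max_sol w x).1.
Definition sol w x : R -> E := (max_sol w x).2.

Definition usol (t : R) w x : W := histW (sol w x) t.
Definition Pi (t : R) (p : Omega * W) : Omega * W := (sigma t p.1, usol t p.1 p.2).

Definition positively_invariant (P : set (Omega * W)) : Prop :=
  forall p, P p -> beta p.1 p.2 = +oo%E /\ forall t, 0 <= t -> P (Pi t p).

Definition minimal_set (M : set (Omega * W)) : Prop :=
  [/\ M !=set0, positively_invariant M, compact M &
      forall K, K !=set0 -> positively_invariant K -> compact K ->
        K `<=` M -> K = M].

Definition linearization (p : Omega * W) (phi : C) : E :=
  let w := p.1 in let x := p.2 in let b := x (- tau w x) in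
  'd (fun a => F w a b) (x 0) (phi 0)
  + 'd (F w (x 0)) b (phi (- tau w x))
  - 'd (tau w) (x : C) phi *: 'd (F w (x 0)) b (dot x (- tau w x)).

Definition variational_solution (p : Omega * W) (v : C) (z : R -> E) : Prop :=
  [/\ {in seg r, z =1 v},
      {within `[- r%:num, +oo[, continuous z} &
      forall t, 0 <= t ->
        has_deriv_within `[0, +oo[%classic z t
          (linearization (Pi t p) (histC z t))].

Definition zsol (p : Omega * W) (v : C) : R -> E :=
  xget 0 [set z | variational_solution p v z].
Definition wsol (t : R) (p : Omega * W) (v : W) : W := histW (zsol p v) t.

Definition upper_lyapunov (M : set (Omega * W)) : \bar R :=
  ereal_sup
    [set limf_esup (fun t : R => (t^-1)%:E * lne (`|wsol t q.1 q.2|)%:E)%E +oo%R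
       | q in [set q : (Omega * W) * W | M q.1 /\ q.2 != 0]].

Definition attraction_domain (M : set (Omega * W)) : set (Omega * W) :=
  [set p | beta p.1 p.2 = +oo%E /\
    exists2 xb, M (p.1, xb) &
      `|usol t p.1 p.2 - usol t p.1 xb| @[t --> +oo%R] --> (0 : R)].

End DelayEquation.

(* Main.v *)
(* The W^{1,oo} norm of a segment is the larger of its supremum and its least Lipschitz constant,
   so every estimate in W^{1,oo} is a Gronwall estimate for a function of one real variable
   together with its Lipschitz constant.

   Since the linearized solution at a time T >= r depends continuously on the point of M and,
   in the supremum norm, on the initial segment, and since the unit ball of W^{1,oo} is
   compact in C (Ascoli), a negative upper Lyapunov exponent gives, uniformly over M, a
   contraction of the linearized solution by the factor e^{-bT} / 4 at some time T in a bounded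
   interval.  A first-order expansion of the nonlinear solution transfers the contraction to all
   initial segments in a tube of fixed radius around M; iterating it gives exponential decay.

   Cover the second projection of M by finitely many small balls.  The set of balls met by the
   fibre over w is upper semicontinuous in w, hence locally constant where its cardinality is
   least; so nearby fibres are close there.  By minimality of the base flow, backward orbits
   visit this place, and exponential stability transports the closeness to every point of the
   base: the fibres of M are lower semicontinuous.  Therefore a solution that has entered the
   tube over one base point keeps doing so when the base point and the initial segment are
   perturbed, which gives openness and the uniform rate on compact sets.

   For connectedness, a relatively clopen part of the domain contains with a point its whole
   forward orbit and a point of M in the same fibre tube; the points of M that it contains form
   a compact positively invariant set, which is all of M. *)
Require Import Defs.
From mathcomp Require Import all_boot all_order all_algebra.
From mathcomp Require Import all_classical all_reals all_analysis.
From mathcomp Require Import measurable_realfun.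
From mathcomp Require Import ring lra.
Set Implicit Arguments. Unset Strict Implicit. Unset Printing Implicit Defensive.
Import Order.TTheory GRing.Theory Num.Theory numFieldNormedType.Exports.
Local Open Scope classical_set_scope.
Local Open Scope ring_scope.

(** Two obstacles shape the proof. The right-hand side is not locally Lipschitz on C: comparing
    x(-tau(x)) with x'(-tau(x')) costs a Lipschitz constant of one of the two functions. So each
    comparison has on one side a function whose Lipschitz constant is known in advance, such as a
    reference solution or a point of [M]. Moreover t -> u(t, w, x) need not be continuous into
    W^{1,oo} while t < r, since translation is not continuous in that norm; orbits are then no paths
    of the phase space. Perturbations are therefore measured in C wherever possible: at times t >=
    r, sup-close data give solutions close in W^{1,oo}. In particular the domain of attraction is
    open even for the topology of C, and connectedness rests on this. Along [M] neither obstacle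
    remains: minimality gives Pi(r, M) = M, so its points are C^1, and on a compact set of W^{1,oo}
    the two topologies agree. The contraction by 1/4 leaves another 1/4 for the remainder of the
    first-order expansion, and the sum 1/2 can be iterated. The contraction time depends on the
    point and the direction; only its bounds r and [N] are uniform. *)

(** * Right derivatives, mean value inequalities and antiderivatives *)

Section MeanValue.
Context {R : realType} {V : normedModType R}.
Implicit Types (y : R -> V) (m : R -> R).

(** The right derivative ignores the past of [y], so solutions can be glued at a time without a
    matching condition from the left. The slope is multiplied out, so that error terms simply add
    up. *)
Definition rderiv y (t : R) (d : V) : Prop :=
  forall e, 0 < e -> \forall h \near 0^'+, `|y (t + h) - y t - h *: d| <= e * h.

(** A continuity argument: with slack [e] per unit of time, the set of times up to which the
    inequality holds is closed and can be continued to the right. Only increments of [m] occur,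
    because [m] will be built from the measure of an open set, which need not be differentiable. *)
Lemma dini_mean_value y m a b : a <= b -> continuous y -> continuous m ->
  (forall t, a <= t -> t < b -> forall e, 0 < e ->
    \forall h \near 0^'+, `|y (t + h) - y t| <= m (t + h) - m t + e * h) ->
  `|y b - y a| <= m b - m a.
Proof.
move=> ab cy cm H; apply/ler_addgt0Pl => e0 e0p.
(* Over [a, b] this slack accumulates to at most [e0]; the added 1 keeps the denominator positive
   when a = b. *)
pose e := e0 / (b - a + 1).
have ba1 : 0 < b - a + 1 by rewrite ltr_wpDl// subr_ge0.
have ep : 0 < e by rewrite divr_gt0.
pose g s := `|y s - y a| - (m s - m a + e * (s - a)).
have cg : continuous g.
  move=> s; apply: cvgB.
    by apply: cvg_norm; apply: cvgB; [exact: cy|exact: cvg_cst].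
  apply: cvgD; first by apply: cvgB; [exact: cm|exact: cvg_cst].
  by apply: cvgMr; apply: cvgB; [exact: cvg_id|exact: cvg_cst].
pose S := [set t | a <= t <= b /\ forall s, a <= s <= t -> g s <= 0].
have Sa : S a.
  split; first by rewrite lexx.
  by move=> s; rewrite -eq_le => /eqP <-; rewrite /g !subrr normr0 mulr0 addr0 subrr.
have hS : has_sup S by split; [exists a|exists b => t [/andP[]]].
pose c := sup S.
have ac : a <= c by apply: sup_upper_bound.
have cb : c <= b by apply: ge_sup; [exists a|move=> t [/andP[]]].
have gc_lt s : a <= s -> s < c -> g s <= 0.
  move=> as_ sc.
  have [t St st] : exists2 t, S t & s < t.
    have cs0 : 0 < c - s by rewrite subr_gt0.
    by have [t St] := sup_adherent cs0 hS; rewrite opprB addrC subrK => st; exists t.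
  by apply: St.2; rewrite as_ ltW.
have gc : g c <= 0.
  move: ac; rewrite le_eqVlt => /predU1P[<-|ac]; first by apply: Sa.2; rewrite lexx.
  rewrite leNgt; apply/negP => gc0.
  have /cvgrPdist_lt /(_ _ gc0) [d /= d0 dP] := cg c.
  have [s [as_ sc sd]] : exists s, [/\ a <= s, s < c & `|c - s| < d].
    exists (Num.max a (c - d / 2)); split.
    - by rewrite le_max lexx.
    - by rewrite gt_max ac/= ltrBlDr ltrDl divr_gt0.
    - have : c - d / 2 <= Num.max a (c - d / 2) by rewrite le_max lexx orbT.
      have : Num.max a (c - d / 2) <= c by rewrite ge_max ltW//= gerBl divr_ge0// ltW.
      by move=> h1 h2; rewrite ger0_norm ?subr_ge0//; lra.
  have := dP s sd; have := gc_lt s as_ sc => /[swap].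
  by rewrite ltr_norml => /andP[_]; lra.
have cS : S c.
  split; first by rewrite ac cb.
  move=> s /andP[as_]; rewrite le_eqVlt => /predU1P[->//|]; exact: gc_lt.
suff bc : b <= c.
  have -> : b = c by apply/eqP; rewrite eq_le bc cb.
  have := gc; rewrite /g subr_le0 => /le_trans; apply.
  rewrite addrC lerD2r /e mulrAC ler_pdivrMr// ler_pM2l//.
  by rewrite lerD// ?lerB// ler01 || lra.
rewrite leNgt; apply/negP => cltb.
have /= [d d0 dP] := H c ac cltb e ep.
pose h := Num.min (d / 2) (b - c).
have h0 : 0 < h by rewrite lt_min divr_gt0//= subr_gt0.
have Sch : S (c + h).
  split.
    have : h <= b - c by rewrite ge_min lexx orbT.
    by move: ac h0; lra.
  move=> s /andP[as_ sch]; have [sc|cs] := leP s c.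
    by apply: cS.2; rewrite as_.
  have hd : h <= d / 2 by rewrite ge_min lexx.
  have sc0 : 0 < s - c by rewrite subr_gt0.
  have scd : `|0 - (s - c)| < d by rewrite sub0r normrN gtr0_norm//; move: (d0); lra.
  have := dP (s - c) scd sc0; rewrite (addrC c) subrK => k1.
  have k2 := gc; rewrite /g in k2.
  have k3 : `|y s - y a| <= `|y s - y c| + `|y c - y a|.
    by rewrite (le_trans _ (ler_normD _ _))// addrA subrK.
  rewrite /g; move: k1 k2 k3; lra.
have : c + h <= c by apply: sup_upper_bound.
by rewrite gerDl leNgt h0.
Qed.

(** The condition on [m] says that its lower right Dini derivative is at least [d']; for an
    exponential barrier this is just convexity. *)
Lemma mean_value y m a b : a <= b -> continuous y -> continuous m ->
  (forall t, a <= t -> t < b -> exists d d', [/\ rderiv y t d,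
     forall e, 0 < e -> \forall h \near 0^'+, h * d' <= m (t + h) - m t + e * h & `|d| <= d']) ->
  `|y b - y a| <= m b - m a.
Proof.
move=> ab cy cm H; apply: dini_mean_value => // t at_ tb e e0.
have [d [d' [yd md dd]]] := H t at_ tb.
have e20 : 0 < e / 2 by rewrite divr_gt0.
near=> h.
have h0 : 0 < h by near: h; exact: nbhs_right_gt.
have k1 : `|y (t + h) - y t - h *: d| <= e / 2 * h by near: h; exact: yd.
have k2 : h * d' <= m (t + h) - m t + e / 2 * h by near: h; exact: md.
have -> : y (t + h) - y t = (y (t + h) - y t - h *: d) + h *: d by rewrite subrK.
apply: le_trans (ler_normD _ _) _; rewrite normrZ gtr0_norm//.
have k3 : h * `|d| <= h * d' by rewrite ler_pM2l.
lra.
Unshelve. all: by end_near. Qed.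

Lemma mean_value_cst y k a b : a <= b -> continuous y ->
  (forall t, a <= t -> t < b -> exists2 d, rderiv y t d & `|d| <= k) ->
  `|y b - y a| <= k * (b - a).
Proof.
move=> ab cy H; rewrite mulrBr.
apply: (@mean_value y ( *%R k)) => //.
  by move=> s; apply: cvgMr; exact: cvg_id.
move=> t at_ tb; have [d yd dk] := H t at_ tb; exists d, k; split => // e e0.
near=> h.
have h0 : 0 < h by near: h; exact: nbhs_right_gt.
by have := mulr_gt0 e0 h0; lra.
Unshelve. all: by end_near. Qed.

Lemma rderivB y z t d d' : rderiv y t d -> rderiv z t d' ->
  rderiv (fun s => y s - z s) t (d - d').
Proof.
move=> yd zd e e0; have e20 : 0 < e / 2 by rewrite divr_gt0.
near=> h.
have k1 : `|y (t + h) - y t - h *: d| <= e / 2 * h by near: h; exact: yd.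
have k2 : `|z (t + h) - z t - h *: d'| <= e / 2 * h by near: h; exact: zd.
rewrite (_ : _ - _ = (y (t + h) - y t - h *: d) - (z (t + h) - z t - h *: d')).
  by apply: le_trans (ler_normB _ _) _; lra.
by rewrite scalerBr !opprD !opprK [X in X + _ = _]addrACA [RHS]addrACA.
Unshelve. all: by end_near. Qed.

Lemma rderivZ y t (c : R) d : rderiv y t d -> rderiv (fun s => c *: y s) t (c *: d).
Proof.
move=> yd e e0; have c0 : 0 < `|c| + 1 by rewrite ltr_wpDl.
have e20 : 0 < e / (`|c| + 1) by rewrite divr_gt0.
near=> h.
have k1 : `|y (t + h) - y t - h *: d| <= e / (`|c| + 1) * h by near: h; exact: yd.
have h0 : 0 < h by near: h; exact: nbhs_right_gt.
rewrite scalerA mulrC -scalerA -!scalerBr normrZ.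
apply: le_trans (_ : (`|c| + 1) * (e / (`|c| + 1) * h) <= _).
  by apply: ler_pM => //; rewrite lerDl.
by rewrite mulrA (mulrC (_ + _)) divfK// gt_eqF.
Unshelve. all: by end_near. Qed.

Lemma rderiv_cst (c : V) t : rderiv (fun=> c) t 0.
Proof.
move=> e e0; near=> h; rewrite subrr scaler0 subrr normr0.
have h0 : 0 < h by near: h; exact: nbhs_right_gt.
by rewrite mulr_ge0// ltW.
Unshelve. all: by end_near. Qed.

Lemma rderiv_shift y (s t : R) d : rderiv y (s + t) d -> rderiv (fun u => y (s + u)) t d.
Proof. by move=> H e e0; apply: filterS (H e e0) => h; rewrite addrA. Qed.

Lemma rderiv_eq y z t d : (\forall h \near 0^'+, z (t + h) = y (t + h)) -> z t = y t ->
  rderiv y t d -> rderiv z t d.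
Proof.
move=> H e0 yd e ep; near=> h; rewrite e0 (near H h)//.
near: h; exact: yd.
Unshelve. all: by end_near. Qed.

End MeanValue.

Section DerivativeWithin.
Context {R : realType} {V : normedModType R}.
Implicit Types (f : R -> V) (A : set R).

Lemma has_deriv_withinP A f t d : has_deriv_within A f t d <->
  forall e, 0 < e -> exists2 dl, 0 < dl & forall s, A s -> `|t - s| < dl ->
    `|f s - f t - (s - t) *: d| <= e * `|s - t|.
Proof.
have E s : s != t -> `|f s - f t - (s - t) *: d| = `|d - slope f t s| * `|s - t|.
  move=> st; rewrite mulrC -normrZ scalerBr /slope scalerA mulfV ?subr_eq0// scale1r.
  by rewrite -normrN opprB.
split.
  move=> /cvgrPdist_le H e e0; have [dl /= dl0 dlP] := H e e0.
  exists dl => // s As ts; have [->|st] := eqVneq s t.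
    by rewrite !subrr scale0r normr0 subrr normr0 mulr0.
  by rewrite E// ler_wpM2r//; apply: dlP.
move=> H; apply/cvgrPdist_le => e e0; have [dl dl0 dlP] := H e e0.
exists dl => //= s ts st As.
by have := dlP s As ts; rewrite E// ler_pM2r// normr_gt0 subr_eq0.
Qed.

Lemma has_deriv_within_rderiv A f t d : (\forall h \near 0^'+, A (t + h)) ->
  has_deriv_within A f t d -> rderiv f t d.
Proof.
move=> At /has_deriv_withinP H e e0; have [dl dl0 dlP] := H e e0.
near=> h.
have h0 : 0 < h by near: h; exact: nbhs_right_gt.
have /dlP : A (t + h) by near: h; exact: At.
rewrite opprD addrA subrr sub0r normrN (addrC t) addrK (gtr0_norm h0); apply.
by near: h; exact: nbhs_right_lt.
Unshelve. all: by end_near. Qed.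

Lemma has_deriv_within_sub A B f t d : A `<=` B ->
  has_deriv_within B f t d -> has_deriv_within A f t d.
Proof.
move=> AB /has_deriv_withinP H; apply/has_deriv_withinP => e e0.
by have [dl dl0 dlP] := H e e0; exists dl => // s /AB; exact: dlP.
Qed.

Lemma derivable_rderiv f t : derivable f t 1 -> rderiv f t ('D_1 f t).
Proof.
move=> dft; have tt : t \in `]t - 1, t + 1[ by rewrite in_itv/=; lra.
have [H _] := derivable_within tt dft.
apply: has_deriv_within_rderiv H; near=> h => /=; rewrite in_itv/=.
have h0 : 0 < h by near: h; exact: nbhs_right_gt.
have h1 : h < 1 by near: h; exact: nbhs_right_lt.
by lra.
Unshelve. all: by end_near. Qed.

End DerivativeWithin.

Lemma rderiv_coord {R : realType} n (G : R -> 'rV[R]_n) t (d : 'rV[R]_n) :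
  (forall j, rderiv (fun s => G s 0 j : R) t (d 0 j)) -> rderiv G t d.
Proof.
move=> H e e0.
have F := nbhs_filter (0 : R).
have {}H := @filter_forall _ _ _ _ (at_right_proper_filter 0) (fun j => H j e e0).
near=> h.
have h0 : 0 < h by near: h; exact: nbhs_right_gt.
rewrite [leLHS]/Num.Def.normr/= mx_normrE.
apply: bigmax_le; first by rewrite mulr_ge0 ?ltW.
move=> [i j] _; rewrite (ord1 i) !mxE/=; move: j; near: h; exact: H.
Unshelve. all: by end_near. Qed.

Lemma antiderivative1 {R : realType} (f : R -> R) : continuous f ->
  exists G : R -> R, [/\ continuous G, forall t, t <= 0 -> G t = 0 &
    forall t, 0 <= t -> rderiv G t (f t)].
Proof.
move=> cf.
(* Starting the integral at -1 makes 0 an interior point, so that the fundamental theorem of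
   calculus also applies at time 0. *)
pose F (x : R) : R := (\int[lebesgue_measure]_(t in [set` `[-1, x]%R]) (f t))%R.
have dF x : -1 < x -> derivable F x 1 /\ derive1 F x = f x.
  move=> x1; apply: (@continuous_FTC1_closed R f (-1) x (x + 1)) => //.
  - by rewrite ltrDl.
  - apply: continuous_compact_integrable; first exact: segment_compact.
    by apply: continuous_subspaceT => ?; exact: cf.
  - exact: cf.
exists (fun t => F (Num.max t 0) - F 0); split.
- move=> x.
  have cF : F (Num.max t 0) @[t --> x] --> F (Num.max x 0).
    apply: (@continuous_comp R R R (fun t => Num.max t 0) F x).
      by apply: continuous_max; [exact: cvg_id|exact: cvg_cst].
    apply: differentiable_continuous; apply/derivable1_diffP.
    by have [] := dF (Num.max x 0); rewrite // lt_max (ltrN10 R) orbT.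
  by apply: cvgB; [exact: cF|exact: cvg_cst].
- by move=> t t0; rewrite max_r// subrr.
- move=> t t0; have [d1 d2] : derivable F t 1 /\ derive1 F t = f t.
    by apply: dF; rewrite (lt_le_trans _ t0).
  have := derivable_rderiv d1; rewrite -derive1E d2.
  move=> H; apply: (@rderiv_eq _ _ (fun s => F s - F 0)) => /=.
  + near=> h; rewrite max_l// addr_ge0//; near: h; apply: nbhs_right_ge.
  + by rewrite max_l.
  + rewrite -[f t]subr0; apply: rderivB; [exact: H|exact: rderiv_cst].
Unshelve. all: by end_near. Qed.

Lemma antiderivative {R : realType} n (f : R -> 'rV[R]_n) : continuous f ->
  exists G : R -> 'rV[R]_n, [/\ continuous G, forall t, t <= 0 -> G t = 0 &
    forall t, 0 <= t -> rderiv G t (f t)].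
Proof.
move=> cf.
have cfj j : continuous (fun t => f t 0 j : R).
  move=> t; apply: (@continuous_comp _ _ _ f (fun A : 'rV[R]_n => A 0 j)); first exact: cf.
  exact: coord_continuous.
have [G HG] := choice (fun j => antiderivative1 (cfj j)).
exists (fun t => \row_j G j t); split.
- move=> t; apply/cvgrPdist_le => e e0.
  have H j : \forall s \near t, `|G j t - G j s| <= e.
    by have [/(_ t) /cvgrPdist_le /(_ e e0)] := HG j.
  have {}H := @filter_forall _ _ _ _ _ H.
  near=> s; rewrite [leLHS]/Num.Def.normr/= mx_normrE.
  apply: bigmax_le; first exact: ltW.
  move=> [i j] _; rewrite (ord1 i) !mxE/=; move: j; near: s; exact: H.
- by move=> t t0; apply/rowP => j; rewrite !mxE; have [_ ->] := HG j.
- move=> t t0; apply: rderiv_coord => j.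
  have [_ _ /(_ t t0) H] := HG j.
  by apply: rderiv_eq H; [near=> h; rewrite mxE|rewrite mxE].
Unshelve. all: by end_near. Qed.

(** * The norm of W^{1,oo} as a Lipschitz constant *)

Section Wnorm.
Context {R : realType} {r : {posnum R}} {n : nat}.
Notation W := (Wspace r n).
Notation C := (Cspace r n).
Implicit Types (x : W).
Let mu := @lebesgue_measure R.

Lemma wnormE x : `|x| = wnorm x. Proof. by []. Qed.

Lemma Cnorm_ub (x : C) s : `|x s| <= `|x|.
Proof. by rewrite -Cfun_clamp supnorm_ub// clamp_seg. Qed.

Lemma Cnorm_le (x : C) k : (forall s, `|x s| <= k) -> `|x| <= k.
Proof. by move=> H; apply: supnorm_le => s _. Qed.

Lemma wnorm_Cnorm x : `|x : C| <= `|x|.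
Proof. by rewrite wnormE le_max lexx. Qed.

Lemma wnorm_le x k : 0 < k -> `|x : C| <= k ->
  (forall s t, `|x s - x t| <= k * `|s - t|) -> `|x| <= k.
Proof.
move=> k0 xk xl; rewrite wnormE ge_max xk/=.
apply: fine_essdot_le; first exact: ltW.
have := ae_has_dot k0 xl; apply: filterS; first exact: (ae_filter_ringOfSetsType mu).
by move=> s H ss; have [] := H ss.
Qed.

Section OpenMeasure.
Variables (a : R) (U : set R).
Hypotheses (oU : open U) (Ufin : (mu U < +oo)%E).
Let phi u := fine (mu (U `&` `]a, u]%classic)).

Let mes u v : measurable (U `&` `]u, v]%classic : set (measurableTypeR R)).
Proof. by apply: measurableI; [exact: open_measurable|exact: measurable_itv]. Qed.

Let fin u v : mu (U `&` `]u, v]%classic) \is a fin_num.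
Proof.
rewrite ge0_fin_numE//; apply: le_lt_trans Ufin; apply: le_measure => //.
- by rewrite inE; exact: mes.
- by rewrite inE; exact: open_measurable.
Qed.

Let phiD u v : a <= u -> u <= v -> phi v = phi u + fine (mu (U `&` `]u, v]%classic)).
Proof.
move=> au uv; rewrite /phi -fineD//; congr fine.
rewrite -measureU//; last first.
  apply/seteqP; split => // z /= [[_ h1] [_ h2]].
  move: h1 h2; rewrite !in_itv/= => /andP[_ zu] /andP[uz _].
  by move: (le_lt_trans zu uz); rewrite ltxx.
congr (mu _); rewrite -setIUr; congr (_ `&` _).
by rewrite -itv_bndbnd_setU//= bnd_simp.
Qed.

(** Take for [g] the measure of [U] between [a] and [u]. It has slope 1 on [U] and small total
    growth when [U] is small, so a multiple of it pays for the points where nothing is known about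
    the derivative. *)
Lemma open_measure_cont : exists g : R -> R, [/\ continuous g,
  forall u v, u <= v -> g u <= g v,
  forall u, U u -> a <= u -> \forall h \near 0^'+, h <= g (u + h) - g u &
  forall u, a <= u -> g u - g a <= fine (mu U)].
Proof.
have mulen u v : u <= v -> fine (mu (U `&` `]u, v]%classic)) <= v - u.
  move=> uv; rewrite -lee_fin fineK//.
  apply: (@le_trans _ _ (mu (`]u, v]%classic))).
    by apply: le_measure; rewrite ?inE.
  by rewrite /mu lebesgue_measure_itv/= lte_fin; case: ltP => // _; rewrite lee_fin subr_ge0.
pose g u := phi (Num.max a u).
have gmono u v : u <= v -> g u <= g v.
  move=> uv; rewrite /g (@phiD (Num.max a u) (Num.max a v))//.
  - by rewrite lerDl fine_ge0.
  - by rewrite le_max lexx.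
  - by rewrite ge_max !le_max lexx uv orbT.
have glip u v : u <= v -> g v - g u <= v - u.
  move=> uv; rewrite /g (@phiD (Num.max a u) (Num.max a v))//; last 2 first.
  - by rewrite le_max lexx.
  - by rewrite ge_max !le_max lexx uv orbT.
  rewrite addrAC subrr add0r; apply: le_trans (mulen _ _ _) _.
    by rewrite ge_max !le_max lexx uv orbT.
  by rewrite /Num.max; case: ltP => h1; case: ltP => h2; lra.
exists g; split => //.
- move=> u; apply/cvgrPdist_lt => e e0; exists e => //= v uv.
  apply: le_lt_trans uv; have [vu|/ltW uv] := leP v u.
    by rewrite !ger0_norm ?subr_ge0 ?gmono// glip.
  by rewrite ler0_norm ?subr_le0 ?gmono// opprB ler0_norm ?subr_le0// opprB glip.
- move=> u Uu au.
  have /nbhs_ballP[d /= d0 dU] := open_nbhs_nbhs (conj oU Uu).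
  near=> h.
  have h0 : 0 < h by near: h; exact: nbhs_right_gt.
  have hd : h < d by near: h; exact: nbhs_right_lt.
  have uh : u <= u + h by rewrite lerDl ltW.
  rewrite /g (max_r au) (max_r (le_trans au uh)).
  rewrite (@phiD u (u + h))// addrAC subrr add0r.
  rewrite setIidr; last first.
    move=> z; rewrite /= in_itv/= => /andP[z1 z2]; apply: dU.
    by rewrite /ball/= distrC ger0_norm ?subr_ge0 ?ltW//; lra.
  by rewrite /mu lebesgue_measure_itv/= lte_fin ltrDl h0 -EFinD/= addrAC subrr add0r.
- move=> u au; rewrite /g maxxx (max_r au).
  rewrite (@phiD a u)// addrAC subrr add0r -lee_fin !fineK//; last first.
    by rewrite ge0_fin_numE.
  by apply: le_measure; rewrite ?inE//; exact: open_measurable.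
Unshelve. all: by end_near. Qed.

End OpenMeasure.

(* A Lipschitz function whose derivative is almost everywhere bounded by [c] is
   [c]-Lipschitz: the exceptional null set is covered by an open set of small
   measure, on which the Lipschitz constant is used. *)
Lemma wnorm_lip x s t : `|x s - x t| <= `|x| * `|s - t|.
Proof.
wlog st : s t / s <= t.
  by move=> H; have [/H//|/ltW/H] := leP s t; rewrite distrC (distrC t).
suff H a b : a \in seg r -> b \in seg r -> a <= b -> `|x b - x a| <= `|x| * (b - a).
  have cl : clamp r s <= clamp r t.
    rewrite /clamp ge_max le_max lexx/= le_max; apply/orP; right.
    by rewrite le_min ge_min st ge_min lexx orbT.
  rewrite -(Cfun_clamp x s) -(Cfun_clamp x t) distrC.
  apply: le_trans (H _ _ (clamp_seg _ _) (clamp_seg _ _) cl) _.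
  rewrite ler_wpM2l//; apply: le_trans (clamp_lip r _ _).
  by rewrite distrC ler_norm.
move=> aS bS ab; apply/ler_addgt0Pl => e e0.
have /lipsegP[K K0 xK] := valP x.
have := ae_has_dotW x.
have F := ae_filter_ringOfSetsType mu.
move=> /filterI /(_ (ae_dot_le x)) [B [mB B0 BP]].
(* With measure below [e / K], the summand [K * g] of the comparison function grows by at most [e]
   in total. *)
have [U [oU BU Ue]] : exists U, [/\ open U, B `<=` U & (mu U < (e / K)%:E)%E].
  have [||U [oU BU Ue]] := @lebesgue_regularity_outer R B (e / K) mB; rewrite ?divr_gt0//.
    by rewrite [X in (X < _)%E](_ : _ = 0%E) ?ltey//; exact: B0.
  exists U; split => //; apply: le_lt_trans Ue.
  have mU : measurable U by exact: open_measurable.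
  apply: (@le_trans _ _ (mu B + mu (U `\` B))%E).
    by rewrite -[in leLHS](setDUK BU); apply: measureU2 => //; exact: measurableD.
  by rewrite [X in (X + _)%E](_ : _ = 0%E) ?add0e//; exact: B0.
have Ufin : (mu U < +oo)%E by apply: lt_trans Ue _; rewrite ltry.
have [g [cg gm gU gtot]] := @open_measure_cont a U oU Ufin.
pose m u := `|x| * u + K * g u.
have : `|x b - x a| <= m b - m a.
  apply: dini_mean_value => //.
  - exact: Cfun_continuous.
  - move=> u; apply: cvgD; first by apply: cvgMr; exact: cvg_id.
    by apply: cvgMr; exact: cg.
  move=> u au ub e1 e10.
  have [uB|uB] := pselect (B u).
    have H := gU u (BU _ uB) au.
    near=> h.
    have h0 : 0 < h by near: h; exact: nbhs_right_gt.
    have gh : h <= g (u + h) - g u by near: h; exact: H.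
    apply: le_trans (xK _ _) _; rewrite (addrC u) addrK gtr0_norm// (addrC h).
    have k1 : K * h <= K * (g (u + h) - g u) by rewrite ler_pM2l.
    have k2 : 0 <= `|x| * h by rewrite mulr_ge0// ltW.
    have k3 := mulr_gt0 e10 h0.
    by rewrite /m; lra.
  have uS : u \in seg r.
    move: aS bS; rewrite !inE /seg/= !in_itv/= => /andP[a1 a2] /andP[b1 b2].
    by rewrite (le_trans a1 au)/= (le_trans (ltW ub)).
  have [/(_ uS) dx /(_ uS) dl] : (u \in seg r -> has_deriv_within (seg r) x u (dot x u)) /\
      (u \in seg r -> `|dot x u| <= fine (essdot x)).
    by apply: contrapT => nP; apply: uB; apply: BP => /=.
  have {}dl : `|dot x u| <= `|x| by rewrite wnormE le_max dl orbT.
  have : rderiv x u (dot x u).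
    apply: has_deriv_within_rderiv dx; near=> h.
    have h0 : 0 < h by near: h; exact: nbhs_right_gt.
    have hd : h < b - u by near: h; apply: nbhs_right_lt; rewrite subr_gt0.
    move: uS bS; rewrite !inE /seg/= !in_itv/= => /andP[u1 u2] /andP[b1 b2].
    by apply/andP; split; lra.
  move=> /(_ _ e10) H; near=> h.
  have h0 : 0 < h by near: h; exact: nbhs_right_gt.
  have k0 : `|x (u + h) - x u - h *: dot x u| <= e1 * h by near: h; exact: H.
  rewrite -(subrK (h *: dot x u) (x (u + h) - x u)).
  apply: le_trans (ler_normD _ _) _; rewrite normrZ gtr0_norm//.
  have k1 : h * `|dot x u| <= h * `|x| by rewrite ler_pM2l.
  have k2 : 0 <= K * (g (u + h) - g u).
    by rewrite mulr_ge0 ?subr_ge0 ?gm ?lerDl ?ltW.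
  by rewrite /m; move: k0 k1 k2; lra.
move/le_trans; apply.
have k1 : K * (g b - g a) <= e.
  rewrite -ler_pdivlMl// mulrC; apply: le_trans (gtot _ ab) _.
  by rewrite -lee_fin fineK ?ge0_fin_numE// ltW.
by rewrite /m; move: k1; lra.
Unshelve. all: by end_near. Qed.

End Wnorm.

(** * Compactness, Gronwall and segments *)

Section ProductContinuity.
Context {X T U : topologicalType}.

Lemma continuous_fst (p : T * U) : {for p, continuous fst}.
Proof. by case: p => x y; exact: cvg_fst. Qed.

Lemma continuous_snd (p : T * U) : {for p, continuous snd}.
Proof. by case: p => x y; exact: cvg_snd. Qed.

Lemma continuous_pair (f : X -> T) (g : X -> U) (x : X) :
  {for x, continuous f} -> {for x, continuous g} ->
  {for x, continuous (fun a => (f a, g a))}.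
Proof. by move=> cf cg; exact: (cvg_pair cf cg). Qed.

End ProductContinuity.

Section RealTools.
Context {R : realType}.

Lemma real_induction (a b : R) (P : R -> Prop) : a <= b -> P a ->
  (forall s t, a <= s -> s <= t -> P t -> P s) ->
  (forall c, a <= c -> c < b -> P c -> exists2 d, 0 < d & P (c + d)) ->
  (forall c, a < c -> c <= b -> (forall s, a <= s -> s < c -> P s) -> P c) ->
  P b.
Proof.
move=> ab Pa mono step lim.
pose S := [set t | a <= t <= b /\ P t].
have Sa : S a by rewrite /S/= lexx.
have hS : has_sup S by split; [exists a|exists b => t [/andP[]]].
pose c := sup S.
have ac : a <= c by apply: sup_upper_bound.
have cb : c <= b by apply: ge_sup; [exists a|move=> t [/andP[]]].
have Pc : P c.
  move: (ac); rewrite le_eqVlt => /predU1P[<-//|altc]; apply: lim => // s as_ sc.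
  have cs0 : 0 < c - s by rewrite subr_gt0.
  have [t [_ Pt]] := sup_adherent cs0 hS; rewrite opprB addrC subrK => st.
  by apply: mono (ltW st) Pt.
move: (cb); rewrite le_eqVlt => /predU1P[<-//|cltb].
have [d d0 Pd] := step c ac cltb Pc.
have : S (Num.min (c + d) b).
  split.
    by rewrite le_min ge_min lexx orbT ab (le_trans ac) ?lerDl ?ltW.
  apply: mono Pd; last by rewrite ge_min lexx.
  by rewrite le_min ab (le_trans ac) ?lerDl ?ltW.
move=> /(sup_upper_bound hS); rewrite leNgt => /negP; case.
by rewrite lt_min cltb ltrDl d0.
Qed.

Lemma first_time (g : R -> R) a b : a <= b -> continuous g -> g a < 0 -> 0 <= g b ->
  exists2 c, a < c <= b & 0 <= g c /\ forall s, a <= s -> s < c -> g s < 0.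
Proof.
move=> ab cg ga gb; apply: contrapT => H.
have : forall s, a <= s -> s <= b -> g s < 0.
  apply: (@real_induction a b (fun t => forall s, a <= s -> s <= t -> g s < 0)) => //.
  - by move=> s a1 a2; have -> : s = a by apply/eqP; rewrite eq_le a1 a2.
  - by move=> s t _ st Pt u au us; apply: Pt => //; exact: le_trans st.
  - move=> c ac cb Pc; have gc : g c < 0 by apply: Pc.
    have /cvgrPdist_lt /(_ (- g c)) := cg c; rewrite oppr_gt0 => /(_ gc) [d /= d0 dP].
    exists (d / 2); first by rewrite divr_gt0.
    move=> s as_ scd; have [sc|cs] := leP s c; first exact: Pc.
    have /dP : `|c - s| < d by rewrite distrC gtr0_norm ?subr_gt0//; move: d0; lra.
    by rewrite ltr_norml => /andP[+ _]; lra.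
  - move=> c ac cb Pc s as_; rewrite le_eqVlt => /predU1P[->|sc]; last exact: (Pc s).
    rewrite ltNge; apply/negP => gc; apply: H; exists c; first by rewrite ac cb.
    by split => // u au uc; exact: (Pc u).
by move=> /(_ b ab (lexx b)); rewrite ltNge gb.
Qed.

Lemma expR_diff_ge (B t h : R) : B * h * expR (B * t) <= expR (B * (t + h)) - expR (B * t).
Proof.
have -> : expR (B * (t + h)) - expR (B * t) = expR (B * t) * (expR (B * h) - 1).
  by rewrite mulrDr expRD; ring.
rewrite mulrC ler_wpM2l ?expR_ge0//.
by have := expR_ge1Dx (B * h); lra.
Qed.

(** The source of nearly all uniformity over compact sets below. Upper bounds fit as well as radii:
    a constant is entered as [d^-1], which makes the predicate monotone in [d]. *)
Lemma compact_unif {T : topologicalType} (K : set T) (P : R -> T -> Prop) : compact K ->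
  (forall d d' x, 0 < d' -> d' <= d -> P d x -> P d' x) ->
  (forall x, K x -> exists2 d, 0 < d & \forall x' \near x, P d x') ->
  exists2 d, 0 < d & forall x, K x -> P d x.
Proof.
move=> /compact_near_coveringP cK mono loc.
have : \forall d \near 0^'+, K `<=` P d.
  apply: cK => x Kx; have [d d0 H] := loc x Kx.
  exists ([set x' | P d x'], [set d' | 0 < d' <= d]) => /=.
    split => //; near=> d'; apply/andP; split; near: d'; first exact: nbhs_right_gt.
    exact: nbhs_right_le.
  by move=> [x' d'] /= [Pdx /andP[d'0 dd']]; apply: mono Pdx.
move=> H; near (0 : R)^'+ => d; exists d; first by near: d; exact: nbhs_right_gt.
by near: d.
Unshelve. all: by end_near. Qed.

End RealTools.

Section Gronwall.
Context {R : realType} {V : normedModType R}.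

(* As long as [`|d|] stays below the barrier [A e^((L+1)t)], its growth is at most
   that of the barrier, since [L m + c <= (L + 1) m] for [c <= A <= m]. *)
Lemma gronwall (d : R -> V) (a A c L rho T : R) : 0 <= T -> 0 <= L -> continuous d ->
  (forall t, t <= 0 -> `|d t| <= a) -> a < A -> c <= A ->
  A * expR ((L + 1) * T) <= rho ->
  (forall t, 0 <= t -> t < T -> (forall s, s <= t -> `|d s| <= rho) ->
     exists2 d', rderiv d t d' & forall m, (forall s, s <= t -> `|d s| <= m) ->
       `|d'| <= L * m + c) ->
  forall t, t <= T -> `|d t| <= A * expR ((L + 1) * T).
Proof.
move=> T0 L0 cd da aA cA Arho H.
have A0 : 0 < A by apply: le_lt_trans aA; apply: le_trans (da 0 (lexx _)).
pose m t := A * expR ((L + 1) * t).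
have L10 : 0 < L + 1 by rewrite ltr_wpDl.
have mmono s t : s <= t -> m s <= m t.
  by move=> st; rewrite /m ler_pM2l// ler_expR ler_pM2l.
have m0 : m 0 = A by rewrite /m mulr0 expR0 mulr1.
have cm : continuous m.
  move=> s; apply: cvgMr.
  apply: (@continuous_comp R R R ( *%R (L + 1)) expR s); last exact: continuous_expR.
  by apply: cvgMr; exact: cvg_id.
suff key t : 0 <= t -> t <= T -> `|d t| < m t.
  move=> t tT; have [t0|/ltW t0] := leP t 0.
    by apply: le_trans (da _ t0) _; apply: (@le_trans _ _ (m 0)); [rewrite m0 ltW|exact: mmono].
  by apply: le_trans (ltW (key _ t0 tT)) _; exact: mmono.
move=> t0 tT; rewrite ltNge; apply/negP => Hn.
have cg : continuous (fun s => `|d s| - m s).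
  move=> s; apply: cvgB; last exact: cm.
  by apply: cvg_norm; exact: cd.
have [||c1 /andP[c10 c1t] [gc1 gs]] := first_time t0 cg.
- by rewrite subr_lt0 m0 (le_lt_trans (da _ _)).
- by rewrite subr_ge0.
have : `|d c1 - d 0| <= m c1 - m 0.
  apply: mean_value => //; first exact: ltW.
  move=> s s0 sc.
  have bd u : u <= s -> `|d u| <= m s.
    move=> us; have [u0|/ltW u0] := leP u 0.
      by apply: le_trans (da _ u0) _; apply: (@le_trans _ _ (m 0)); [rewrite m0 ltW|exact: mmono].
    by apply: le_trans (mmono _ _ us); rewrite -subr_le0 ltW// gs// (le_lt_trans us).
  have sT : s < T by apply: lt_le_trans sc _; exact: le_trans tT.
  have [|d' dd' Hd'] := H s s0 sT.
    (* Below the barrier [d] stays within [rho], and only there is the bound on its derivative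
       assumed. *)
    move=> u us; apply: le_trans (bd _ us) _; apply: le_trans Arho.
    by apply: mmono; exact: ltW.
  exists d', ((L + 1) * m s); split => //; last first.
    apply: le_trans (Hd' _ bd) _; rewrite mulrDl mul1r lerD2l.
    by apply: le_trans cA _; apply: (@le_trans _ _ (m 0)); [rewrite m0|exact: mmono].
  move=> e e0; near=> h.
  have h0 : 0 < h by near: h; exact: nbhs_right_gt.
  have k1 : A * ((L + 1) * h * expR ((L + 1) * s)) <= A * (expR ((L + 1) * (s + h)) - expR ((L + 1) * s)).
    by rewrite ler_pM2l// expR_diff_ge.
  have k2 := mulr_gt0 e0 h0.
  by rewrite /m; move: k1 k2; lra.
(* The gap [a < A] at time 0 persists up to [c1], which contradicts the contact with the barrier
   there. *)
have k1 : `|d c1| <= `|d c1 - d 0| + `|d 0| by rewrite (le_trans _ (ler_normD _ _))// subrK.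
have k2 := da 0 (lexx _).
by move: gc1 k1 k2 aA; rewrite m0; lra.
Unshelve. all: by end_near. Qed.

Lemma gronwall0 (d : R -> V) (L T : R) : 0 <= T -> 0 <= L -> continuous d ->
  (forall t, t <= 0 -> d t = 0) ->
  (forall t, 0 <= t -> t < T ->
     exists2 d', rderiv d t d' & forall m, (forall s, s <= t -> `|d s| <= m) ->
       `|d'| <= L * m) ->
  forall t, t <= T -> d t = 0.
Proof.
move=> T0 L0 cd d0 H t tT; apply/eqP; rewrite -normr_le0.
apply/ler_addgt0Pl => e e0; rewrite addr0.
pose A := e / expR ((L + 1) * T).
have A0 : 0 < A by rewrite divr_gt0// expR_gt0.
have -> : e = A * expR ((L + 1) * T) by rewrite /A divfK// gt_eqF ?expR_gt0.
apply: (@gronwall d 0 A 0 L (A * expR ((L + 1) * T)) T) => //.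
- by move=> s s0; rewrite d0// normr0.
- exact: ltW.
- move=> s s0 sT _; have [d' ? Hd'] := H s s0 sT; exists d' => // m Hm.
  by rewrite addr0 Hd'.
Qed.

End Gronwall.

Section Segments.
Context {R : realType} {r : {posnum R}} {n : nat}.
Notation E := 'rV[R]_n.
Notation C := (Cspace r n).
Notation W := (Wspace r n).
Notation histC := (@histC R r n).
Notation histW := (@histW R r n).
Implicit Types (y z : R -> E) (t : R).

Definition lipto y (K t : R) := forall s u, s <= t -> u <= t -> `|y s - y u| <= K * `|s - u|.
Definition lipC (x : C) (K : R) := forall s u, `|x s - x u| <= K * `|s - u|.

Lemma clamp_le0 s : clamp r s <= 0.
Proof. by have := clamp_seg r s; rewrite inE /seg/= in_itv/= => /andP[]. Qed.

Lemma clamp_geN s : - r%:num <= clamp r s.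
Proof. by have := clamp_seg r s; rewrite inE /seg/= in_itv/= => /andP[]. Qed.

Lemma clampK s : clamp r (clamp r s) = clamp r s.
Proof. by rewrite clamp_id// clamp_seg. Qed.

Lemma clamp_ge0 s : 0 <= s -> clamp r s = 0.
Proof. by move=> s0; rewrite /clamp min_r// max_r// oppr_le0. Qed.

Lemma continuous_clamp : continuous (clamp r).
Proof.
move=> x; apply/cvgrPdist_lt => e e0; exists e => //= y xy.
by apply: le_lt_trans xy; exact: clamp_lip.
Qed.

Lemma Cfun_ge0 (x : C) s : 0 <= s -> x s = x 0.
Proof. by move=> s0; rewrite -Cfun_clamp clamp_ge0. Qed.

Lemma histCE y t s : (forall u, {for u, continuous (fun u => y (t + clamp r u))}) ->
  histC y t s = y (t + clamp r s).
Proof.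
move=> cy; rewrite /Defs.histC insubdK// inE; split => //.
by apply/funext => u /=; rewrite clampK.
Qed.

Lemma histC_cont y t s : continuous y -> histC y t s = y (t + clamp r s).
Proof.
move=> cy; apply: histCE => u.
apply: (@continuous_comp R R E (fun u => t + clamp r u) y u); last exact: cy.
by apply: cvgD; [exact: cvg_cst|exact: continuous_clamp].
Qed.

Lemma histC_le y t k : continuous y ->
  (forall s, t - r%:num <= s -> s <= t -> `|y s| <= k) -> `|histC y t| <= k.
Proof.
move=> cy H; apply: Cnorm_le => s; rewrite histC_cont//; apply: H.
  by rewrite lerD2l clamp_geN.
by rewrite gerDl clamp_le0.
Qed.

Lemma histCB_le y z t k : continuous y -> continuous z ->
  (forall s, t - r%:num <= s -> s <= t -> `|y s - z s| <= k) -> `|histC y t - histC z t| <= k.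
Proof.
move=> cy cz H; apply: Cnorm_le => s.
rewrite -[X in `|X|]/(histC y t s - histC z t s) !histC_cont//; apply: H.
  by rewrite lerD2l clamp_geN.
by rewrite gerDl clamp_le0.
Qed.

Lemma histC_eq y z t : continuous y -> continuous z ->
  (forall s, t - r%:num <= s -> s <= t -> y s = z s) -> histC y t = histC z t.
Proof.
move=> cy cz H; apply/eqP; rewrite -subr_eq0 -normr_le0; apply: histCB_le => // s s1 s2.
by rewrite H// subrr normr0.
Qed.

Lemma continuous_histC y : continuous y -> continuous (fun t => histC y t).
Proof.
move=> cy t; apply/cvgrPdist_le => e e0.
have [d d0 dP] : exists2 d, 0 < d & forall u, u \in `[t - r%:num, t] ->
    forall v, `|u - v| < d -> `|y u - y v| <= e.
  have := @compact_unif R _ `[t - r%:num, t]%classic (fun d u => forall v, `|u - v| < d -> `|y u - y v| <= e).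
  apply; first exact: segment_compact.
    by move=> d d' x _ dd H v vd; apply: H; exact: lt_le_trans dd.
  move=> u _; have e20 : 0 < e / 2 by rewrite divr_gt0.
  have /cvgrPdist_le /(_ _ e20) [d /= d0 dP] := cy u.
  exists (d / 2); first by rewrite divr_gt0.
  exists (d / 2); rewrite /= ?divr_gt0// => u' uu' v u'v.
  have -> : y u' - y v = (y u - y v) - (y u - y u') by rewrite opprB [RHS]addrC subrKA.
  apply: le_trans (ler_normB _ _) _; rewrite (splitr e) lerD//; apply: dP => /=.
    rewrite (le_lt_trans (ler_distD u' _ _))// (splitr d) ltrD//.
  by apply: lt_trans uu' _; rewrite ltr_pdivrMr// ltr_pMr// ltr1n.
exists d => //= t' tt'; apply: Cnorm_le => s.
rewrite -[X in `|X|]/(histC y t s - histC y t' s) !histC_cont//; apply: dP.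
  by rewrite in_itv/= lerD2l clamp_geN gerDl clamp_le0.
by rewrite opprD addrACA subrr addr0.
Qed.

Lemma histC_lip y t K : continuous y -> 0 <= K -> lipto y K t -> lipC (histC y t) K.
Proof.
move=> cy K0 yK s u; rewrite !histC_cont//.
apply: le_trans (yK _ _ _ _) _; rewrite ?gerDl ?clamp_le0//.
rewrite opprD addrACA subrr add0r ler_wpM2l//; exact: clamp_lip.
Qed.

Lemma lipC_in (x : C) K : lipC x K -> x \in @lipseg R r n.
Proof.
move=> xK; apply/lipsegP; exists (`|K| + 1); first by rewrite ltr_wpDl.
move=> s t; apply: le_trans (xK s t) _; rewrite ler_wpM2r//.
by rewrite (le_trans (ler_norm _))// lerDl.
Qed.

Lemma histWE y t K : lipC (histC y t) K -> histW y t = histC y t :> C.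
Proof. by move=> H; rewrite /Defs.histW insubdK//; exact: lipC_in H. Qed.

Lemma W_lip (x : W) : lipC x `|x|. Proof. exact: wnorm_lip. Qed.

Lemma C_ext (x y : C) : (forall s, - r%:num <= s -> s <= 0 -> x s = y s) -> x = y.
Proof.
move=> H; apply: Cspace_eq => s; rewrite inE /seg/= in_itv/= => /andP[]; exact: H.
Qed.

Lemma W_ext (x y : W) : (x = y :> C) -> x = y. Proof. by move=> H; exact/val_inj. Qed.

Lemma lipto_mono y K t t' : t' <= t -> lipto y K t -> lipto y K t'.
Proof. by move=> tt' H s u st ut; apply: H; exact: le_trans tt'. Qed.

Lemma lipto_glue y K T : 0 <= T -> lipto y K 0 ->
  (forall s u, 0 <= s -> s <= u -> u <= T -> `|y u - y s| <= K * (u - s)) -> lipto y K T.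
Proof.
move=> T0 H0 H1; have W s u : s <= u -> u <= T -> `|y s - y u| <= K * `|s - u|.
  move=> su uT; rewrite distrC (distrC s) (ger0_norm (_ : 0 <= u - s)) ?subr_ge0//.
  have [s0|/ltW s0] := leP 0 s; first exact: H1.
  have [u0|/ltW u0] := leP u 0.
    by rewrite distrC (le_trans (H0 _ _ s0 u0))// distrC ger0_norm ?subr_ge0.
  have k1 := H1 0 u (lexx _) u0 uT; have k2 := H0 0 s (lexx _) s0.
  apply: le_trans (ler_distD (y 0) _ _) _.
  move: k1 k2; rewrite subr0 sub0r ger0_norm ?oppr_ge0//; lra.
move=> s u sT uT; have [/W|/ltW/W H] := leP s u; first exact.
by rewrite distrC (distrC s); apply: H.
Qed.

End Segments.

(** * Equations with locally almost Lipschitz right-hand side *)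

Section GeometricSequences.
Context {R : realType} {V : completeNormedModType R}.

Lemma geometric_cauchy_cvg (u : nat -> V) (m : R) : 0 <= m ->
  (forall k, `|u k.+1 - u k| <= m / 2 ^+ k) ->
  cvgn u /\ forall k, `|u k - limn u| <= 2 * m / 2 ^+ k.
Proof.
move=> m0 H.
have p0 k : 0 < (2 : R) ^+ k by rewrite exprn_gt0.
have cu : cvgn u.
  have : cvgn (series (telescope u)).
    apply: normed_cvg; apply: (@series_le_cvg _ _ (geometric m 2^-1)).
    - by move=> k; exact: normr_ge0.
    - by move=> k; rewrite /geometric/= mulr_ge0// exprn_ge0.
    - by move=> k; rewrite /geometric/= exprVn; exact: H.
    - by apply: is_cvg_geometric_series; rewrite ger0_norm// invf_lt1// ltr1n.
  rewrite telescopeK => /cvg_ex[l ul]; apply/cvg_ex; exists (l + u 0%N).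
  have : (fun k => (u k - u 0%N) + u 0%N) @ \oo --> l + u 0%N.
    by apply: cvgD; [exact: ul|exact: cvg_cst].
  by under eq_fun do rewrite subrK.
split => // k.
have step j : `|u k - u (k + j)%N| <= 2 * m / 2 ^+ k.
  (* The exact partial sum of the geometric series is what makes the induction on [j] close. *)
  suff : `|u k - u (k + j)%N| <= 2 * m / 2 ^+ k * (1 - (2 ^+ j)^-1).
    move/le_trans; apply; apply: ler_piMr; first by rewrite divr_ge0 ?mulr_ge0// ltW.
    by rewrite gerBl invr_ge0 ltW.
  elim: j => [|j IH]; first by rewrite addn0 subrr normr0 expr0 invr1 subrr mulr0.
  rewrite addnS; apply: le_trans (ler_distD (u (k + j)%N) _ _) _.
  have h1 := H (k + j)%N; rewrite distrC in h1.
  apply: le_trans (lerD IH h1) _.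
  rewrite exprD exprS !invfM (_ : _ - (2^-1 / 2 ^+ j) = (1 - (2 ^+ j)^-1) + (2 ^+ j)^-1 / 2); last first.
    by have := p0 j; move=> ?; field; rewrite ?gt_eqF.
  rewrite [leRHS]mulrDr lerD2l le_eqVlt; apply/orP; left; apply/eqP.
  by have := p0 j; have := p0 k => ? ?; field; rewrite ?gt_eqF.
apply/ler_addgt0Pr => e e0.
have /cvgrPdist_le /(_ _ e0) [N _ NP] : u @ \oo --> limn u by [].
apply: le_trans (ler_distD (u (k + N)%N) _ _) _; apply: lerD; first exact: step.
by rewrite distrC; apply: NP; rewrite /= leq_addl.
Unshelve. all: by end_near. Qed.

End GeometricSequences.

Lemma geometric_cauchy_row {R : realType} n (u : nat -> 'rV[R]_n) (m : R) : 0 <= m ->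
  (forall k, `|u k.+1 - u k| <= m / 2 ^+ k) ->
  exists l : 'rV[R]_n, forall k, `|u k - l| <= 2 * m / 2 ^+ k.
Proof.
move=> m0 H.
have Hj j k : `|u k.+1 0 j - u k 0 j| <= m / 2 ^+ k.
  apply: le_trans (H k); rewrite [leRHS]/Num.Def.normr/= mx_normrE.
  by apply: le_trans; last exact: (le_bigmax _ _ (0, j)); rewrite !mxE.
exists (\row_j limn (fun k => u k 0 j : R^o)) => k.
rewrite [leLHS]/Num.Def.normr/= mx_normrE; apply: bigmax_le.
  by rewrite !mulr_ge0// invr_ge0 exprn_ge0.
move=> [i j] _; rewrite (ord1 i) !mxE/=.
by have [_] := @geometric_cauchy_cvg R R^o (fun k => u k 0 j) m m0 (Hj j); apply.
Qed.

Section GeneralEquation.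
Context {R : realType} {r : {posnum R}} {n : nat}.
Notation E := 'rV[R]_n.
Notation C := (Cspace r n).
Notation W := (Wspace r n).
Notation histC := (@histC R r n).
Implicit Types (y z : R -> E) (t : R) (G : R -> C -> E).

(* With a state-dependent delay the right-hand side is locally Lipschitz only when one of
   the two arguments compared has a prescribed Lipschitz constant. *)
Definition regular_rhs G :=
  continuous (fun q : R * C => G q.1 q.2) /\
  forall t0 x0 K, 0 <= t0 -> exists2 d : R, 0 < d & exists2 L : R, 0 <= L &
    forall t (phi psi : C), 0 <= t -> `|t - t0| < d -> `|phi - x0| < d -> `|psi - x0| < d ->
      lipC phi K -> `|G t phi - G t psi| <= L * `|phi - psi|.

(* Right derivatives suffice: by continuity of [G] they are ordinary derivatives. *)
Definition gsol G (x : C) T y :=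
  [/\ continuous y, forall t, t <= 0 -> y t = x t &
      forall t, 0 <= t -> t < T -> rderiv y t (G t (histC y t))].

Lemma regular_shift G b : 0 <= b -> regular_rhs G -> regular_rhs (fun t => G (b + t)).
Proof.
move=> b0 [cG LG]; split.
  move=> q; apply: (@continuous_comp _ _ _ (fun q : R * C => (b + q.1, q.2)) (fun q : R * C => G q.1 q.2)); last exact: cG.
  apply: continuous_pair; last exact: continuous_snd.
  by apply: cvgD; [exact: cvg_cst|exact: continuous_fst].
move=> t0 x0 K t00; have [|d d0 [L L0 H]] := LG (b + t0) x0 K; first by rewrite addr_ge0.
exists d => //; exists L => // t phi psi t_ge0 tt0; apply: H; first by rewrite addr_ge0.
by rewrite opprD addrACA subrr add0r.
Qed.

Lemma continuous_rhs G y : continuous (fun q : R * C => G q.1 q.2) -> continuous y ->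
  continuous (fun t => G t (histC y t)).
Proof.
move=> cG cy t.
apply: (@continuous_comp _ _ _ (fun t => (t, histC y t)) (fun q : R * C => G q.1 q.2)); last exact: cG.
by apply: continuous_pair; [exact: cvg_id|exact: continuous_histC].
Qed.

Lemma lip_continuous y K : (forall s u, `|y s - y u| <= K * `|s - u|) -> continuous y.
Proof.
move=> H t; apply/cvgrPdist_lt => e e0.
have K0 : 0 < `|K| + 1 by rewrite ltr_wpDl.
exists (e / (`|K| + 1)); first by rewrite /= divr_gt0.
move=> s /= ts; apply: le_lt_trans (H _ _) _.
apply: (@le_lt_trans _ _ ((`|K| + 1) * `|t - s|)).
  by rewrite ler_wpM2r// (le_trans (ler_norm _))// lerDl.
by rewrite mulrC -ltr_pdivlMr.
Qed.

(** Picard iteration on the curves that prolong [x] and are [K]-Lipschitz on the whole line. Since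
    [K] dominates both the norm of [x] and a local bound [B] of the right-hand side, this class is
    invariant; and within it the right-hand side is Lipschitz, as all iterates share the constant
    [K]. *)
Lemma picard_existence G (x : W) : regular_rhs G -> exists2 h, 0 < h & exists y, gsol G x h y.
Proof.
move=> [cG LG].
pose B := `|G 0 x| + 1; pose K := Num.max `|x| B.
have B0 : 0 < B by rewrite ltr_wpDl.
have K0 : 0 < K by rewrite lt_max B0 orbT.
have [d2 d20 [L L0 HL]] := LG 0 x K (lexx _).
have [d1 d10 HB] : exists2 d1, 0 < d1 & forall t phi, `|t| < d1 -> `|phi - (x : C)| < d1 -> `|G t phi| <= B.
  have /cvgrPdist_lt /(_ _ ltr01) /nbhs_ballP[d /= d0 dP] := cG (0, x : C).
  exists d => // t phi td phid; rewrite /B addrC -lerBlDr.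
  apply: le_trans (lerB_dist _ _) _; rewrite ltW// distrC; apply: (dP (t, phi)).
  split; rewrite /= -ball_normE/=; first by rewrite sub0r normrN.
  by rewrite distrC.
pose d := Num.min d1 d2.
have d0 : 0 < d by rewrite lt_min d10 d20.
(* The three bounds keep the time within [d], keep the segments within [d] of [x] (by [K * h < d]),
   and make the iteration a contraction by 1/2 (by [L * h <= 1 / 2]). *)
pose h := Num.min (d / 2) (Num.min (d / (2 * K)) (2 * (L + 1))^-1).
have L10 : 0 < L + 1 by rewrite ltr_wpDl.
have h0 : 0 < h by rewrite !lt_min !divr_gt0 ?mulr_gt0//= invr_gt0 mulr_gt0.
have hd : h < d.
  by rewrite (le_lt_trans (_ : h <= d / 2)) ?ge_min ?lexx//; move: d0; lra.
have Khd : K * h < d.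
  apply: (@le_lt_trans _ _ (d / 2)); last by move: d0; lra.
  rewrite mulrC -ler_pdivlMr// -mulrA -invfM.
  by rewrite !ge_min lexx orbT.
have Lh : L * h <= 2^-1.
  apply: (@le_trans _ _ ((L + 1) * (2 * (L + 1))^-1)); last first.
    by rewrite invfM mulrCA divff ?mulr1// gt_eqF.
  apply: ler_pM => //; [exact: ltW|by rewrite lerDl|].
  by rewrite !ge_min lexx !orbT.
(* Freezing time outside [0, h] gives curves and integrands defined and continuous on the whole
   line. *)
pose clip t := Num.min (Num.max t 0) h.
have clip0 t : 0 <= clip t by rewrite /clip le_min le_max lexx orbT ltW.
have cliph t : clip t <= h by rewrite /clip ge_min lexx orbT.
have clip_id t : 0 <= t -> t <= h -> clip t = t by move=> t0 th; rewrite /clip max_l// min_l.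
have cclip : continuous clip.
  move=> t; apply: (@continuous_min _ _ (fun t => Num.max t 0) (fun=> h)); last exact: cvg_cst.
  by apply: (@continuous_max _ _ id (fun=> 0)); [exact: cvg_id|exact: cvg_cst].
pose g y t := G (clip t) (histC y (clip t)).
have cg y : continuous y -> continuous (g y).
  move=> cy t; apply: (@continuous_comp _ _ _ clip (fun t => G t (histC y t))).
    exact: cclip.
  exact: continuous_rhs.
have /choice[S HS] : forall y, exists A : R -> E, continuous y ->
    [/\ continuous A, forall t, t <= 0 -> A t = 0 & forall t, 0 <= t -> rderiv A t (g y t)].
  move=> y; have [cy|ncy] := pselect (continuous y); last by exists 0 => /ncy.
  by have [A HA] := antiderivative (cg _ cy); exists A.
pose Y y := (forall s u, `|y s - y u| <= K * `|s - u|) /\ forall t, t <= 0 -> y t = x t.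
have Yc y : Y y -> continuous y by move=> [/lip_continuous].
have Ynear y t : Y y -> 0 <= t -> t <= h -> `|histC y t - x| < d.
  move=> Yy t0 th; apply: le_lt_trans Khd; apply: Cnorm_le => s.
  rewrite -[X in `|X|]/(histC y t s - x s) histC_cont//; last exact: Yc.
  have [yK yx] := Yy; rewrite -[x s]Cfun_clamp -yx ?clamp_le0//.
  by apply: le_trans (yK _ _) _; rewrite addrK ger0_norm// ler_pM2l.
have gB y t : Y y -> `|g y t| <= B.
  move=> Yy; apply: HB.
    by rewrite ger0_norm//; apply: le_lt_trans (cliph _) (lt_le_trans hd _); rewrite ge_min lexx.
  by apply: lt_le_trans (Ynear _ _ _ _ _) _ => //; rewrite ge_min lexx.
pose Phi y t := x t + S y (Num.min t h).
have PhiY y : Y y -> Y (Phi y).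
  move=> Yy; have [cS S0 dS] := HS _ (Yc _ Yy).
  have Phi0 t : t <= 0 -> Phi y t = x t.
    by move=> t0; rewrite /Phi min_l ?(le_trans t0 (ltW h0))// S0// addr0.
  split => // s u.
  pose T := Num.max 0 (Num.max s u).
  have : lipto (Phi y) K T.
    apply: lipto_glue; first by rewrite le_max lexx.
      move=> s' u' s0 u0; rewrite !Phi0//; apply: le_trans (wnorm_lip _ _ _) _.
      by rewrite ler_wpM2r// le_max lexx.
    move=> s' u' s0 su uT; have u0 := le_trans s0 su.
    rewrite /Phi (Cfun_ge0 _ s0) (Cfun_ge0 _ u0) opprD addrACA subrr add0r.
    have ms0 : 0 <= Num.min s' h by rewrite le_min s0 ltW.
    have msu : Num.min s' h <= Num.min u' h by rewrite /Num.min; case: ltP => h1; case: ltP => h2; lra.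
    apply: le_trans (_ : B * (Num.min u' h - Num.min s' h) <= _).
      apply: mean_value_cst => // t st tu; exists (g y t); last exact: gB.
      by apply: dS; exact: le_trans st.
    apply: ler_pM; rewrite ?subr_ge0// ?(ltW B0)//; first by rewrite le_max lexx orbT.
    by rewrite /Num.min; case: ltP => h1; case: ltP => h2; lra.
  by apply; rewrite !le_max lexx !orbT.
have contr y z m : Y y -> Y z -> (forall s, `|y s - z s| <= m) -> forall t, `|Phi y t - Phi z t| <= m / 2.
  move=> Yy Yz yz t.
  have m0 : 0 <= m by apply: le_trans (yz 0).
  have [cSy Sy0 dSy] := HS _ (Yc _ Yy); have [cSz Sz0 dSz] := HS _ (Yc _ Yz).
  rewrite /Phi opprD addrACA subrr add0r.
  set t' := Num.min t h.
  have [t0|/ltW t0] := leP t' 0; first by rewrite Sy0// Sz0// subrr normr0 divr_ge0.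
  have t'h : t' <= h by rewrite ge_min lexx orbT.
  have : `|(S y t' - S z t') - (S y 0 - S z 0)| <= (L * m) * (t' - 0).
    apply: (@mean_value_cst _ _ (fun s => S y s - S z s)) => //.
      by move=> s; apply: cvgB; [exact: cSy|exact: cSz].
    move=> s s0 st; exists (g y s - g z s).
      by apply: rderivB; [exact: dSy|exact: dSz].
    have sh : s <= h by apply: ltW; exact: lt_le_trans t'h.
    rewrite /g clip_id//.
    have dd2 : d <= d2 by rewrite ge_min lexx orbT.
    apply: le_trans (HL _ _ _ _ _ _ _ _) _ => //.
    - by rewrite subr0 ger0_norm//; apply: le_lt_trans sh _; exact: lt_le_trans dd2.
    - by apply: lt_le_trans dd2; exact: Ynear.
    - by apply: lt_le_trans dd2; exact: Ynear.
    - apply: histC_lip; [exact: Yc|exact: ltW|]; move=> a b _ _; exact: Yy.1.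
    - rewrite ler_wpM2l//; apply: histCB_le; try exact: Yc.
      by move=> *; exact: yz.
  rewrite (Sy0 0 (lexx _)) (Sz0 0 (lexx _)) subrr !subr0 => /le_trans; apply.
  rewrite mulrAC mulrC; apply: ler_wpM2l => //; apply: le_trans Lh.
  by rewrite ler_wpM2l.
pose u k := iter k Phi x.
have uY k : Y (u k).
  elim: k => [|k]; last exact: PhiY.
  split => // s t /=; apply: le_trans (wnorm_lip _ _ _) _.
  by rewrite ler_wpM2r// le_max lexx.
pose m := 2 * K * h.
have u01 t : `|u 1%N t - u 0%N t| <= m.
  have m0 : 0 <= m by rewrite !mulr_ge0// ltW.
  rewrite /= /Phi addrAC subrr add0r.
  have [cS S0 dS] := HS _ (Yc _ (uY 0%N)).
  have [t0|/ltW t0] := leP t 0.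
    by rewrite S0 ?normr0// ge_min t0.
  rewrite -[X in `|X|]subr0 -(S0 0)//.
  have t'0 : 0 <= Num.min t h by rewrite le_min t0 ltW.
  apply: le_trans (mean_value_cst (k := B) t'0 cS _) _.
    move=> s s0 _; exists (g x s); first exact: dS.
    exact: (gB (u 0%N)).
  rewrite subr0; apply: (@le_trans _ _ (K * h)).
    apply: ler_pM => //; first exact: ltW.
      by rewrite le_max lexx orbT.
    by rewrite ge_min lexx orbT.
  by have := mulr_gt0 K0 h0; rewrite /m; lra.
have uk k t : `|u k.+1 t - u k t| <= m / 2 ^+ k.
  elim: k t => [|k IH] t; first by rewrite expr0 divr1.
  rewrite exprS invfM mulrCA mulrC; exact: (contr (u k.+1) (u k)).
have m0 : 0 <= m by apply: le_trans (u01 0).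
have /choice[y uy'] := fun t => @geometric_cauchy_row R n (fun k => u k t) m m0 (fun k => uk k t).
have uy k t : `|u k t - y t| <= 2 * m / 2 ^+ k by exact: uy'.
have Yy : Y y.
  have small e : 0 < e -> exists k : nat, 2 * m / 2 ^+ k <= e.
    move=> e0.
    have /cvgrPdist_le /(_ _ e0)[k _ kP] : geometric (2 * m) (2^-1 : R) @ \oo --> 0.
      by apply: cvg_geometric; rewrite ger0_norm// invf_lt1// ltr1n.
    exists k; have := kP k (leqnn k); rewrite /geometric/= sub0r normrN exprVn.
    exact: le_trans (ler_norm _).
  split.
    move=> s t; apply/ler_addgt0Pr => e e0.
    have [k ke] := small _ (divr_gt0 e0 (ltr0n _ 2)).
    have h1 := le_trans (uy k s) ke; have h2 := le_trans (uy k t) ke.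
    apply: le_trans (ler_distD (u k s) _ _) _; rewrite distrC (splitr e).
    rewrite [leRHS]addrCA; apply: lerD h1 _.
    apply: le_trans (ler_distD (u k t) _ _) _; apply: lerD h2.
    exact: (uY k).1.
  move=> t t0; apply/eqP; rewrite -subr_eq0 -normr_le0; apply/ler_addgt0Pr => e e0.
  rewrite add0r; have [k ke] := small _ e0.
  by apply: le_trans ke; rewrite -((uY k).2 t t0) distrC.
have yE : y = Phi y.
  apply/funext => t; apply/eqP; rewrite -subr_eq0 -normr_le0; apply/ler_addgt0Pr => e e0.
  rewrite add0r.
  have /cvgrPdist_le /(_ _ e0)[k _ kP] : geometric (2 * m) (2^-1 : R) @ \oo --> 0.
    by apply: cvg_geometric; rewrite ger0_norm// invf_lt1// ltr1n.
  have := kP k (leqnn k); rewrite /geometric/= sub0r normrN exprVn => ke.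
  have {}ke := le_trans (ler_norm _) ke.
  apply: le_trans (ler_distD (u k.+1 t) _ _) _.
  have h1 := uy k.+1 t; have h2 := contr (u k) y _ (uY k) Yy (uy k) t.
  rewrite distrC in h1; apply: le_trans (lerD h1 h2) _; apply: le_trans ke.
  by rewrite exprS invfM mulrCA -mulrDl -div1r -splitr mul1r || (rewrite exprS invfM; lra).
exists h => //; exists y; split; [exact: Yc|exact: Yy.2|].
move=> t t0 th; have [cS S0 dS] := HS _ (Yc _ Yy).
have -> : G t (histC y t) = g y t by rewrite /g clip_id// ltW.
(* On [0, h] the fixed point is [x 0 + S y]; it is written as a difference to match [rderivB]. *)
apply: (@rderiv_eq _ _ (fun s => S y s - (- x 0 : E))).
- rewrite yE -yE; near=> e; have e0 : 0 < e by near: e; exact: nbhs_right_gt.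
  have eh : e < h - t by near: e; apply: nbhs_right_lt; rewrite subr_gt0.
  rewrite [LHS](congr1 (@^~ (t + e)) yE) /Phi Cfun_ge0 ?addr_ge0// 1?ltW//.
  by rewrite min_l ?opprK 1?addrC//; move: eh; lra.
- by rewrite [LHS](congr1 (@^~ t) yE) /Phi Cfun_ge0// min_l ?opprK 1?addrC// ltW.
- by rewrite -[g y t]subr0; apply: rderivB; [exact: dS|exact: rderiv_cst].
Unshelve. all: by end_near. Qed.

End GeneralEquation.

(** * Uniqueness, gluing and continuation of solutions *)

Section Continuation.
Context {R : realType} {r : {posnum R}} {n : nat}.
Notation E := 'rV[R]_n.
Notation C := (Cspace r n).
Notation W := (Wspace r n).
Notation histC := (@histC R r n).
Notation histW := (@histW R r n).
Implicit Types (y z : R -> E) (t : R) (G : R -> C -> E) (x : W).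

Lemma bounded_on_segment y a b : continuous y ->
  exists2 M, 0 < M & forall t, a <= t -> t <= b -> `|y t| <= M.
Proof.
move=> cy.
have [d d0 H] : exists2 d, 0 < d & forall t, t \in `[a, b] -> `|y t| <= d^-1.
  apply: (@compact_unif R _ `[a, b]%classic (fun d t => `|y t| <= d^-1)).
  - exact: segment_compact.
  - by move=> d d' t d'0 dd' /le_trans; apply; rewrite lef_pV2// posrE// (lt_le_trans d'0).
  - move=> t _; exists (`|y t| + 1)^-1; first by rewrite invr_gt0 ltr_wpDl.
    rewrite invrK.
    have /cvgrPdist_le /(_ _ ltr01) := cy t; apply: filterS => s.
    rewrite -lerBlDl; apply: le_trans; rewrite distrC; exact: lerB_dist.
exists d^-1; first by rewrite invr_gt0.
by move=> t at_ tb; apply: H; rewrite in_itv/= at_.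
Qed.

Lemma gsol_mono G (x : C) T T' y : T' <= T -> gsol G x T y -> gsol G x T' y.
Proof.
by move=> TT [cy y0 dy]; split => // t t0 tT; apply: dy => //; exact: lt_le_trans TT.
Qed.

Lemma gsol_ext G (x : C) T y z : gsol G x T y -> continuous z ->
  (forall t, t < T -> z t = y t) -> (forall t, t <= 0 -> z t = x t) -> gsol G x T z.
Proof.
move=> [cy y0 dy] cz zy z0; split => // t t0 tT.
have -> : histC z t = histC y t.
  by apply: histC_eq => // s _ st; apply: zy; exact: le_lt_trans tT.
apply: rderiv_eq (dy t t0 tT); last exact: zy.
near=> h; apply: zy.
have : h < T - t by near: h; apply: nbhs_right_lt; rewrite subr_gt0.
by lra.
Unshelve. all: by end_near. Qed.

Lemma gsol_lip_bound G x T y B : 0 <= T -> gsol G x T y ->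
  (forall t, 0 <= t -> t < T -> `|G t (histC y t)| <= B) -> lipto y (Num.max `|x| B) T.
Proof.
move=> T0 [cy y0 dy] H; apply: lipto_glue => //.
  move=> s u s0 u0; rewrite !y0//; apply: le_trans (wnorm_lip _ _ _) _.
  by rewrite ler_wpM2r// le_max lexx.
move=> s u s0 su uT; apply: le_trans (_ : B * (u - s) <= _).
  apply: mean_value_cst => // t st tu.
  have t0 := le_trans s0 st; have tT := lt_le_trans tu uT.
  by exists (G t (histC y t)); [exact: dy|exact: H].
by rewrite ler_wpM2r ?subr_ge0// le_max lexx orbT.
Qed.

Lemma gsol_lip G x T y T' : continuous (fun q : R * C => G q.1 q.2) -> gsol G x T y ->
  T' < T -> exists2 K, 0 < K & lipto y K T'.
Proof.
move=> cG sy TT; have [cy y0 dy] := sy.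
have [M M0 HM] := @bounded_on_segment _ 0 (Num.max 0 T') (continuous_rhs cG cy).
exists (Num.max `|x| M); first by rewrite lt_max M0 orbT.
apply: (@lipto_mono _ _ _ _ (Num.max 0 T')); first by rewrite le_max lexx orbT.
have [T0|T0] := leP T' 0.
  move=> s u s0 u0; rewrite !y0//; apply: le_trans (wnorm_lip _ _ _) _.
  by rewrite ler_wpM2r// le_max lexx.
apply: (@gsol_lip_bound G) => //; first exact: ltW.
  exact: gsol_mono (ltW TT) sy.
by move=> t t0 tT; apply: HM => //; rewrite max_r ltW.
Qed.

(** The Lipschitz constant of one of the two solutions is enough for [regular_rhs]; [gsol_lip]
    supplies it for [y] on compact time intervals. Gronwall then gives uniqueness for a short time,
    and real induction does the rest. *)
Lemma gsol_unique G x T y z : regular_rhs G -> gsol G x T y -> gsol G x T z ->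
  forall t, t < T -> y t = z t.
Proof.
move=> [cG LG] sy sz t tT; have [cy y0 dy] := sy; have [cz z0 dz] := sz.
have [t0|/ltW t0] := leP t 0; first by rewrite y0// z0.
suff : forall s, s <= t -> y s = z s by apply.
apply: (@real_induction R 0 t (fun t => forall s, s <= t -> y s = z s)) => //.
- by move=> s s0; rewrite y0// z0.
- by move=> s u _ su H v vs; apply: H; exact: le_trans su.
- move=> c c0 ct Hc.
  have [K K0 yK] := gsol_lip cG sy tT.
  have [d d0 [L L0 HL]] := LG c (histC y c) K c0.
  have /cvgrPdist_lt /(_ _ d0) [dy1 /= dy10 Hy] := continuous_histC (r := r) cy (x := c).
  have /cvgrPdist_lt /(_ _ d0) [dz1 /= dz10 Hz] := continuous_histC (r := r) cz (x := c).
  pose e := Num.min (Num.min d (t - c)) (Num.min dy1 dz1).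
  have e0 : 0 < e by rewrite !lt_min d0 dy10 dz10 subr_gt0 ct.
  have [ed et ey ez] : [/\ e <= d, e <= t - c, e <= dy1 & e <= dz1].
    by rewrite /e !ge_min !lexx !orbT.
  exists e => // s sce.
  have : (fun u => y (c + u) - z (c + u)) (s - c) = 0.
    apply: (@gronwall0 R E (fun u => y (c + u) - z (c + u)) L e) => //; first exact: ltW.
    - have cs u : {for u, continuous (fun u => c + u)}.
        by apply: cvgD; [exact: cvg_cst|exact: cvg_id].
      move=> u; apply: cvgB.
        by apply: (@continuous_comp R R E (fun u => c + u) y); [exact: cs|exact: cy].
      by apply: (@continuous_comp R R E (fun u => c + u) z); [exact: cs|exact: cz].
    - by move=> u u0; rewrite Hc ?subrr// gerDl.
    - move=> u u0 ue.
      have cu0 : 0 <= c + u by rewrite addr_ge0.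
      have cuT : c + u < T by move: ue et tT; lra.
      have cut : c + u <= t by move: ue et; lra.
      exists (G (c + u) (histC y (c + u)) - G (c + u) (histC z (c + u))).
        by apply: rderivB; apply: rderiv_shift; [exact: dy|exact: dz].
      have du : `|c - (c + u)| < e by rewrite opprD addrA subrr sub0r normrN ger0_norm.
      move=> m Hm; apply: le_trans (HL _ _ _ _ _ _ _ _) _ => //.
      + by rewrite distrC; exact: lt_le_trans ed.
      + by rewrite distrC; apply: Hy; exact: lt_le_trans ey.
      + rewrite distrC (histC_eq (z := z) cy)//; last by move=> v _ vc; exact: Hc.
        by apply: Hz; exact: lt_le_trans ez.
      + apply: histC_lip => //; first exact: ltW.
        exact: lipto_mono yK.
      + rewrite ler_wpM2l//; apply: histCB_le => // v _ vu.
        by have := Hm (v - c); rewrite (addrC c) subrK; apply; rewrite lerBlDl.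
    - by rewrite lerBlDl.
  by rewrite /= (addrC c) subrK => /eqP; rewrite subr_eq0 => /eqP.
- move=> c c0 ct H s; rewrite le_eqVlt => /predU1P[->|sc]; last first.
    have [s0|/ltW s0] := leP s 0; first by rewrite y0// z0.
    exact: (H s).
  have cg : continuous (fun u => y u - z u).
    by move=> u; apply: cvgB; [exact: cy|exact: cz].
  apply/eqP; rewrite -subr_eq0 -normr_le0; apply/ler_addgt0Pr => e e0; rewrite add0r.
  have /cvgrPdist_le /(_ _ e0) [d /= d0 dP] := cg c.
  have [u [u0 uc ud]] : exists u, [/\ 0 <= u, u < c & `|c - u| < d].
    exists (Num.max 0 (c - d / 2)); split.
    - by rewrite le_max lexx.
    - by rewrite gt_max c0/= ltrBlDr ltrDl divr_gt0.
    - have m1 : c - d / 2 <= Num.max 0 (c - d / 2) by rewrite le_max lexx orbT.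
      have m2 : Num.max 0 (c - d / 2) <= c by rewrite ge_max ltW//= gerBl divr_ge0// ltW.
      by rewrite ger0_norm ?subr_ge0//; move: d0; lra.
  by have := dP u ud; rewrite (H u u0 uc u (lexx _)) subrr subr0.
Qed.

(** Clamped arguments replace a case distinction, so continuity of the glued curve is immediate. On
    the right of [T] the formula reduces to [y2] because [y2 0 = y T]. *)
Lemma gsol_glue G (x w : C) T S y y2 : 0 <= T -> gsol G x T y -> w = histC y T ->
  gsol (fun t => G (T + t)) w S y2 ->
  gsol G x (T + S) (fun t => y (Num.min t T) + (y2 (Num.max (t - T) 0) - y2 0)).
Proof.
move=> T0 [cy y0 dy] wE [cy2 y20 dy2].
set Y := (fun t => _).
have Y1 t : t <= T -> Y t = y t.
  by move=> tT; rewrite /Y min_l// max_r ?subr_le0// subrr addr0.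
have y2T t : - r%:num <= t -> t <= 0 -> y2 t = y (T + t).
  move=> rt t0; rewrite y20// wE histC_cont// clamp_id// inE /seg/= in_itv/=.
  by rewrite rt t0.
have Y2 t : T <= t -> Y t = y2 (t - T).
  move=> tT; rewrite /Y min_r// max_l ?subr_ge0//.
  by rewrite [y2 0]y2T ?oppr_le0// addr0 addrC subrK.
have cY : continuous Y.
  move=> t; apply: cvgD.
    apply: (@continuous_comp R R E (fun t => Num.min t T) y); last exact: cy.
    by apply: (@continuous_min _ _ id (fun=> T)); [exact: cvg_id|exact: cvg_cst].
  apply: cvgB; last exact: cvg_cst.
  apply: (@continuous_comp R R E (fun t => Num.max (t - T) 0) y2); last exact: cy2.
  apply: (@continuous_max _ _ (fun t => t - T) (fun=> 0)); last exact: cvg_cst.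
  by apply: cvgB; [exact: cvg_id|exact: cvg_cst].
split => //.
  by move=> t t0; rewrite Y1 ?y0//; exact: le_trans T0.
move=> t t0 tTS; have [tT|Tt] := ltP t T.
  rewrite (@histC_eq _ _ _ Y y)//; last by move=> s _ st; rewrite Y1// (le_trans st)// ltW.
  apply: rderiv_eq (dy t t0 tT); last by rewrite Y1// ltW.
  near=> h; rewrite Y1//.
  have : h < T - t by near: h; apply: nbhs_right_lt; rewrite subr_gt0.
  by lra.
have -> : histC Y t = histC y2 (t - T).
  apply: C_ext => s rs s0; rewrite !histC_cont// clamp_id; last first.
    by rewrite inE /seg/= in_itv/= rs s0.
  have [h1|h1] := leP T (t + s); first by rewrite Y2// addrAC.
  rewrite Y1 ?ltW// y2T; last 2 first.
  - by move: Tt rs; lra.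
  - by move: h1; lra.
  by congr y; ring.
have e1 : t = T + (t - T) by ring.
have h1 : 0 <= t - T by rewrite subr_ge0.
have h2 : t - T < S by rewrite ltrBlDl.
have := dy2 _ h1 h2; rewrite -e1 => H.
have : rderiv (fun s => y2 (- T + s)) t (G t (histC y2 (t - T))).
  by apply: rderiv_shift; rewrite addrC.
apply: rderiv_eq; last by rewrite Y2// addrC.
near=> h; have h0 : 0 < h by near: h; exact: nbhs_right_gt.
rewrite Y2 1?[RHS]addrC; last by move: Tt h0; lra.
by congr y2; ring.
Unshelve. all: by end_near. Qed.

(** Elements of C are extended by constants to the left of -r, and [gsol] prescribes all nonpositive
    times; hence the truncation at [- r]. *)
Lemma gsol_shift G (x : C) T s y : 0 <= s -> gsol G x T y ->
  gsol (fun t => G (s + t)) (histC y s) (T - s) (fun t => y (s + Num.max t (- r%:num))).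
Proof.
move=> s0 [cy y0 dy]; set Y := (fun t => y (s + _)).
have cY : continuous Y.
  move=> t; apply: (@continuous_comp R R E (fun t => s + Num.max t (- r%:num)) y); last exact: cy.
  apply: cvgD; first exact: cvg_cst.
  by apply: (@continuous_max _ _ id (fun=> - r%:num)); [exact: cvg_id|exact: cvg_cst].
have r0 : 0 < r%:num by [].
split => //.
  by move=> t t0; rewrite histC_cont// /Y /clamp min_l// maxC.
move=> t t0 tT.
have -> : histC Y t = histC y (s + t).
  apply: C_ext => u ru u0; rewrite !histC_cont// clamp_id; last first.
    by rewrite inE /seg/= in_itv/= ru u0.
  by rewrite /Y max_l ?addrA//; move: t0 ru; lra.
have H : rderiv (fun t => y (s + t)) t (G (s + t) (histC y (s + t))).
  by apply: rderiv_shift; apply: dy; [rewrite addr_ge0|rewrite addrC -ltrBrDr].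
apply: rderiv_eq H; last by rewrite /Y max_l//; move: t0 r0; lra.
near=> h; have h0 : 0 < h by near: h; exact: nbhs_right_gt.
by rewrite /Y max_l//; move: t0 r0 h0; lra.
Unshelve. all: by end_near. Qed.

Lemma gsol_union G x (b : \bar R) : regular_rhs G ->
  (forall T, (T%:E < b)%E -> exists y, gsol G x T y) ->
  exists Y : R -> E, forall T y, (T%:E < b)%E -> gsol G x T y -> forall t, t < T -> Y t = y t.
Proof.
move=> rG H.
have /choice[Y HY] : forall t, exists e : E, forall T y, (T%:E < b)%E -> gsol G x T y -> t < T -> e = y t.
  move=> t; have [[T [y [Tb sy tT]]]|N] := pselect (exists T y, [/\ (T%:E < b)%E, gsol G x T y & t < T]).
    exists (y t) => T' y' T'b sy' tT'.
    have m1 : t < Num.min T T' by rewrite lt_min tT.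
    apply: (gsol_unique rG _ _ m1).
      by apply: gsol_mono sy; rewrite ge_min lexx.
    by apply: gsol_mono sy'; rewrite ge_min lexx orbT.
  by exists 0 => T y Tb sy tT; exfalso; apply: N; exists T, y.
by exists Y => T y Tb sy t tT; exact: HY Tb sy tT.
Qed.

Lemma gsol_global G x : regular_rhs G -> (forall T, exists y, gsol G x T y) ->
  exists Y, forall T, gsol G x T Y.
Proof.
move=> rG H; have [Y HY] := @gsol_union G x +oo%E rG (fun T _ => H T).
have YE T y : gsol G x T y -> forall t, t < T -> Y t = y t.
  by move=> sy; apply: HY => //; exact: ltry.
exists Y => T; have [y sy] := H T; apply: gsol_ext (sy) _ _ _.
- move=> t; have [z sz] := H (t + 1); have [cz _ _] := sz.
  have H1 : \forall s \near t, Y s = z s.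
    near=> s; apply: (YE _ _ sz); near: s.
    by apply: lt_nbhsl; rewrite ltrDl.
  rewrite /continuous_at (YE _ _ sz) ?ltrDl//.
  by apply: cvg_trans (cz t); apply: near_eq_cvg; apply: filterS H1 => s ->.
- exact: YE.
- move=> t t0; have [z sz] := H 1; have [_ z0 _] := sz.
  by rewrite (YE _ _ sz) ?z0// (le_lt_trans t0).
Unshelve. all: by end_near. Qed.

(** A bounded right-hand side makes the solutions Lipschitz with a common constant, so they have a
    limit at [b]. The segment at [b] is then again Lipschitz, hence admissible initial data for
    [picard_existence]. *)
Lemma gsol_extend G x b : regular_rhs G -> 0 < b ->
  (forall T, T < b -> exists y, gsol G x T y) ->
  (exists B, forall T y, T < b -> gsol G x T y ->
     forall t, 0 <= t -> t < T -> `|G t (histC y t)| <= B) ->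
  exists2 T, b < T & exists y, gsol G x T y.
Proof.
move=> rG b0 H [B HB].
have [Y HY] : exists Y : R -> E, forall T y, (T%:E < b%:E)%E -> gsol G x T y -> forall t, t < T -> Y t = y t.
  by apply: gsol_union => // T; rewrite lte_fin; exact: H.
have YE T y : T < b -> gsol G x T y -> forall t, t < T -> Y t = y t.
  by move=> Tb; apply: HY; rewrite lte_fin.
pose K := Num.max `|x| `|B|.
have K0 : 0 <= K by rewrite le_max normr_ge0.
have Ylip s u : s < b -> u < b -> `|Y s - Y u| <= K * `|s - u|.
  move=> sb ub.
  have [T [sT uT T0 Tb]] : exists T, [/\ s < T, u < T, 0 <= T & T < b].
    exists ((Num.max (Num.max s u) 0 + b) / 2).
    have h1 : s <= Num.max (Num.max s u) 0 by rewrite !le_max lexx.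
    have h2 : u <= Num.max (Num.max s u) 0 by rewrite !le_max lexx orbT.
    have h3 : 0 <= Num.max (Num.max s u) 0 by rewrite !le_max lexx orbT.
    have h4 : Num.max (Num.max s u) 0 < b by rewrite !gt_max sb ub.
    by split; lra.
  have [y sy] := H T Tb; rewrite !(YE _ _ Tb sy)//.
  have yl := gsol_lip_bound T0 sy (HB T y Tb sy).
  apply: le_trans (yl _ _ (ltW sT) (ltW uT)) _; rewrite ler_wpM2r// /K.
  by rewrite ge_max; apply/andP; split; rewrite le_max ?lexx// ler_norm orbT.
have [l Hl] : exists l : E, forall t, t < b -> `|Y t - l| <= K * (b - t).
  pose u (k : nat) := Y (b - b / 2 ^+ k).
  have p0 k : 0 < (2 : R) ^+ k by rewrite exprn_gt0.
  have ub k : b - b / 2 ^+ k < b by rewrite gtrBl divr_gt0.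
  have [|k|l Hl] := @geometric_cauchy_row _ _ u (K * b).
  - by rewrite mulr_ge0// ltW.
  - apply: le_trans (Ylip _ _ (ub _) (ub _)) _.
    have -> : b - b / 2 ^+ k.+1 - (b - b / 2 ^+ k) = b / 2 ^+ k / 2.
      by rewrite exprS; field; rewrite gt_eqF.
    have bk := divr_gt0 b0 (p0 k).
    by rewrite -[leRHS]mulrA ler_wpM2l// ger0_norm; move: bk; lra.
  exists l => t tb; apply/ler_addgt0Pr => e e0.
  (* Two shares come from the distance of [u k] to the limit, one from the distance of its time to
     [b]. *)
  pose c := 3 * K * b.
  have c0 : 0 <= c by rewrite !mulr_ge0// ltW.
  have /cvgrPdist_le /(_ _ e0)[k _ kP] : geometric c (2^-1 : R) @ \oo --> 0.
    by apply: cvg_geometric; rewrite ger0_norm// invf_lt1// ltr1n.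
  have := kP k (leqnn k); rewrite /geometric/= sub0r normrN exprVn => ke.
  have {}ke := le_trans (ler_norm _) ke.
  apply: le_trans (ler_distD (u k) _ _) _.
  have k1 := Ylip t _ tb (ub k); have k2 := Hl k.
  have k3 : `|t - (b - b / 2 ^+ k)| <= (b - t) + b / 2 ^+ k.
    rewrite ler_norml; have := divr_gt0 b0 (p0 k) => ?; apply/andP; split; lra.
  have k4 : K * `|t - (b - b / 2 ^+ k)| <= K * ((b - t) + b / 2 ^+ k) by rewrite ler_wpM2l.
  have k5 : c / 2 ^+ k = 3 * (K * (b / 2 ^+ k)) by rewrite /c; ring.
  have k6 : 2 * (K * b) / 2 ^+ k = 2 * (K * (b / 2 ^+ k)) by ring.
  by move: k1 k2 k4 ke; rewrite k5 k6 -/(u k); lra.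
pose Z t := if t < b then Y t else l.
have Zlip s u : `|Z s - Z u| <= K * `|s - u|.
  rewrite /Z; case: ltP => sb; case: ltP => ub.
  - exact: Ylip.
  - apply: le_trans (Hl _ sb) _; rewrite ler_wpM2l//.
    by rewrite ler0_norm ?subr_le0 ?(le_trans (ltW sb))//; lra.
  - rewrite distrC; apply: le_trans (Hl _ ub) _; rewrite ler_wpM2l//.
    by rewrite ger0_norm ?subr_ge0 ?(le_trans (ltW ub))//; lra.
  - by rewrite subrr normr0 mulr_ge0.
have cZ := lip_continuous Zlip.
have sZ : gsol G x b Z.
  have Z0 t : t <= 0 -> Z t = x t.
    move=> t0; have tb : t < b / 2 by apply: le_lt_trans t0 _; rewrite divr_gt0.
    have b2 : b / 2 < b by move: b0; lra.
    have [y sy] := H _ b2; rewrite /Z (lt_trans tb b2) (YE _ _ b2 sy)//.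
    by have [_ y0 _] := sy; rewrite y0.
  split => // t t0 tb.
  pose T := (t + b) / 2; have [tT Tb] : t < T /\ T < b by rewrite /T; split; lra.
  have [y sy] := H T Tb.
  have [|_ _] := @gsol_ext G x T y Z sy cZ _ Z0.
    by move=> s sT; rewrite /Z (lt_trans sT Tb) (YE _ _ Tb sy).
  by apply.
have lipb : lipC (histC Z b) K by apply: histC_lip => // s u _ _; exact: Zlip.
pose w : W := histW Z b.
have wE : w = histC Z b :> C by apply: histWE lipb.
have [h h0 [y2 sy2]] := @picard_existence R r n _ w (regular_shift (ltW b0) rG).
exists (b + h); first by rewrite ltrDl.
by eexists; apply: (gsol_glue (ltW b0) sZ wE sy2).
Qed.

Lemma rderiv_linear (c : E) t : rderiv (fun u => u *: c) t c.
Proof.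
move=> e e0; near=> h; have h0 : 0 < h by near: h; exact: nbhs_right_gt.
by rewrite -scalerBl (addrC t) addrK subrr normr0 mulr_ge0// ltW.
Unshelve. all: by end_near. Qed.

(* Only the right derivative is prescribed, but the right-hand side is continuous. *)
Lemma rderiv_has_deriv y (g : R -> E) a (b : \bar R) : continuous y -> continuous g ->
  (forall t, a <= t -> (t%:E < b)%E -> rderiv y t (g t)) ->
  forall t, a <= t -> (t%:E < b)%E ->
    has_deriv_within [set s | a <= s /\ (s%:E < b)%E] y t (g t).
Proof.
move=> cy cg dy t at_ tb; apply/has_deriv_withinP => e e0.
have /cvgrPdist_le /(_ _ e0) [d /= d0 dP] := cg t.
exists d => // s [as_ sb] ts.
pose z u := y u - u *: g t.
have cz : continuous z.
  by move=> u; apply: cvgB; [exact: cy|apply: cvgZr_tmp; exact: cvg_id].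
have key u v : a <= u -> u <= v -> (v%:E < b)%E -> `|u - t| < d -> `|v - t| < d ->
    `|z v - z u| <= e * (v - u).
  move=> au uv vb ut vt; apply: mean_value_cst => // q uq qv.
  exists (g q - g t); last first.
    rewrite distrC; apply: dP; rewrite /= distrC.
    by move: ut vt; rewrite !ltr_norml => /andP[? ?] /andP[? ?]; apply/andP; split; lra.
  apply: rderivB; first by apply: dy; [exact: le_trans uq|apply: lt_trans vb; rewrite lte_fin].
  exact: rderiv_linear.
have zE : `|y s - y t - (s - t) *: g t| = `|z s - z t|.
  by rewrite /z scalerBl !opprD !opprK [in RHS]addrACA.
rewrite zE; have [st|/ltW st] := leP t s.
  rewrite ger0_norm ?subr_ge0//; apply: key => //; first by rewrite subrr normr0.
  by rewrite distrC.
rewrite distrC (distrC s) ger0_norm ?subr_ge0//; apply: key => //; last by rewrite subrr normr0.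
by rewrite distrC.
Qed.

End Continuation.

(** * Differential estimates *)

Section DifferentialEstimates.
Context {R : realType}.

Lemma norm_le_dist {V : normedModType R} (x y : V) : `|x| <= `|x - y| + `|y|.
Proof. by rewrite -[X in `|X| <= _](subrK y); exact: ler_normD. Qed.

Lemma linear_op_bounded {U V : normedModType R} (g : {linear U -> V}) : continuous g ->
  exists2 M, 0 < M & forall v, `|g v| <= M * `|v|.
Proof.
move=> /linear_bounded_continuous/linear_boundedP H.
near +oo_R => M; exists M; first by near: M; exact: nbhs_pinfty_gt.
by near: M.
Unshelve. all: by end_near. Qed.

Lemma opnorm_ub {U V : normedModType R} (f g : {linear U -> V}) : continuous f -> continuous g ->
  forall v, `|f v - g v| <= opnorm (f \- g) * `|v|.
Proof.
move=> /linear_op_bounded[M1 M10 H1] /linear_op_bounded[M2 M20 H2] v.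
have [->|v0] := eqVneq v 0; first by rewrite !linear0 addr0 !normr0 mulr0.
have nv : 0 < `|v| by rewrite normr_gt0.
rewrite -ler_pdivrMr//.
have -> : `|f v - g v| / `|v| = `|(f \- g) (`|v|^-1 *: v)|.
  by rewrite /= [f (_ *: _)]linearZ [g (_ *: _)]linearZ/= -scalerBr normrZ normfV normr_id mulrC.
apply: sup_upper_bound; last first.
  by exists (`|v|^-1 *: v) => //=; rewrite normrZ normfV normr_id mulVf// gt_eqF.
split; first by exists `|(f \- g) 0|; exists 0 => //=; rewrite normr0.
exists (M1 + M2) => _ [u /= u1 <-]; apply: le_trans (ler_normB _ _) _; apply: lerD.
  by apply: le_trans (H1 _) _; rewrite ger_pMr.
by apply: le_trans (H2 _) _; rewrite ger_pMr.
Qed.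

Lemma differentiable_rderiv {U V : normedModType R} (f : U -> V) a v (s : R) :
  differentiable f (a + s *: v) -> rderiv (fun s => f (a + s *: v)) s ('d f (a + s *: v) v).
Proof.
move=> df e e0.
have := @diff_derivable _ _ _ _ _ v df.
rewrite /derivable -[lim _]/('D_v f (a + s *: v)) deriveE// => /cvgrPdist_le /(_ e e0) H.
have {}H : \forall h \near 0^'+, `|'d f (a + s *: v) v -
    h^-1 *: ((f \o shift (a + s *: v)) (h *: v) - f (a + s *: v))| <= e.
  by have [d /= d0 dP] := H; exists d => // h hd h0; apply: dP => //; rewrite gt_eqF.
near=> h; have h0 : 0 < h by near: h; exact: nbhs_right_gt.
have : `|'d f (a + s *: v) v -
    h^-1 *: ((f \o shift (a + s *: v)) (h *: v) - f (a + s *: v))| <= e by near: h.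
rewrite /= (addrC (h *: v)) -addrA -scalerDl => k1.
rewrite mulrC -ler_pdivrMl// -[h^-1](@gtr0_norm _ h^-1) ?invr_gt0// -normrZ.
by rewrite scalerBr scalerA mulVf ?gt_eqF// scale1r distrC.
Unshelve. all: by end_near. Qed.

Lemma segment_estimate {U V : normedModType R} (f : U -> V) a b (l : V) k :
  (forall c, differentiable f c) ->
  (forall s, 0 <= s -> s <= 1 -> `|'d f (b + s *: (a - b)) (a - b) - l| <= k) ->
  `|f a - f b - l| <= k.
Proof.
move=> df H.
pose y (s : R) := f (b + s *: (a - b)) - s *: l.
have : `|y 1 - y 0| <= k * (1 - 0).
  apply: mean_value_cst => //.
    move=> s; apply: cvgB; last by apply: cvgZr_tmp; exact: cvg_id.
    apply: (@continuous_comp R U V (fun s => b + s *: (a - b)) f s); last first.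
      exact: differentiable_continuous.
    by apply: cvgD; [exact: cvg_cst|apply: cvgZr_tmp; exact: cvg_id].
  move=> s s0 s1; exists ('d f (b + s *: (a - b)) (a - b) - l).
    apply: rderivB; first exact: differentiable_rderiv.
    move=> e e0; near=> h; have h0 : 0 < h by near: h; exact: nbhs_right_gt.
    by rewrite -scalerBl (addrC s) addrK subrr normr0 mulr_ge0// ltW.
  by apply: H => //; exact: ltW.
by rewrite /y !scale1r !scale0r !subr0 addr0 (addrC b) subrK mulr1 addrAC.
Unshelve. all: by end_near. Qed.

Lemma ball_segment {V : normedModType R} (a b c : V) s d : 0 <= s -> s <= 1 ->
  `|a - c| < d -> `|b - c| < d -> `|b + s *: (a - b) - c| < d.
Proof.
move=> s0 s1 ac bc.
have -> : b + s *: (a - b) - c = s *: (a - c) + (1 - s) *: (b - c).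
  have -> : a - b = (a - c) - (b - c) by rewrite opprB subrKA.
  by rewrite addrAC scalerBr scalerBl scale1r addrCA.
apply: le_lt_trans (ler_normD _ _) _; rewrite !normrZ ger0_norm// ger0_norm ?subr_ge0//.
have [->|sn0] := eqVneq s 0; first by rewrite mul0r add0r subr0 mul1r.
have sp : 0 < s by rewrite lt_def sn0.
have k1 : s * `|a - c| < s * d by rewrite ltr_pM2l.
have k2 : (1 - s) * `|b - c| <= (1 - s) * d by rewrite ler_wpM2l ?subr_ge0// ltW.
by move: k1 k2; lra.
Qed.

Lemma mulmx_norm n (v : 'rV[R]_n) (A : 'M[R]_n) : `|v *m A| <= n%:R * `|A| * `|v|.
Proof.
have entry m p (B : 'M[R]_(m, p)) i j : `|B i j| <= `|B|.
  by rewrite [leRHS]/Num.Def.normr/= mx_normrE; exact: (le_bigmax _ _ (i, j)).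
rewrite [leLHS]/Num.Def.normr/= mx_normrE; apply: bigmax_le; first by rewrite !mulr_ge0.
move=> [i j] _; rewrite mxE; apply: le_trans (ler_norm_sum _ _ _) _.
apply: (@le_trans _ _ (\sum_(k < n) `|v| * `|A|)).
  by apply: ler_sum => k _; rewrite normrM; apply: ler_pM => //; exact: entry.
by rewrite sumr_const card_ord -[leLHS]mulr_natl [leRHS]mulrAC mulrA.
Qed.

End DifferentialEstimates.

(* The differential behind an opaque constant: unification must not unfold ['d]. *)
Lemma sealed_diff_ex {R : realType} {U V : normedModType R} :
  {D : (U -> V) -> U -> U -> V | forall f a v, D f a v = 'd f a v}.
Proof. by exists (fun f a v => 'd f a v). Qed.

Definition sealed_diff {R : realType} {U V : normedModType R} := sval (@sealed_diff_ex R U V).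

Lemma sealed_diffE {R : realType} {U V : normedModType R} (f : U -> V) a v :
  sealed_diff f a v = 'd f a v.
Proof. exact: (svalP sealed_diff_ex). Qed.

Section VectorFieldData.
Context {R : realType} {r : {posnum R}} {n : nat} {Omega : metricType R}.
Notation E := 'rV[R]_n.
Notation C := (Cspace r n).
Variables (F : Omega -> E -> E -> E) (tau : Omega -> C -> R).
Hypotheses (hF : H1 F) (hT : H2 tau).

Definition D2F w a b v : E := sealed_diff (fun c => F w c b) a v.
Definition D3F w a b v : E := sealed_diff (F w a) b v.
Definition D2tau w x v : R := sealed_diff (tau w : C -> R^o) x v.

Lemma D2F_lin w a b : linear (D2F w a b).
Proof. by move=> k u v; rewrite /D2F !sealed_diffE linearP. Qed.

Lemma D3F_lin w a b : linear (D3F w a b).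
Proof. by move=> k u v; rewrite /D3F !sealed_diffE linearP. Qed.

Lemma D2tau_lin w x : linear (D2tau w x : C -> R^o).
Proof. by move=> k u v; rewrite /D2tau !sealed_diffE linearP. Qed.

Lemma D2FE w a b v : D2F w a b v = v *m 'J (fun c => F w c b) a.
Proof. by rewrite /jacobian mul_rV_lin1 -sealed_diffE. Qed.

Lemma D3FE w a b v : D3F w a b v = v *m 'J (F w a) b.
Proof. by rewrite /jacobian mul_rV_lin1 -sealed_diffE. Qed.

(** A bound by [e] times the norm of the vector, uniform in the vector: this form serves the
    Jacobians of [F] and the operator-norm continuity of the derivative of [tau] alike. *)
Lemma D2F_cont (p0 : Omega * E * E) e : 0 < e -> \forall p \near p0,
  forall v, `|D2F p.1.1 p.1.2 p.2 v - D2F p0.1.1 p0.1.2 p0.2 v| <= e * `|v|.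
Proof.
move=> e0; have [_ _ _ cJ _] := hF.
have n0 : 0 < n%:R + 1 :> R by rewrite ltr_wpDl.
have /cvgrPdist_le /(_ (e / (n%:R + 1))) := cJ p0; rewrite divr_gt0// => /(_ isT).
apply: filterS => p Hp v; rewrite !D2FE -mulmxBr.
apply: le_trans (mulmx_norm _ _) _; rewrite ler_wpM2r//.
rewrite distrC in Hp; apply: le_trans (ler_wpM2l _ Hp) _ => //.
by rewrite mulrCA ger_pMr// ler_pdivrMr// mul1r lerDl.
Qed.

Lemma D3F_cont (p0 : Omega * E * E) e : 0 < e -> \forall p \near p0,
  forall v, `|D3F p.1.1 p.1.2 p.2 v - D3F p0.1.1 p0.1.2 p0.2 v| <= e * `|v|.
Proof.
move=> e0; have [_ _ _ _ cJ] := hF.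
have n0 : 0 < n%:R + 1 :> R by rewrite ltr_wpDl.
have /cvgrPdist_le /(_ (e / (n%:R + 1))) := cJ p0; rewrite divr_gt0// => /(_ isT).
apply: filterS => p Hp v; rewrite !D3FE -mulmxBr.
apply: le_trans (mulmx_norm _ _) _; rewrite ler_wpM2r//.
rewrite distrC in Hp; apply: le_trans (ler_wpM2l _ Hp) _ => //.
by rewrite mulrCA ger_pMr// ler_pdivrMr// mul1r lerDl.
Qed.

Lemma D2tau_cont (p0 : Omega * C) e : 0 < e -> \forall p \near p0,
  forall v, `|D2tau p.1 p.2 v - D2tau p0.1 p0.2 v| <= e * `|v|.
Proof.
move=> e0; have [_ dT cT _] := hT.
have /cvgrPdist_le /(_ e e0) := cT p0.
apply: filterS => p; rewrite sub0r normrN => Hp v.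
rewrite /D2tau !sealed_diffE; apply: le_trans (opnorm_ub _ _ _) _; first exact: (diff_continuous (dT _ _)).
  exact: (diff_continuous (dT _ _)).
by rewrite ler_wpM2r// (le_trans (ler_norm _)).
Qed.

Lemma D2F_bounded w a b : exists2 M, 0 < M & forall v, `|D2F w a b v| <= M * `|v|.
Proof.
have [_ d2 _ _ _] := hF.
have [M M0 H] := linear_op_bounded (diff_continuous (d2 w a b)).
by exists M => // v; rewrite /D2F sealed_diffE.
Qed.

Lemma D3F_bounded w a b : exists2 M, 0 < M & forall v, `|D3F w a b v| <= M * `|v|.
Proof.
have [_ _ d3 _ _] := hF.
have [M M0 H] := linear_op_bounded (diff_continuous (d3 w a b)).
by exists M => // v; rewrite /D3F sealed_diffE.
Qed.

Lemma D2tau_bounded w x : exists2 M, 0 < M & forall v, `|D2tau w x v| <= M * `|v|.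
Proof.
have [_ dT _ _] := hT.
have [M M0 H] := linear_op_bounded (diff_continuous (dT w x)).
by exists M => // v; rewrite /D2tau sealed_diffE.
Qed.

Lemma ball3P (P : Omega * E * E -> Prop) (w0 : Omega) (a0 b0 : E) :
  (\forall p \near (w0, a0, b0), P p) -> exists2 d : R, 0 < d &
  forall w a b, ball w0 d w -> `|a - a0| < d -> `|b - b0| < d -> P (w, a, b).
Proof.
move=> /nbhs_ballP[d /= d0 dP]; exists d => // w a b wd ad bd; apply: dP.
by split; [split|]; rewrite //= -ball_normE/= distrC.
Qed.

Lemma ball2P {V : normedModType R} (P : Omega * V -> Prop) (w0 : Omega) (x0 : V) :
  (\forall p \near (w0, x0), P p) -> exists2 d : R, 0 < d &
  forall w x, ball w0 d w -> `|x - x0| < d -> P (w, x).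
Proof.
move=> /nbhs_ballP[d /= d0 dP]; exists d => // w x wd xd; apply: dP.
by split; rewrite //= -ball_normE/= distrC.
Qed.

Lemma F_linear_approx w0 a0 b0 e : 0 < e -> exists2 d : R, 0 < d &
  forall w a b a' b', ball w0 d w -> `|a - a0| < d -> `|b - b0| < d ->
    `|a' - a0| < d -> `|b' - b0| < d ->
    `|F w a b - F w a' b' - (D2F w a' b' (a - a') + D3F w a' b' (b - b'))|
      <= e * (`|a - a'| + `|b - b'|).
Proof.
move=> e0; have e20 : 0 < e / 2 by rewrite divr_gt0.
have [_ d2 d3 _ _] := hF.
have [d1 d10 H1] := ball3P (D2F_cont (w0, a0, b0) e20).
have [d2' d20 H2] := ball3P (D3F_cont (w0, a0, b0) e20).
exists (Num.min d1 d2'); first by rewrite lt_min d10.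
move=> w a b a' b' /[dup] /(le_ball (_ : Num.min d1 d2' <= d1)) + /(le_ball (_ : Num.min d1 d2' <= d2')).
rewrite !ge_min !lexx orbT => /(_ isT) w1 /(_ isT) w2.
rewrite !lt_min => /andP[a1 a2] /andP[b1 b2] /andP[a'1 a'2] /andP[b'1 b'2].
(* One argument is moved at a time. The derivatives on the way and at the expansion point are each
   within [e / 2] of the one at the centre. *)
have k1 : `|F w a b - F w a' b - D2F w a' b' (a - a')| <= e * `|a - a'|.
  apply: (segment_estimate (f := fun c => F w c b)) => // s s0 s1; rewrite -sealed_diffE.
  have h1 := H1 w (a' + s *: (a - a')) b w1 (ball_segment s0 s1 a1 a'1) b1 (a - a').
  have h2 := H1 w a' b' w1 a'1 b'1 (a - a').
  rewrite distrC in h2; apply: le_trans (ler_distD (D2F w0 a0 b0 (a - a')) _ _) _.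
  by apply: le_trans (lerD h1 h2) _; rewrite -mulrDl -splitr.
have k2 : `|F w a' b - F w a' b' - D3F w a' b' (b - b')| <= e * `|b - b'|.
  apply: (segment_estimate (f := F w a')) => // s s0 s1; rewrite -sealed_diffE.
  have h1 := H2 w a' (b' + s *: (b - b')) w2 a'2 (ball_segment s0 s1 b2 b'2) (b - b').
  have h2 := H2 w a' b' w2 a'2 b'2 (b - b').
  rewrite distrC in h2; apply: le_trans (ler_distD (D3F w0 a0 b0 (b - b')) _ _) _.
  by apply: le_trans (lerD h1 h2) _; rewrite -mulrDl -splitr.
rewrite mulrDr; apply: le_trans _ (lerD k1 k2); apply: le_trans _ (ler_normD _ _).
by rewrite addrACA subrKA -opprD.
Qed.

Lemma tau_linear_approx w0 x0 e : 0 < e -> exists2 d : R, 0 < d &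
  forall w x x', ball w0 d w -> `|x - x0| < d -> `|x' - x0| < d ->
    `|tau w x - tau w x' - D2tau w x' (x - x')| <= e * `|x - x'|.
Proof.
move=> e0; have e20 : 0 < e / 2 by rewrite divr_gt0.
have [_ dT _ _] := hT.
have [d d0 H] := ball2P (D2tau_cont (w0, x0) e20).
exists d => // w x x' wd xd x'd.
apply: (segment_estimate (V := R^o) (f := tau w)) => // s s0 s1; rewrite -sealed_diffE.
have h1 := H w (x' + s *: (x - x')) wd (ball_segment s0 s1 xd x'd) (x - x').
have h2 := H w x' wd x'd (x - x').
rewrite distrC in h2; apply: le_trans (ler_distD (D2tau w0 x0 (x - x')) _ _) _.
by apply: le_trans (lerD h1 h2) _; rewrite -mulrDl -splitr.
Qed.

Lemma F_loc_lip w0 a0 b0 : exists2 d : R, 0 < d & exists2 L, 0 < L &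
  forall w a b a' b', ball w0 d w -> `|a - a0| < d -> `|b - b0| < d ->
    `|a' - a0| < d -> `|b' - b0| < d ->
    `|F w a b - F w a' b'| <= L * (`|a - a'| + `|b - b'|).
Proof.
have [d1 d10 H1] := F_linear_approx w0 a0 b0 ltr01.
have [d2 d20 H2] := ball3P (D2F_cont (w0, a0, b0) ltr01).
have [d3 d30 H3] := ball3P (D3F_cont (w0, a0, b0) ltr01).
have [M2 M20 HM2] := D2F_bounded w0 a0 b0; have [M3 M30 HM3] := D3F_bounded w0 a0 b0.
exists (Num.min d1 (Num.min d2 d3)); first by rewrite !lt_min d10 d20.
exists (1 + (1 + M2) + (1 + M3)); first by rewrite !addr_gt0.
move=> w a b a' b' wd; rewrite !lt_min => /and3P[a1 _ _] /and3P[b1 _ _] /and3P[a'1 a'2 a'3] /and3P[b'1 b'2 b'3].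
have w1 : ball w0 d1 w by apply: le_ball wd; rewrite ge_min lexx.
have w2 : ball w0 d2 w by apply: le_ball wd; rewrite !ge_min lexx !orbT.
have w3 : ball w0 d3 w by apply: le_ball wd; rewrite !ge_min lexx !orbT.
have k1 := H1 _ _ _ _ _ w1 a1 b1 a'1 b'1.
have k2 : `|D2F w a' b' (a - a')| <= (1 + M2) * `|a - a'|.
  by apply: le_trans (norm_le_dist _ (D2F w0 a0 b0 (a - a'))) _; rewrite mulrDl lerD//; exact: (H2 w a' b' w2 a'2 b'2).
have k3 : `|D3F w a' b' (b - b')| <= (1 + M3) * `|b - b'|.
  by apply: le_trans (norm_le_dist _ (D3F w0 a0 b0 (b - b'))) _; rewrite mulrDl lerD//; exact: (H3 w a' b' w3 a'3 b'3).
move: k1 k2 k3.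
move: (F w a b) (F w a' b') (D2F w a' b' (a - a')) (D3F w a' b' (b - b')) => u u' v v' k1 k2 k3.
have k5 := norm_le_dist (u - u') (v + v').
have k4 := ler_normD v v'.
have p1 : 0 <= (1 + M2) * `|b - b'| by rewrite mulr_ge0// addr_ge0// ltW.
have p2 : 0 <= (1 + M3) * `|a - a'| by rewrite mulr_ge0// addr_ge0// ltW.
by move: k1 k2 k3 k4 k5 p1 p2; lra.
Qed.

Lemma tau_loc_lip w0 x0 : exists2 d : R, 0 < d & exists2 L, 0 < L &
  forall w x x', ball w0 d w -> `|x - x0| < d -> `|x' - x0| < d ->
    `|tau w x - tau w x'| <= L * `|x - x'|.
Proof.
have [d1 d10 H1] := tau_linear_approx w0 x0 ltr01.
have [d2 d20 H2] := ball2P (D2tau_cont (w0, x0) ltr01).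
have [M M0 HM] := D2tau_bounded w0 x0.
exists (Num.min d1 d2); first by rewrite lt_min d10.
exists (1 + (1 + M)); first by rewrite !addr_gt0.
move=> w x x' wd xd x'd.
have dd1 : Num.min d1 d2 <= d1 by rewrite ge_min lexx.
have dd2 : Num.min d1 d2 <= d2 by rewrite ge_min lexx orbT.
have w1 := le_ball dd1 wd; have w2 := le_ball dd2 wd.
have x1 := lt_le_trans xd dd1; have x'1 := lt_le_trans x'd dd1; have x'2 := lt_le_trans x'd dd2.
have k1 := H1 _ _ _ w1 x1 x'1.
have k2 : `|D2tau w x' (x - x')| <= (1 + M) * `|x - x'|.
  move: (H2 w x' w2 x'2 (x - x')) (HM (x - x')) => /=.
  move: (D2tau w x' (x - x')) (D2tau w0 x0 (x - x')) => u' u k1' k2'.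
  have k3 := ler_normD (u' - u) u; rewrite subrK in k3; apply: le_trans k3 _.
  by rewrite mulrDl lerD.
move: k1 k2; move: (tau w x) (tau w x') (D2tau w x' (x - x')) => u u' v k1 k2.
have k3 := ler_normD (u - u' - v) v; rewrite subrK in k3; apply: le_trans k3 _.
by rewrite mulrDl lerD.
Qed.

End VectorFieldData.

(** * The solution semiflow *)

Section DelayFlow.
Context {R : realType} {r : {posnum R}} {n : nat} {Omega : metricType R}.
Notation E := 'rV[R]_n.
Notation C := (Cspace r n).
Notation W := (Wspace r n).
Notation histC := (@histC R r n).
Variables (sigma : R -> Omega -> Omega) (F : Omega -> E -> E -> E) (tau : Omega -> C -> R).
Hypotheses (hsigma : continuous_flow sigma) (hF : H1 F) (hT : H2 tau).
Hypothesis htau : forall w x, 0 <= tau w x <= r%:num.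

Notation solution := (solution sigma F tau).
Notation maximal_solution := (maximal_solution sigma F tau).
Notation beta := (beta sigma F tau).
Notation sol := (sol sigma F tau).
Notation usol := (usol sigma F tau).
Notation Pi := (Pi sigma F tau).
Implicit Types (w : Omega) (y : R -> E).

Definition vfield w (phi : C) : E := F w (phi 0) (phi (- tau w phi)).
Definition rhs w (t : R) (phi : C) : E := vfield (sigma t w) phi.

Lemma eval_continuous : continuous (fun q : C * R => q.1 q.2).
Proof.
move=> [x s]; apply/cvgrPdist_lt => e e0; have e20 : 0 < e / 2 by rewrite divr_gt0.
have /cvgrPdist_lt /(_ _ e20) /nbhs_ballP[d /= d0 dP] := @Cfun_continuous _ _ _ x s.
have m0 : 0 < Num.min d (e / 2) by rewrite lt_min d0.
have := nbhsx_ballx (x, s) _ m0; apply: filterS => -[x' s'] [/= xx ss].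
apply: le_lt_trans (ler_distD (x s') _ _) _; rewrite (splitr e); apply: ltrD.
  by apply: dP; apply: le_ball ss; rewrite ge_min lexx.
apply: le_lt_trans (Cnorm_ub (x - x') s') _.
move: xx; rewrite -ball_normE/= => xx; apply: lt_le_trans xx _.
by rewrite ge_min lexx orbT.
Qed.

Lemma delayed_value_continuous : continuous (fun q : Omega * C => q.2 (- tau q.1 q.2) : E).
Proof.
move=> q; have [ct _ _ _] := hT.
apply: (@continuous_comp _ _ _ (fun q : Omega * C => (q.2, - tau q.1 q.2)) (fun q : C * R => q.1 q.2)); last exact: eval_continuous.
by apply: continuous_pair; [exact: continuous_snd|apply: cvgN; exact: ct].
Qed.

Lemma vfield_continuous : continuous (fun q : Omega * C => vfield q.1 q.2).
Proof.
move=> q; have [cF _ _ _ _] := hF.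
apply: (@continuous_comp _ _ _ (fun q : Omega * C => (q.1, q.2 0, q.2 (- tau q.1 q.2))) (fun p : Omega * E * E => F p.1.1 p.1.2 p.2)); last exact: cF.
apply: continuous_pair; last exact: delayed_value_continuous.
apply: continuous_pair; first exact: continuous_fst.
apply: (@continuous_comp _ _ _ (fun q : Omega * C => (q.2, 0)) (fun q : C * R => q.1 q.2)); last exact: eval_continuous.
by apply: continuous_pair; [exact: continuous_snd|exact: cvg_cst].
Qed.

(** The delayed values phi(-tau(phi)) and psi(-tau(psi)) are compared through phi(-tau(psi)). Only
    [phi] is evaluated at two different times, so only [phi] needs a Lipschitz constant. *)
Lemma vfield_loc_lip w0 (x0 : C) K : exists2 d : R, 0 < d & exists2 L, 0 < L &
  forall w (phi psi : C), ball w0 d w -> `|phi - x0| < d -> `|psi - x0| < d ->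
    lipC phi K -> `|vfield w phi - vfield w psi| <= L * `|phi - psi|.
Proof.
have [dF dF0 [LF LF0 HF]] := F_loc_lip hF w0 (x0 0) (x0 (- tau w0 x0)).
have [dt dt0 [Lt Lt0 Ht]] := tau_loc_lip hT w0 x0.
have /cvgrPdist_lt /(_ dF dF0) := delayed_value_continuous (x := (w0, x0)).
move=> /ball2P[db db0 Hb].
exists (Num.min dF (Num.min dt db)); first by rewrite !lt_min dF0 dt0.
exists (LF * (1 + (1 + `|K| * Lt))).
  by rewrite mulr_gt0// addr_gt0// ltr_wpDr// mulr_ge0// ltW.
move=> w phi psi wd pd qd pK.
have d1 : Num.min dF (Num.min dt db) <= dF by rewrite ge_min lexx.
have d2 : Num.min dF (Num.min dt db) <= dt by rewrite !ge_min lexx !orbT.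
have d3 : Num.min dF (Num.min dt db) <= db by rewrite !ge_min lexx !orbT.
have p1 := lt_le_trans pd d1; have q1 := lt_le_trans qd d1.
have w1 := le_ball d1 wd; have w2 := le_ball d2 wd; have w3 := le_ball d3 wd.
have p2 := lt_le_trans pd d2; have q2 := lt_le_trans qd d2.
have p3 := lt_le_trans pd d3; have q3 := lt_le_trans qd d3.
have b1 := Hb w phi w3 p3; have b2 := Hb w psi w3 q3; rewrite /= distrC in b1; rewrite /= distrC in b2.
have a1 := le_lt_trans (Cnorm_ub (phi - x0) 0) p1.
have a2 := le_lt_trans (Cnorm_ub (psi - x0) 0) q1.
apply: le_trans (HF w _ _ _ _ w1 a1 b1 a2 b2) _.
rewrite -mulrA; apply: ler_wpM2l; first exact: ltW.
rewrite mulrDl mul1r; apply: lerD; first exact: (Cnorm_ub (phi - psi) 0).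
apply: le_trans (ler_distD (phi (- tau w psi)) _ _) _.
rewrite mulrDl mul1r addrC; apply: lerD; first exact: (Cnorm_ub (phi - psi)).
apply: le_trans (pK _ _) _.
apply: (@le_trans _ _ (`|K| * `|tau w phi - tau w psi|)).
  have -> : - tau w phi - - tau w psi = - (tau w phi - tau w psi) by rewrite opprB opprK addrC.
  by rewrite normrN ler_wpM2r// ler_norm.
rewrite -mulrA; apply: ler_wpM2l; first exact: normr_ge0.
exact: (Ht w phi psi w2 p2 q2).
Qed.

Lemma flow_cont w : continuous (fun t => sigma t w).
Proof.
move=> t; have [cs _ _] := hsigma.
apply: (@continuous_comp _ _ _ (fun t => (t, w)) (fun p : R * Omega => sigma p.1 p.2)); last exact: cs.
by apply: continuous_pair; [exact: cvg_id|exact: cvg_cst].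
Qed.

Lemma rhs_regular w : regular_rhs (rhs w).
Proof.
split.
  move=> q.
  apply: (@continuous_comp _ _ _ (fun q : R * C => (sigma q.1 w, q.2)) (fun q : Omega * C => vfield q.1 q.2)); last exact: vfield_continuous.
  apply: continuous_pair; last exact: continuous_snd.
  apply: (@continuous_comp _ _ _ fst (fun t => sigma t w)); last exact: flow_cont.
  exact: continuous_fst.
move=> t0 x0 K t00.
have [d d0 [L L0 H]] := vfield_loc_lip (sigma t0 w) x0 K.
have /cvg_ballP /(_ d d0) /nbhs_ballP[d1 /= d10 H1'] := @flow_cont w t0.
exists (Num.min d d1); first by rewrite lt_min d0.
exists L; first exact: ltW.
move=> t phi psi _ td pd qd pK.
have e1 : Num.min d d1 <= d by rewrite ge_min lexx.
have e2 : Num.min d d1 <= d1 by rewrite ge_min lexx orbT.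
apply: (H (sigma t w) phi psi _ (lt_le_trans pd e1) (lt_le_trans qd e1) pK).
by apply: H1'; rewrite -ball_normE/= distrC; exact: (lt_le_trans td e2).
Qed.

Lemma vfield_histC w y t : continuous y ->
  vfield w (histC y t) = F w (y t) (y (t - tau w (histC y t))).
Proof.
move=> cy; rewrite /vfield !histC_cont// clamp_ge0// addr0 clamp_id//.
by rewrite inE /seg/= in_itv/=; have /andP[? ?] := htau w (histC y t); apply/andP; split; lra.
Qed.

Lemma continuous_comp_within (A : set R) (y : R -> E) (f : R -> R) :
  {within A, continuous y} -> continuous f -> (forall t, A (f t)) -> continuous (fun t => y (f t)).
Proof.
move=> /subspace_continuousP cy cf Af t; apply/cvgrPdist_lt => e e0.
have /cvgrPdist_lt /(_ e e0) H := cy _ (Af t).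
have H' : nbhs (f t) [set u | A u -> `|y (f t) - y u| < e] by exact: H.
have : nbhs t (f @^-1` [set u | A u -> `|y (f t) - y u| < e]) by exact: (cf t _ H').
by apply: filterS => s /= /(_ (Af s)).
Qed.

(** Clamping time to [-r, T] discards the arbitrary values of [y] elsewhere and gives a curve on the
    whole line, to which the theory of [gsol] applies. *)
Lemma solution_gsol w (x : W) (b : \bar R) y T : 0 <= T -> (T%:E < b)%E -> solution w x b y ->
  gsol (rhs w) x T (fun t => y (Num.min (Num.max t (- r%:num)) T)).
Proof.
move=> T0 Tb [b0 yx cy dy]; set Y := (fun t => y _).
have r0 : 0 < r%:num by [].
have clipA t : - r%:num <= Num.min (Num.max t (- r%:num)) T /\ ((Num.min (Num.max t (- r%:num)) T)%:E < b)%E.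
  split; first by rewrite le_min le_max lexx orbT; move: r0 T0; lra.
  by apply: le_lt_trans Tb; rewrite lee_fin ge_min lexx orbT.
have cY : continuous Y.
  apply: (@continuous_comp_within _ _ (fun t => Num.min (Num.max t (- r%:num)) T) cy) => //.
  move=> t; apply: (@continuous_min _ _ (fun t => Num.max t (- r%:num)) (fun=> T)); last exact: cvg_cst.
  by apply: (@continuous_max _ _ id (fun=> - r%:num)); [exact: cvg_id|exact: cvg_cst].
have YE t : - r%:num <= t -> t <= T -> Y t = y t by move=> t1 t2; rewrite /Y max_l// min_l.
split => //.
  move=> t t0; have t0T : Num.max t (- r%:num) <= T.
    by rewrite ge_max (le_trans t0 T0)/=; move: r0 T0; lra.
  have cE : Num.max t (- r%:num) = clamp r t by rewrite /clamp min_l// maxC.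
  by rewrite /Y min_l// cE yx ?clamp_seg// Cfun_clamp.
move=> t t0 tT; have tb : (t%:E < b)%E by apply: lt_trans Tb; rewrite lte_fin.
have hE : Defs.histC y t = histC Y t.
  rewrite /Defs.histC; congr insubd; apply/funext => s.
  rewrite YE//; first by have := clamp_geN (r := r) s; move: t0; lra.
  by have := clamp_le0 (r := r) s; move: tT; lra.
have := dy t t0 tb; rewrite hE => /has_deriv_within_rderiv H.
rewrite /rhs vfield_histC//.
have -> : Y t = y t by apply: YE; [move: r0 t0; lra|exact: ltW].
have -> : Y (t - tau (sigma t w) (histC Y t)) = y (t - tau (sigma t w) (histC Y t)).
  by have /andP[? ?] := htau (sigma t w) (histC Y t); apply: YE; move: t0 tT; lra.
have {}H : rderiv y t (F (sigma t w) (y t) (y (t - tau (sigma t w) (histC Y t)))).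
  apply: H; near=> h; have h0 : 0 < h by near: h; exact: nbhs_right_gt.
  have hT' : h < T - t by near: h; apply: nbhs_right_lt; rewrite subr_gt0.
  split; first by rewrite addr_ge0// ltW.
  by apply: lt_trans Tb; rewrite lte_fin; move: hT'; lra.
apply: rderiv_eq H; last by apply: YE; [move: r0 t0; lra|exact: ltW].
near=> h; have h0 : 0 < h by near: h; exact: nbhs_right_gt.
have hT' : h < T - t by near: h; apply: nbhs_right_lt; rewrite subr_gt0.
by apply: YE; move: r0 t0 h0 hT'; lra.
Unshelve. all: by end_near. Qed.

Lemma gsol_solution w (x : W) (b : \bar R) (Y : R -> E) : (0 < b)%E ->
  (forall t, (t%:E < b)%E -> exists T y, [/\ t < T, gsol (rhs w) x T y & forall s, s < T -> Y s = y s]) ->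
  solution w x b Y.
Proof.
move=> b0 H; split => //.
- move=> t ts; have t0 : t <= 0 by move: ts; rewrite inE /seg/= in_itv/= => /andP[].
  have [|T [y [tT [_ y0 _] Yy]]] := H t; first by apply: le_lt_trans b0; rewrite lee_fin.
  by rewrite Yy// y0.
- apply/subspace_continuousP => t [_ tb]; have [T [y [tT [cy _ _] Yy]]] := H t tb.
  have cYt : Y @ t --> Y t.
    rewrite (Yy t tT); apply: cvg_trans (cy t).
    by apply: near_eq_cvg; near=> s; rewrite Yy//; near: s; exact: lt_nbhsl.
  exact: cvg_within_filter.
- move=> t t0 tb; have [T [y [tT sy Yy]]] := H t tb; have [cy y0 dy] := sy.
  have hE : Defs.histC Y t = histC y t.
    rewrite /Defs.histC; congr insubd; apply/funext => s; rewrite Yy//.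
    by have := clamp_le0 (r := r) s; move: tT; lra.
  have := @rderiv_has_deriv _ _ y (fun t => rhs w t (histC y t)) 0 T%:E cy.
  move=> /(_ (continuous_rhs (rhs_regular w).1 cy)) D.
  have {}D : has_deriv_within [set s | 0 <= s /\ (s%:E < T%:E)%E] y t (rhs w t (histC y t)).
    by apply: D => // s s0; rewrite lte_fin; exact: dy.
  rewrite hE (Yy t tT) Yy; last by have /andP[? ?] := htau (sigma t w) (histC y t); move: tT; lra.
  rewrite -vfield_histC// -/(rhs w t _).
  move/has_deriv_withinP : D => D; apply/has_deriv_withinP => e e0.
  have [d d0 dP] := D e e0; exists (Num.min d (T - t)); first by rewrite lt_min d0 subr_gt0.
  move=> s [s0 sb]; rewrite lt_min => /andP[sd sT].
  have {}sT : s < T by move: sT; rewrite ltr_norml => /andP[? ?]; lra.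
  by rewrite !Yy//; apply: dP => //; split => //; rewrite lte_fin.
Unshelve. all: by end_near. Qed.

Lemma ereal_between (a : R) (b : \bar R) : (a%:E < b)%E -> exists2 T, a < T & (T%:E < b)%E.
Proof.
case: b => [b| |] // ab.
  by exists ((a + b) / 2); rewrite ?lte_fin; move: ab; rewrite lte_fin; lra.
by exists (a + 1); rewrite ?ltrDl// ltry.
Qed.

(** The end point is the supremum of the lengths of all [gsol]; a solution on a longer interval
    would give a [gsol] of length above the supremum. *)
Lemma maximal_solution_ex w (x : W) : exists p, maximal_solution w x p.1 p.2.
Proof.
pose S := [set T%:E | T in [set T | exists y, gsol (rhs w) x T y]].
pose b := ereal_sup S.
have Sb T y : gsol (rhs w) x T y -> (T%:E <= b)%E.
  by move=> sy; apply: ereal_sup_ubound; exists T => //; exists y.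
have b0 : (0 < b)%E.
  have [h h0 [y sy]] := picard_existence x (rhs_regular w).
  by apply: lt_le_trans (Sb _ _ sy); rewrite lte_fin.
have bS T : (T%:E < b)%E -> exists2 T', T < T' & exists y, gsol (rhs w) x T' y.
  by move=> /ereal_sup_gt[_ [T' [y sy] <-]]; rewrite lte_fin => TT; exists T' => //; exists y.
have [Y HY] := @gsol_union _ _ _ (rhs w) x b (rhs_regular w) (fun T Tb =>
  let: ex_intro2 T' TT (ex_intro y sy) := bS T Tb in ex_intro _ y (gsol_mono (ltW TT) sy)).
have sY : solution w x b Y.
  apply: gsol_solution => // t tb; have [T tT Tb] := ereal_between tb.
  have [T' TT [y sy]] := bS T Tb; exists T, y; have sy' := gsol_mono (ltW TT) sy.
  by split => // s; apply: HY.
exists (b, Y); split => // b' y' sy' bb' _.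
apply/eqP; rewrite eq_le bb' andbT leNgt; apply/negP => ltb /=.
have [T1 bT Tb'] : exists2 T, (b < T%:E)%E & (T%:E < b')%E.
  case: (b) b0 ltb => [c| |] c0 cb; last by [].
  - by have [T cT Tb'] := ereal_between cb; exists T; rewrite ?lte_fin.
  - by move: cb; rewrite ltNge leey.
have T0 : 0 <= T1 by rewrite -lee_fin ltW// (lt_trans b0).
have sg := solution_gsol T0 Tb' sy'.
by have := Sb _ _ sg; rewrite leNgt bT.
Qed.

Implicit Type x : W.

Lemma sol_maximal w (x : W) : maximal_solution w x (beta w x) (sol w x).
Proof.
have [p Hp] := maximal_solution_ex w x.
exact: (@xgetPex _ (0%E, 0) [set p | maximal_solution w x p.1 p.2] (ex_intro _ p Hp)).
Qed.

Lemma beta_gt0 w x : (0 < beta w x)%E.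
Proof. by have [[]] := sol_maximal w x. Qed.

Lemma beta_gsol w x T : (T%:E < beta w x)%E -> exists y, gsol (rhs w) x T y.
Proof.
move=> Tb; have [T0|/ltW T0] := leP 0 T.
  by eexists; apply: solution_gsol Tb (sol_maximal w x).1.
by eexists; apply: gsol_mono T0 (solution_gsol (lexx _) (beta_gt0 w x) (sol_maximal w x).1).
Qed.

(** The restriction to times below [beta] disappears in [sol_gsol], after [beta_ge], whose proof
    relies on this restricted form. *)
Lemma sol_gsol_lt w x T y t : gsol (rhs w) x T y -> - r%:num <= t -> t < T ->
  (t%:E < beta w x)%E -> sol w x t = y t.
Proof.
move=> sy rt tT tb.
have [T1 tT1 T1b] := ereal_between tb.
pose T' := Num.max 0 (Num.min T T1).
have T'0 : 0 <= T' by rewrite le_max lexx.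
have T'b : (T'%:E < beta w x)%E.
  rewrite /T'; have [_|_] := leP 0 (Num.min T T1); last exact: beta_gt0.
  by apply: le_lt_trans T1b; rewrite lee_fin ge_min lexx orbT.
have sz := solution_gsol T'0 T'b (sol_maximal w x).1.
have tT' : t <= T' by rewrite le_max le_min (ltW tT) (ltW tT1) orbT.
have [t0|t0] := ltP 0 t; last first.
  have [_ z0 _] := sz; have [_ y0 _] := sy.
  by have := z0 t t0; rewrite max_l// min_l// y0.
have m1 : t < Num.min T T1 by rewrite lt_min tT tT1.
have T'E : T' = Num.min T T1 by rewrite /T' max_r// ltW// (lt_trans t0).
have := gsol_unique (rhs_regular w) sz (gsol_mono (_ : T' <= T) sy) (t := t).
rewrite max_l// min_l//; apply; first by rewrite T'E ge_min lexx.
by rewrite T'E.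
Qed.

Lemma beta_ge w x T y : gsol (rhs w) x T y -> (T%:E <= beta w x)%E.
Proof.
move=> sy; rewrite leNgt; apply/negP => bT.
have T0 : 0 < T by rewrite -lte_fin; exact: lt_trans (beta_gt0 w x) bT.
have sT : solution w x T%:E y.
  apply: gsol_solution => // t; rewrite lte_fin => tT; by exists T, y.
have := (sol_maximal w x).2 _ _ sT (ltW bT) => /(_ _)/[dup].
move=> H _; have : T%:E = beta w x.
  apply: H => t rt tb; rewrite (sol_gsol_lt sy)//.
  by rewrite -lte_fin; exact: lt_trans bT.
by move=> E'; move: bT; rewrite -E' ltxx.
Qed.

Lemma sol_gsol w x T y t : gsol (rhs w) x T y -> - r%:num <= t -> t < T -> sol w x t = y t.
Proof.
move=> sy rt tT; apply: (sol_gsol_lt sy) => //.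
by apply: lt_le_trans (beta_ge sy); rewrite lte_fin.
Qed.

Lemma usol_histC w x T y t : gsol (rhs w) x T y -> 0 <= t -> t < T ->
  usol t w x = histC y t :> C.
Proof.
move=> sy t0 tT; have hE : histC (sol w x) t = histC y t.
  rewrite /Defs.histC; congr insubd; apply/funext => s.
  have h1 := clamp_le0 (r := r) s; have h2 := clamp_geN (r := r) s.
  by apply: (sol_gsol sy); lra.
have [cy _ _] := sy.
have [K K0 yK] := gsol_lip (rhs_regular w).1 sy tT.
by rewrite -hE; apply: (@histWE _ _ _ _ _ K); rewrite hE; apply: histC_lip => //; exact: ltW.
Qed.

Lemma beta_infty w x : beta w x = +oo%E <-> exists y, forall T, gsol (rhs w) x T y.
Proof.
split=> [binf|[y sy]].
  by apply: gsol_global; [exact: rhs_regular|move=> T; apply: beta_gsol; rewrite binf ltry].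
apply/eqP; rewrite -leye_eq leNgt; apply/negP => blt.
have b0 := beta_gt0 w x.
have : beta w x \is a fin_num by rewrite ge0_fin_numE// ltW.
move=> /fineK bE; have := beta_ge (sy (fine (beta w x) + 1)).
by rewrite -bE lee_fin gerDl leNgt ltr01.
Qed.

Lemma rhs_shift w s : (fun t => rhs w (s + t)) = rhs (sigma s w).
Proof.
by have [_ _ sD] := hsigma; apply/funext => t; apply/funext => phi; rewrite /rhs addrC sD.
Qed.

Lemma gsol_after w x y s : 0 <= s -> (forall T, gsol (rhs w) x T y) ->
  forall T, gsol (rhs (sigma s w)) (usol s w x) T (fun t => y (s + Num.max t (- r%:num))).
Proof.
move=> s0 sy T.
rewrite (usol_histC (sy (s + 1)) s0) ?ltrDl//.
by have := gsol_shift s0 (sy (s + T)); rewrite addrAC subrr add0r rhs_shift.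
Qed.

Lemma beta_after w x s : 0 <= s -> beta w x = +oo%E -> beta (sigma s w) (usol s w x) = +oo%E.
Proof.
move=> s0 /beta_infty[y sy]; apply/beta_infty; eexists; exact: gsol_after s0 sy.
Qed.

Lemma usol_after w x s t : 0 <= s -> 0 <= t -> beta w x = +oo%E ->
  usol t (sigma s w) (usol s w x) = usol (s + t) w x.
Proof.
move=> s0 t0 /beta_infty[y sy]; apply: W_ext.
rewrite (usol_histC (gsol_after s0 sy (t + 1)) t0) ?ltrDl//.
rewrite (usol_histC (sy (s + t + 1)) (addr_ge0 s0 t0)) ?ltrDl//.
have [cy _ _] := sy 0.
have [cy' _ _] := gsol_after s0 sy 0.
apply: C_ext => u ru u0; rewrite !histC_cont// clamp_id; last first.
  by rewrite inE /seg/= in_itv/= ru u0.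
by rewrite max_l ?addrA//; move: t0 ru; lra.
Qed.

Lemma Pi_after p s t : 0 <= s -> 0 <= t -> beta p.1 p.2 = +oo%E -> Pi t (Pi s p) = Pi (s + t) p.
Proof.
move=> s0 t0 bp; have [_ _ sD] := hsigma.
by rewrite /Defs.Pi /= usol_after// addrC sD.
Qed.

Lemma usol0 w x : usol 0 w x = x.
Proof.
apply: W_ext; have [h h0 [y sy]] := picard_existence x (rhs_regular w).
rewrite (usol_histC sy)//; have [cy y0 _] := sy.
by apply: C_ext => s rs s0; rewrite histC_cont// add0r y0 ?clamp_le0// Cfun_clamp.
Qed.

Lemma Pi0 p : Pi 0 p = p.
Proof. by have [_ s0 _] := hsigma; case: p => w x; rewrite /Defs.Pi /= s0 usol0. Qed.

Lemma beta_glue w x T T' y : 0 <= T -> T < T' -> gsol (rhs w) x T' y ->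
  beta (sigma T w) (usol T w x) = +oo%E -> beta w x = +oo%E.
Proof.
move=> T0 TT sy /beta_infty[y2 sy2]; apply/beta_infty.
apply: gsol_global; first exact: rhs_regular.
move=> S; have [ST|TS] := leP S T.
  by exists y; apply: gsol_mono sy; apply: le_trans ST _; exact: ltW.
have s2 := sy2 (S - T); rewrite -rhs_shift in s2.
have := gsol_glue T0 (gsol_mono (ltW TT) sy) (usol_histC sy T0 TT) s2.
by rewrite addrC subrK => g; eexists; exact: g.
Qed.

(** Blow-up alternative, the contrapositive of [gsol_extend]. It turns a priori bounds into
    existence on a prescribed interval. *)
Lemma beta_unbounded w x : beta w x != +oo%E ->
  (forall B, exists T y t, [/\ gsol (rhs w) x T y, 0 <= t, t < T & B < `|rhs w t (histC y t)|]).
Proof.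
move=> bn B; apply: contrapT => N.
have b0 := beta_gt0 w x.
have bfin : beta w x \is a fin_num by rewrite ge0_fin_numE ?ltey// ltW.
have bE := fineK bfin; set b := fine (beta w x) in bE.
have [|||T bT [y sy]] := @gsol_extend _ _ _ (rhs w) x b (rhs_regular w).
- by rewrite -lte_fin bE.
- by move=> T Tb; apply: beta_gsol; rewrite -bE lte_fin.
- exists B => T y _ sy t t0 tT; rewrite leNgt; apply/negP => Bl.
  by apply: N; exists T, y, t.
by have := beta_ge sy; rewrite -bE lee_fin leNgt bT.
Qed.

End DelayFlow.

Lemma ltW_half {R : realType} (d : R) : 0 < d -> d / 2 <= d.
Proof. lra. Qed.

Section Coercions.
Context {R : realType} {r : {posnum R}} {n : nat}.
Implicit Types (x y : Wspace r n) (f g : Cspace r n).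

Lemma WfunB x y : Wfun (x - y) = Wfun x - Wfun y. Proof. by []. Qed.
Lemma WfunZ a x : Wfun (a *: x) = a *: Wfun x. Proof. by []. Qed.
Lemma CfunB f g s : (f - g) s = f s - g s. Proof. by []. Qed.
Lemma CfunZ a f s : (a *: f) s = a *: f s. Proof. by []. Qed.

End Coercions.

Section CompactUniformity.
Context {R : realType} {Omega : metricType R} {V : normedModType R}.

(** Passes from the points of [K] to all points of a tube around [K]; the local radius is halved so
    that a ball around a nearby point of [K] remains in the original one. *)
Lemma compact_tube (K : set (Omega * V)) (P : R -> Omega * V -> Prop) : compact K ->
  (forall d d' p, 0 < d' -> d' <= d -> P d p -> P d' p) ->
  (forall p, K p -> exists2 d : R, 0 < d &
    forall w x, ball p.1 d w -> `|x - p.2| < d -> P d (w, x)) ->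
  exists2 d : R, 0 < d & forall w0 x0, K (w0, x0) ->
    forall w x, ball w0 d w -> `|x - x0| < d -> P d (w, x).
Proof.
move=> cK mono loc.
have [d d0 H] : exists2 d, 0 < d & forall p, K p ->
    forall w x, ball p.1 d w -> `|x - p.2| < d -> P d (w, x).
  apply: (compact_unif (K := K) (P := fun d p => forall w x, ball p.1 d w -> `|x - p.2| < d -> P d (w, x)) cK).
    move=> d d' p d'0 dd' H w x wd xd; apply: (mono d) => //; apply: H.
      exact: le_ball wd.
    exact: lt_le_trans xd dd'.
  move=> p Kp; have [d d0 H] := loc p Kp; exists (d / 2); first by rewrite divr_gt0.
  have d20 : 0 < d / 2 by rewrite divr_gt0.
  have dd := ltW_half d0.
  have := nbhsx_ballx p _ d20; apply: filterS => -[w1 x1] [/= w1d x1d] w x wd xd.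
  apply: (mono d) => //; apply: H.
    by rewrite (splitr d); exact: ball_triangle w1d wd.
  apply: le_lt_trans (ler_distD x1 _ _) _; rewrite (splitr d); apply: ltrD => //.
  by move: x1d; rewrite -ball_normE/= distrC.
exists d => // w0 x0 K0; exact: (H (w0, x0) K0).
Qed.

Lemma compact_tube_continuous {U : normedModType R} (K : set (Omega * V)) (g : Omega * V -> U) e :
  compact K -> continuous g -> 0 < e ->
  exists2 d : R, 0 < d & forall w0 x0, K (w0, x0) ->
    forall w x, ball w0 d w -> `|x - x0| < d -> `|g (w, x) - g (w0, x0)| <= e.
Proof.
move=> cK cg e0; have e20 : 0 < e / 2 by rewrite divr_gt0.
have [d d0 H] : exists2 d, 0 < d & forall p, K p ->
    forall w x, ball p.1 d w -> `|x - p.2| < d -> `|g (w, x) - g p| <= e.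
  apply: (compact_unif (K := K) (P := fun d p => forall w x, ball p.1 d w -> `|x - p.2| < d -> `|g (w, x) - g p| <= e) cK).
    move=> d d' p d'0 dd' H w x wd xd; apply: H; first exact: le_ball wd.
    exact: lt_le_trans xd dd'.
  move=> p _; have /cvgrPdist_le /(_ _ e20) /nbhs_ballP[d /= d0 H] := cg p.
  have d20 : 0 < d / 2 by rewrite divr_gt0.
  have dd := ltW_half d0.
  exists (d / 2) => //.
  have := nbhsx_ballx p _ d20; apply: filterS => -[w1 x1] [/= w1d x1d] w x wd xd.
  apply: le_trans (ler_distD (g p) _ _) _; rewrite (splitr e); apply: lerD.
    rewrite distrC; apply: H; split => /=.
      by rewrite (splitr d); exact: ball_triangle w1d wd.
    rewrite (splitr d); apply: ball_triangle x1d _.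
    by rewrite -ball_normE/= distrC.
  by apply: H; split => /=; [exact: le_ball w1d|exact: le_ball x1d].
exists d => // w0 x0 K0; exact: (H (w0, x0) K0).
Qed.

End CompactUniformity.

(** * Continuous dependence on the base point and the initial segment *)

Section ContinuousDependence.
Context {R : realType} {r : {posnum R}} {n : nat} {Omega : metricType R}.
Notation E := 'rV[R]_n.
Notation C := (Cspace r n).
Notation W := (Wspace r n).
Notation histC := (@histC R r n).
Variables (sigma : R -> Omega -> Omega) (F : Omega -> E -> E -> E) (tau : Omega -> C -> R).
Hypotheses (hsigma : continuous_flow sigma) (hF : H1 F) (hT : H2 tau).
Hypothesis htau : forall w x, 0 <= tau w x <= r%:num.

Notation beta := (beta sigma F tau).
Notation usol := (usol sigma F tau).
Notation Pi := (Pi sigma F tau).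
Notation vfield := (vfield F tau).
Notation rhs := (rhs sigma F tau).
Implicit Types (w : Omega) (y : R -> E) (x : W).

Lemma vfield_unif_lip (K : set (Omega * C)) Kl : compact K ->
  exists2 d : R, 0 < d & exists2 L, 0 < L & forall w0 (x0 : C), K (w0, x0) ->
    forall w (phi psi : C), ball w0 d w -> `|phi - x0| < d -> `|psi - x0| < d ->
    lipC phi Kl -> `|vfield w phi - vfield w psi| <= L * `|phi - psi|.
Proof.
move=> cK.
pose P (d : R) (p : Omega * C) := forall psi, `|psi - p.2| < d -> lipC p.2 Kl ->
  `|vfield p.1 p.2 - vfield p.1 psi| <= d^-1 * `|p.2 - psi|.
have [|[w0 x0] K0|d d0 H] := @compact_tube _ _ _ K P cK.
- move=> d d' p d'0 dd' H psi psid pK; apply: le_trans (H psi _ pK) _; first exact: lt_le_trans psid dd'.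
  by rewrite ler_wpM2r// lef_pV2// posrE// (lt_le_trans d'0).
- have [d d0 [L L0 H]] := vfield_loc_lip hF hT w0 x0 Kl.
  pose d' := Num.min (d / 2) L^-1.
  have d'0 : 0 < d' by rewrite lt_min divr_gt0//= invr_gt0.
  have d'd : d' <= d / 2 by rewrite ge_min lexx.
  have d'L : L <= d'^-1 by rewrite -[L]invrK lef_pV2 ?posrE ?invr_gt0// ge_min lexx orbT.
  have dd : d' <= d := le_trans d'd (ltW_half d0).
  exists d' => // w x /= wd xd psi psid pK.
  have xd2 := lt_le_trans xd dd.
  have pd : `|psi - x0| < d.
    apply: le_lt_trans (ler_distD x _ _) _; rewrite (splitr d); apply: ltrD.
      exact: lt_le_trans psid d'd.
    exact: lt_le_trans xd d'd.
  apply: le_trans (H w x psi _ xd2 pd pK) _; last by rewrite ler_wpM2r.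
  exact: (le_ball dd wd).
have dd := ltW_half d0.
exists (d / 2); first by rewrite divr_gt0.
exists d^-1; first by rewrite invr_gt0.
move=> w0 x0 K0 w phi psi wd phid psid pK.
apply: (H w0 x0 K0 w phi (le_ball dd wd) (lt_le_trans phid dd) psi _ pK).
rewrite (splitr d); apply: le_lt_trans (ler_distD x0 _ _) _.
by rewrite (distrC x0); exact: (ltrD psid phid).
Qed.

Lemma flow_unif w0 T e : 0 < e -> exists2 d : R, 0 < d & forall w, ball w0 d w ->
  forall t, 0 <= t -> t <= T -> ball (sigma t w0) e (sigma t w).
Proof.
move=> e0; have e20 : 0 < e / 2 by rewrite divr_gt0.
have [cs _ _] := hsigma.
have [d d0 H] : exists2 d, 0 < d & forall t, t \in `[0, T] -> forall w, ball w0 d w -> ball (sigma t w0) e (sigma t w).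
  apply: (@compact_unif R _ `[0, T]%classic (fun d t => forall w, ball w0 d w -> ball (sigma t w0) e (sigma t w))).
  - exact: segment_compact.
  - by move=> d d' t d'0 dd' H w wd; apply: H; exact: le_ball wd.
  - move=> t _; have /cvg_ballP /(_ _ e20) /nbhs_ballP[d /= d0 H] := cs (t, w0).
    exists d => //; have := nbhsx_ballx t _ d0; apply: filterS => s sd w wd.
    rewrite (splitr e); apply: (ball_triangle (y := sigma t w0)).
      by apply: ball_sym; apply: (H (s, w0)); split => //=; exact: ballxx.
    by apply: (H (s, w)); split.
by exists d => // w wd t t0 tT; apply: H => //; rewrite in_itv/= t0.
Qed.

(** The data are close in C only. The right-hand sides along the two solutions then differ by at
    most [e], and this is at the same time a Lipschitz bound for the difference on [0, T]: the part
    of the W^{1,oo} norm that a sup estimate misses. *)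
Lemma solution_near w0 x0 y0 T e : 0 <= T -> 0 < e -> (forall T, gsol (rhs w0) x0 T y0) ->
  exists2 d : R, 0 < d & forall w x, ball w0 d w -> `|(x : C) - (x0 : C)| < d ->
    exists2 T', T < T' & exists2 y, gsol (rhs w) x T' y &
      (forall s, s <= T -> `|y s - y0 s| <= e) /\
      (forall s u, 0 <= s -> s <= u -> u <= T ->
        `|(y u - y0 u) - (y s - y0 s)| <= e * (u - s)).
Proof.
move=> T0 e0 sy0; pose T1 := T + 1.
have T10 : 0 <= T1 by rewrite addr_ge0.
have [cy0 y00 dy0] := sy0 T1.
have cG w := (rhs_regular hsigma hF hT w).1.
have [K0 K00 lipy0] : exists2 K, 0 < K & lipto y0 K T1.
  by apply: (gsol_lip (cG w0) (sy0 (T1 + 1))); rewrite ltrDl.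
pose orb t := (sigma t w0, histC y0 t).
have corb : continuous orb.
  by move=> t; apply: continuous_pair; [exact: flow_cont|exact: continuous_histC].
pose Kc := orb @` `[0, T1]%classic.
have cKc : compact Kc.
  apply: continuous_compact; last exact: segment_compact.
  by apply: continuous_subspaceT => t; exact: corb.
have inK t : 0 <= t -> t <= T1 -> Kc (sigma t w0, histC y0 t).
  by move=> t0 tT; exists t => //=; rewrite in_itv/= t0.
have [d1 d10 [L L0 HL]] := vfield_unif_lip K0 cKc.
have L10 : 0 < L + 1 by rewrite addr_gt0.
(* Within distance [rho] the Lipschitz estimate is valid and contributes at most [e / 2]. Below, [A]
   bounds the effect of moving the base point; it is at most [e / 2] and so small that the Gronwall
   barrier stays under [rho]. *)
pose rho := Num.min (d1 / 2) (e / (2 * (L + 1))).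
have rho0 : 0 < rho by rewrite lt_min !divr_gt0// mulr_gt0.
have rhod : rho < d1.
  by apply: (@le_lt_trans _ _ (d1 / 2)); [rewrite ge_min lexx|move: d10; lra].
have rhoL : L * rho <= e / 2 /\ rho <= e.
  have : rho <= e / (2 * (L + 1)) by rewrite ge_min lexx orbT.
  rewrite ler_pdivlMr ?mulr_gt0// => k; have := mulr_gt0 rho0 L0; move: rho0 k; lra.
pose ex := expR ((L + 1) * T1).
have ex0 : 0 < ex by rewrite expR_gt0.
pose A := Num.min (e / 2) (rho / ex).
have A0 : 0 < A by rewrite lt_min !divr_gt0.
have Ae : A <= e / 2 by rewrite ge_min lexx.
have Arho : A * ex <= rho by rewrite -ler_pdivlMr// ge_min lexx orbT.
have [d2 d20 H2] := compact_tube_continuous cKc (vfield_continuous hF hT) A0.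
have m120 : 0 < Num.min d1 d2 by rewrite lt_min d10.
have [d3 d30 H3] := @flow_unif w0 T1 _ m120.
exists (Num.min d3 (A / 2)); first by rewrite lt_min d30 divr_gt0.
move=> w x /(le_ball (_ : Num.min d3 (A / 2) <= d3)); rewrite ge_min lexx => /(_ isT) wd xd.
have xA : `|(x : C) - (x0 : C)| <= A / 2 by apply: le_trans (ltW xd) _; rewrite ge_min lexx orbT.
have vdiff t phi rho' : 0 <= t -> t <= T1 -> rho' < d1 -> `|phi - histC y0 t| <= rho' ->
    `|rhs w t phi - rhs w0 t (histC y0 t)| <= L * rho' + A.
  move=> t0 tT rd pd; have Kt := inK t t0 tT.
  have wt := H3 w wd t t0 tT.
  have wt1 : ball (sigma t w0) d1 (sigma t w) by apply: le_ball wt; rewrite ge_min lexx.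
  have wt2 : ball (sigma t w0) d2 (sigma t w) by apply: le_ball wt; rewrite ge_min lexx orbT.
  apply: le_trans (ler_distD (vfield (sigma t w) (histC y0 t)) _ _) _; apply: lerD.
    rewrite distrC; have z0 : `|histC y0 t - histC y0 t| < d1 by rewrite subrr normr0.
    have lh : lipC (histC y0 t) K0.
      by apply: histC_lip => //; [exact: ltW|exact: lipto_mono lipy0].
    apply: le_trans (HL _ _ Kt (sigma t w) _ phi wt1 z0 (le_lt_trans pd rd) lh) _.
    by apply: ler_wpM2l; [exact: ltW|rewrite distrC].
  by apply: (H2 _ _ Kt (sigma t w) (histC y0 t) wt2); rewrite subrr normr0.
have apriori T' y : T' <= T1 -> gsol (rhs w) x T' y -> forall s, s <= T' -> `|y s - y0 s| <= rho.
  move=> TT sy s sT'; have [cy yx dy] := sy.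
  have dx u : u <= 0 -> `|y u - y0 u| <= A / 2.
    by move=> u0; rewrite yx// y00//; apply: le_trans xA; exact: (Cnorm_ub ((x : C) - x0)).
  have [T'0|T'0] := leP T' 0.
    apply: le_trans (dx _ (le_trans sT' T'0)) _.
    apply: le_trans Arho; apply: (@le_trans _ _ A); first by move: A0; lra.
    rewrite ler_peMr ?(ltW A0)// /ex -[leLHS]expR0 ler_expR.
    exact: (mulr_ge0 (ltW L10) T10).
  have exT : expR ((L + 1) * T') <= ex by rewrite /ex ler_expR ler_pM2l.
  have AT : A * expR ((L + 1) * T') <= rho by apply: le_trans Arho; rewrite ler_pM2l.
  apply: le_trans AT.
  apply: (@gronwall _ _ (fun u => y u - y0 u) (A / 2) A A L rho T') => //.
  - exact: (ltW T'0).
  - exact: (ltW L0).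
  - by move=> u; apply: cvgB; [exact: cy|exact: cy0].
  - by move: A0; lra.
  - by apply: le_trans Arho; rewrite ler_pM2l.
  - move=> t t0 tT' Ht; exists (rhs w t (histC y t) - rhs w0 t (histC y0 t)).
      by apply: rderivB; [exact: dy|apply: dy0 => //; exact: lt_le_trans TT].
    move=> m Hm; have tT1 : t <= T1 by apply: ltW; exact: lt_le_trans TT.
    (* The given bound [m] may leave the region of the Lipschitz estimate, so it is capped by [rho],
       which is known to hold up to time [t]. *)
    pose m' := Num.min m rho.
    have m'm : m' <= m by rewrite ge_min lexx.
    apply: (@le_trans _ _ (L * m' + A)); last by rewrite lerD2r ler_pM2l.
    apply: vdiff => //; first by apply: le_lt_trans rhod; rewrite ge_min lexx orbT.
    by apply: histCB_le => // u _ ut; rewrite le_min Hm// Ht.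
have dbound T' y t : T' <= T1 -> gsol (rhs w) x T' y -> 0 <= t -> t < T' ->
    `|rhs w t (histC y t) - rhs w0 t (histC y0 t)| <= e.
  move=> TT sy t0 tT'; have [cy _ _] := sy.
  apply: (@le_trans _ _ (L * rho + A)); last by move: rhoL Ae => [? _]; lra.
  apply: vdiff => //; first by apply: ltW; exact: lt_le_trans TT.
  by apply: histCB_le => // u _ ut; apply: apriori TT sy _ _; apply: le_trans ut (ltW tT').
(* The estimates so far concern any solution on any subinterval. They keep the right-hand side
   bounded, so the solution cannot end before [T]. *)
have Tb : (T%:E < beta w x)%E.
  rewrite ltNge; apply/negP => bT.
  have bn : beta w x != +oo%E by apply: contraTneq bT => ->; rewrite leye_eq.
  have [M M0 HM] := @bounded_on_segment _ _ _ 0 T1 (continuous_rhs (cG w0) cy0).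
  have [T' [y [t [sy t0 tT']]]] := beta_unbounded hsigma hF hT htau bn (M + e).
  have T'T : T' <= T by rewrite -lee_fin; apply: le_trans bT; exact: beta_ge sy.
  have T'1 : T' <= T1 by rewrite (le_trans T'T)// lerDl.
  rewrite ltNge => /negP; apply.
  apply: le_trans (norm_le_dist _ (rhs w0 t (histC y0 t))) _; rewrite addrC; apply: lerD.
    by apply: HM => //; apply: ltW; exact: lt_le_trans T'1.
  exact: dbound T'1 sy t0 tT'.
have [T2 TT2 T2b] := ereal_between Tb.
have [y sy2] := beta_gsol hsigma hF hT htau T2b.
pose T' := Num.min T2 T1.
have TT' : T < T' by rewrite lt_min TT2/= ltrDl.
have T'1 : T' <= T1 by rewrite ge_min lexx orbT.
have sy : gsol (rhs w) x T' y by apply: gsol_mono sy2; rewrite ge_min lexx.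
exists T' => //; exists y => //; have [cy _ dy] := sy; split.
  move=> s sT; apply: le_trans rhoL.2; apply: apriori T'1 sy _ _.
  exact: le_trans sT (ltW TT').
move=> s u s0 su uT; apply: (@mean_value_cst _ _ (fun t => y t - y0 t)) => //.
  by move=> t; apply: cvgB; [exact: cy|exact: cy0].
move=> t st tu; have t0 := le_trans s0 st.
have tT' : t < T' by apply: lt_le_trans tu (le_trans uT (ltW TT')).
exists (rhs w t (histC y t) - rhs w0 t (histC y0 t)); last exact: dbound T'1 sy t0 tT'.
by apply: rderivB; [exact: dy|apply: dy0 => //; exact: lt_le_trans T'1].
Qed.

(* After one delay only the supremum distance of the initial segments matters. *)
Lemma usol_near w0 x0 T e : 0 <= T -> 0 < e -> beta w0 x0 = +oo%E ->
  exists2 d : R, 0 < d & forall w x, ball w0 d w -> `|(x : C) - (x0 : C)| < d ->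
    (T%:E < beta w x)%E /\ forall t, 0 <= t -> t <= T ->
      (r%:num <= t -> `|usol t w x - usol t w0 x0| <= e) /\
      `|usol t w x - usol t w0 x0| <= Num.max e `|x - x0|.
Proof.
move=> T0 e0 /(beta_infty hsigma hF hT htau)[y0 sy0].
have [d d0 H] := solution_near T0 e0 sy0; exists d => // w x wd xd.
have [T' TT' [y sy [H1' H2']]] := H w x wd xd.
split; first by apply: lt_le_trans (beta_ge hsigma hF hT htau sy); rewrite lte_fin.
move=> t t0 tT; have tT' := le_lt_trans tT TT'.
have [cy yx _] := sy; have [cy0 y00 _] := sy0 T'.
have hE := usol_histC hsigma hF hT htau sy t0 tT'.
have hE0 := usol_histC hsigma hF hT htau (sy0 T') t0 tT'.
move: (usol t w x) (usol t w0 x0) hE hE0 => v v0 hE hE0.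
have supb : `|(v - v0 : W) : C| <= e.
  rewrite WfunB hE hE0; apply: histCB_le => // s _ st; apply: H1'.
  exact: le_trans st tT.
have val s : (v - v0 : W) s = y (t + clamp r s) - y0 (t + clamp r s).
  by rewrite WfunB CfunB hE hE0 !histC_cont.
split => [rt|].
  apply: wnorm_le => // s u; rewrite !val.
  wlog su : s u / clamp r s <= clamp r u.
    move=> Hw; have [/Hw//|/ltW/Hw] := leP (clamp r s) (clamp r u).
    by rewrite distrC (distrC s).
  rewrite distrC; apply: le_trans (H2' _ _ _ _ _) _.
  - by have := clamp_geN (r := r) s; move: rt; lra.
  - by rewrite lerD2l.
  - by have := clamp_le0 (r := r) u; move: tT; lra.
  rewrite opprD addrACA subrr add0r ler_pM2l//.
  by rewrite distrC; apply: le_trans (clamp_lip r _ _); exact: ler_norm.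
have m0 : 0 < Num.max e `|x - x0| by rewrite lt_max e0.
apply: wnorm_le => //; first by rewrite le_max supb.
have lip : lipto (fun s => y s - y0 s) (Num.max e `|x - x0|) T.
  apply: lipto_glue => //.
    move=> s u s0 u0; rewrite !yx// !y00//.
    apply: le_trans (wnorm_lip (x - x0) s u) _.
    by rewrite ler_wpM2r// le_max lexx orbT.
  move=> s u s0 su uT; apply: le_trans (H2' s u s0 su uT) _.
  by rewrite ler_wpM2r ?subr_ge0// le_max lexx.
move=> s u; rewrite !val; apply: le_trans (lip _ _ _ _) _.
- by have := clamp_le0 (r := r) s; move: tT; lra.
- by have := clamp_le0 (r := r) u; move: tT; lra.
by rewrite opprD addrACA subrr add0r ler_pM2l// clamp_lip.
Qed.

Lemma Pi_continuous p t : 0 <= t -> beta p.1 p.2 = +oo%E -> {for p, continuous (Pi t)}.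
Proof.
case: p => w0 x0 t0 /= binf; apply: continuous_pair.
  have [cs _ _] := hsigma.
  apply: (@continuous_comp _ _ _ (fun p : Omega * W => (t, p.1)) (fun q : R * Omega => sigma q.1 q.2)); last exact: cs.
  by apply: continuous_pair; [exact: cvg_cst|exact: continuous_fst].
apply/cvgrPdist_le => e e0.
have [d d0 H] := usol_near t0 e0 binf.
have m0 : 0 < Num.min d e by rewrite lt_min d0.
have := nbhsx_ballx (w0, x0) _ m0; apply: filterS => -[w x] [/= wd xd].
have {}xd : `|x - x0| < Num.min d e by move: xd; rewrite -ball_normE/= distrC.
have d1 : Num.min d e <= d by rewrite ge_min lexx.
have d2 : Num.min d e <= e by rewrite ge_min lexx orbT.
have [_ /(_ t t0 (lexx t)) [_ k]] := H w x (le_ball d1 wd) (le_lt_trans (wnorm_Cnorm (x - x0)) (lt_le_trans xd d1)).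
suff k' : `|usol t w0 x0 - usol t w x| <= e by exact: k'.
rewrite distrC; apply: (le_trans k).
by rewrite ge_max lexx/=; exact: (ltW (lt_le_trans xd d2)).
Qed.

End ContinuousDependence.

(** * Minimal sets and linearization *)

Section SegmentDerivative.
Context {R : realType} {r : {posnum R}} {n : nat}.
Notation E := 'rV[R]_n.
Notation C := (Cspace r n).
Notation W := (Wspace r n).
Implicit Types (s t : R) (x : W).

(** Makes the punctured neighbourhood filter within the segment proper at the end points too, where
    the derivative is one-sided. *)
Lemma seg_near_point s d : s \in seg r -> 0 < d ->
  exists2 u, u \in seg r & u != s /\ `|s - u| < d.
Proof.
move=> ss d0; have r0 : 0 < r%:num by [].
pose e := Num.min (d / 2) (r%:num / 2).
have e0 : 0 < e by rewrite lt_min !divr_gt0.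
have ed : e <= d / 2 by rewrite ge_min lexx.
have er : e <= r%:num / 2 by rewrite ge_min lexx orbT.
move: ss; rewrite inE /seg/= in_itv/= => /andP[s1 s2].
have [h|h] := leP s (- r%:num / 2).
  exists (s + e); first by rewrite inE /seg/= in_itv/=; apply/andP; split; lra.
  split; first by rewrite gt_eqF// ltrDl.
  by rewrite opprD addrA subrr sub0r normrN gtr0_norm//; lra.
exists (s - e); first by rewrite inE /seg/= in_itv/=; apply/andP; split; lra.
split; first by rewrite lt_eqF// gtrBl.
by rewrite opprB addrC subrK gtr0_norm//; lra.
Qed.

Lemma within_seg_proper s : s \in seg r -> ProperFilter (within (seg r) s^').
Proof.
move=> ss; apply: Build_ProperFilter_ex => // P [d /= d0 dP].
have [u us [un ud]] := seg_near_point ss d0.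
by exists u; apply: dP => //; rewrite -inE.
Qed.

Lemma has_deriv_dot (f : C) s d : s \in seg r -> has_deriv_within (seg r) f s d -> dot f s = d.
Proof.
by move=> ss fd; have P := within_seg_proper ss; exact/cvg_lim.
Qed.

Lemma deriv_lip_bound (f : R -> E) s d K : s \in seg r -> has_deriv_within (seg r) f s d ->
  (forall u, `|f u - f s| <= K * `|u - s|) -> `|d| <= K.
Proof.
move=> ss /has_deriv_withinP fd fK; apply/ler_addgt0Pl => e e0.
have [dl dl0 dlP] := fd e e0; have [u us [un ud]] := seg_near_point ss dl0.
have us0 : 0 < `|u - s| by rewrite normr_gt0 subr_eq0.
have := dlP u (set_mem us) ud; rewrite distrC => k1.
rewrite -(ler_pM2l us0) -normrZ; apply: le_trans (norm_le_dist _ (f u - f s)) _.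
by rewrite mulrC mulrDl; apply: lerD => //; exact: fK.
Qed.

Definition C1seg x := exists2 V : R -> E, continuous V &
  forall s, s \in seg r -> has_deriv_within (seg r) x s (V s).

Lemma C1seg_deriv x s : C1seg x -> s \in seg r -> has_deriv_within (seg r) x s (dot x s).
Proof. by move=> [V _ H] ss; rewrite (has_deriv_dot ss (H s ss)); exact: H. Qed.

Lemma dot_le x s : C1seg x -> s \in seg r -> `|dot x s| <= `|x|.
Proof.
move=> cx ss; apply: (deriv_lip_bound ss (C1seg_deriv cx ss)) => u; exact: wnorm_lip.
Qed.

Lemma dotB_le x x' s : C1seg x -> C1seg x' -> s \in seg r ->
  `|dot x s - dot x' s| <= `|x - x'|.
Proof.
move=> cx cx' ss.
have := has_deriv_withinD (C1seg_deriv cx ss) (has_deriv_withinZ (a := -1) (C1seg_deriv cx' ss)).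
rewrite scaleN1r => H; apply: (deriv_lip_bound ss H) => u.
rewrite /= !scaleN1r; exact: (wnorm_lip (x - x')).
Qed.

(** Closeness in W^{1,oo} means closeness of derivatives, so the modulus of continuity of the
    derivative of [x0] passes to its neighbours. One [d] therefore serves all nearby [x], with three
    shares of [e / 4]. *)
Lemma C1seg_expansion x0 e : C1seg x0 -> 0 < e -> exists2 d : R, 0 < d &
  forall x, C1seg x -> `|x - x0| < d -> forall s u, s \in seg r -> u \in seg r -> `|s - u| < d ->
    `|dot x u - dot x s| <= e /\ `|x u - x s - (u - s) *: dot x s| <= e * `|u - s|.
Proof.
move=> c0 e0; have e40 : 0 < e / 4 by rewrite divr_gt0.
have e3 : 3 * (e / 4) <= e by lra.
have e3E : e / 4 + (e / 4 + e / 4) = 3 * (e / 4) by ring.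
have e8E : e / 8 + e / 8 = e / 4 by field.
have [V cV HV] := c0.
have [d1 d10 H1] : exists2 d, 0 < d & forall t, t \in `[- r%:num, 0] ->
    forall u, `|t - u| < d -> `|V t - V u| <= e / 4.
  apply: (@compact_unif R _ `[- r%:num, 0]%classic (fun d t => forall u, `|t - u| < d -> `|V t - V u| <= e / 4)).
  - exact: segment_compact.
  - by move=> d d' t _ dd H u tu; apply: H; exact: lt_le_trans dd.
  - move=> t _; have e80 : 0 < e / 8 by rewrite divr_gt0.
    have /cvgrPdist_le /(_ _ e80) [d /= d0 dP] := cV t.
    have d20 : 0 < d / 2 by rewrite divr_gt0.
    exists (d / 2) => //; exists (d / 2) => // t' /= tt' u t'u.
    have k1 := dP t' (lt_le_trans tt' (ltW_half d0)).
    have k2 : `|V t - V u| <= e / 8.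
      apply: dP => /=; apply: le_lt_trans (ler_distD t' _ _) _.
      by rewrite (splitr d) ltrD.
    apply: le_trans (ler_distD (V t) _ _) _; rewrite distrC.
    by rewrite -e8E; exact: lerD k1 k2.
exists (Num.min d1 (e / 4)); first by rewrite lt_min d10.
move=> x cx xd s u ss us su.
have xe : `|x - x0| <= e / 4 by apply: ltW; apply: lt_le_trans xd _; rewrite ge_min lexx orbT.
have su1 : `|s - u| < d1 by apply: lt_le_trans su _; rewrite ge_min lexx.
have dots v q : v \in seg r -> q \in seg r -> `|v - q| < d1 -> `|dot x q - dot x v| <= 3 * (e / 4).
  move=> vs qs vq.
  apply: le_trans (ler_distD (dot x0 q) _ _) _.
  have k1 := le_trans (dotB_le cx c0 qs) xe.
  have k2 := le_trans (dotB_le cx c0 vs) xe; rewrite distrC in k2.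
  have k3 : `|dot x0 q - dot x0 v| <= e / 4.
    rewrite (has_deriv_dot qs (HV q qs)) (has_deriv_dot vs (HV v vs)) distrC.
    by apply: H1 => //; move: vs; rewrite inE.
  rewrite -e3E; exact: (lerD k1 (le_trans (ler_distD (dot x0 v) _ _) (lerD k3 k2))).
split; first exact: (le_trans (dots s u ss us su1) e3).
clear xd xe.
have segP v : v \in seg r -> - r%:num <= v <= 0 by rewrite inE /seg/= in_itv.
have key a b : a \in seg r -> b \in seg r -> a <= b -> (forall q, a <= q -> q <= b -> `|dot x q - dot x s| <= e) ->
    `|(x b - b *: dot x s) - (x a - a *: dot x s)| <= e * (b - a).
  move=> /segP/andP[a1 a2] /segP/andP[b1 b2] ab Hq.
  apply: (@mean_value_cst _ _ (fun v => x v - v *: dot x s)) => //.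
    move=> v; apply: cvgB; first exact: Cfun_continuous.
    by apply: cvgZr_tmp; exact: cvg_id.
  move=> v av vb; exists (dot x v - dot x s); last by apply: Hq => //; exact: ltW.
  apply: rderivB; last exact: rderiv_linear.
  have vs : v \in seg r by rewrite inE /seg/= in_itv/= (le_trans a1 av)/= (le_trans (ltW vb)).
  apply: has_deriv_within_rderiv (C1seg_deriv cx vs); near=> h.
  have h0 : 0 < h by near: h; exact: nbhs_right_gt.
  have hb : h < b - v by near: h; apply: nbhs_right_lt; rewrite subr_gt0.
  by rewrite /seg/= in_itv/=; apply/andP; split; lra.
have zE : `|x u - x s - (u - s) *: dot x s| = `|(x u - u *: dot x s) - (x s - s *: dot x s)|.
  by rewrite scalerBl !opprD !opprK [in RHS]addrACA.
have near q : Num.min s u <= q -> q <= Num.max s u -> `|dot x q - dot x s| <= e.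
  move=> q1 q2; apply: le_trans (dots s q ss _ _) e3.
    move: (segP _ ss) (segP _ us) => /andP[s1 s2] /andP[u1 u2].
    rewrite inE /seg/= in_itv/=; apply/andP; split.
      by apply: le_trans q1; rewrite le_min s1.
    by apply: le_trans q2 _; rewrite ge_max s2.
  apply: le_lt_trans su1; move: q1 q2; rewrite /Num.min /Num.max; case: ltP => h q1 q2.
    by rewrite !ler0_norm; lra.
  by rewrite !ger0_norm; lra.
rewrite zE; have [su'|/ltW us'] := leP s u.
  rewrite (ger0_norm (_ : 0 <= u - s)) ?subr_ge0//; apply: key => // q q1 q2.
  by apply: near; rewrite ?min_l ?max_r.
rewrite distrC (distrC u) (ger0_norm (_ : 0 <= s - u)) ?subr_ge0//; apply: key => // q q1 q2.
by apply: near; rewrite ?min_r ?max_l.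
Unshelve. all: by end_near. Qed.

End SegmentDerivative.

Section MinimalSetFacts.
Context {R : realType} {r : {posnum R}} {n : nat} {Omega : metricType R}.
Notation E := 'rV[R]_n.
Notation C := (Cspace r n).
Notation W := (Wspace r n).
Notation histC := (@histC R r n).
Variables (sigma : R -> Omega -> Omega) (F : Omega -> E -> E -> E) (tau : Omega -> C -> R).
Hypotheses (hsigma : continuous_flow sigma) (hF : H1 F) (hT : H2 tau).
Hypothesis htau : forall w x, 0 <= tau w x <= r%:num.
Variable M : set (Omega * W).
Hypothesis hM : minimal_set sigma F tau M.

Notation beta := (beta sigma F tau).
Notation usol := (usol sigma F tau).
Notation Pi := (Pi sigma F tau).
Notation rhs := (rhs sigma F tau).
Implicit Types (w : Omega) (y : R -> E) (x : W) (p q : Omega * W).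

Lemma M_beta p : M p -> beta p.1 p.2 = +oo%E.
Proof. by have [_ inv _ _] := hM => /inv[]. Qed.

Lemma M_Pi p t : 0 <= t -> M p -> M (Pi t p).
Proof. by have [_ inv _ _] := hM => t0 /inv[_]; exact. Qed.

(* [Pi s @` M] is again compact and positively invariant, hence all of [M]. *)
Lemma M_Pi_surj s p : 0 <= s -> M p -> exists2 q, M q & Pi s q = p.
Proof.
move=> s0 Mp; have [[p0 Mp0] inv cM minM] := hM.
suff ME : Pi s @` M = M.
  have [q Mq qp] : (Pi s @` M) p by rewrite ME.
  by exists q.
apply: minM.
- by exists (Pi s p0); exists p0.
- move=> _ [q Mq <-]; split; first exact: beta_after (M_beta Mq).
  move=> t t0; exists (Pi t q); first exact: M_Pi.
  rewrite (Pi_after hsigma hF hT htau t0 s0 (M_beta Mq)) (Pi_after hsigma hF hT htau s0 t0 (M_beta Mq)).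
  by rewrite addrC.
- apply: continuous_compact => //; apply/subspace_continuousP => q Mq.
  apply: cvg_within_filter; exact: (Pi_continuous hsigma hF hT htau s0 (M_beta Mq)).
- by move=> _ [q Mq <-]; exact: M_Pi.
Qed.

(** By [M_Pi_surj] the point is reached after time r from a point of [M]; its segment is then a
    piece of a solution over [0, r], where the derivative is continuous. *)
Lemma M_C1 p : M p -> C1seg p.2.
Proof.
have r0 : 0 <= r%:num by [].
move=> /(M_Pi_surj r0)[q Mq <-].
have [y sy] := (beta_infty hsigma hF hT htau q.1 q.2).1 (M_beta Mq).
have [cy _ dy] := sy (r%:num + 1).
have xE : usol r%:num q.1 q.2 = histC y r%:num :> C.
  by apply: (usol_histC hsigma hF hT htau (sy (r%:num + 1))); rewrite ?ltrDl.
have cg := continuous_rhs (rhs_regular hsigma hF hT q.1).1 cy.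
exists (fun s => rhs q.1 (r%:num + s) (histC y (r%:num + s))).
  move=> s; apply: (@continuous_comp _ _ _ (fun s => r%:num + s) (fun t => rhs q.1 t (histC y t))).
    by apply: cvgD; [exact: cvg_cst|exact: cvg_id].
  exact: cg.
move=> s ss; rewrite /= xE; apply/has_deriv_withinP => e e0.
have /has_deriv_withinP/(_ e e0)[d d0 dP] : has_deriv_within [set u | 0 <= u /\ (u%:E < +oo)%E] y
    (r%:num + s) (rhs q.1 (r%:num + s) (histC y (r%:num + s))).
  apply: (@rderiv_has_deriv _ _ y (fun t => rhs q.1 t (histC y t)) 0 +oo%E cy cg).
  - by move=> t t0 _; have [_ _ dy'] := sy (t + 1); apply: dy'; rewrite // ltrDl.
  - by move: ss; rewrite inE /seg/= in_itv/= => /andP[+ _]; lra.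
  - exact: ltry.
exists d => // u us su; rewrite !histC_cont// (clamp_id ss) clamp_id ?inE//.
have -> : u - s = (r%:num + u) - (r%:num + s) by rewrite opprD addrACA subrr add0r.
apply: dP.
  by split; rewrite ?ltry//; move: us; rewrite /seg/= in_itv/= => /andP[+ _]; lra.
by rewrite opprD addrACA subrr add0r.
Qed.

Lemma M_bounded : exists2 B, 0 < B & forall p, M p -> `|p.2| <= B.
Proof.
have [_ _ cM _] := hM.
have [d d0 H] : exists2 d, 0 < d & forall p, M p -> `|p.2| <= d^-1.
  apply: (@compact_unif R _ M (fun d p => `|p.2| <= d^-1) cM).
    by move=> d d' p d'0 dd' /le_trans; apply; rewrite lef_pV2// posrE// (lt_le_trans d'0).
  move=> p _; exists (`|p.2| + 1)^-1; first by rewrite invr_gt0 ltr_wpDl.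
  have := nbhsx_ballx p _ (@ltr01 R); apply: filterS => q [_] /=; rewrite invrK -ball_normE/= distrC => k.
  apply: le_trans (norm_le_dist q.2 p.2) _; rewrite addrC lerD2l; exact: ltW.
by exists d^-1; rewrite ?invr_gt0.
Qed.

End MinimalSetFacts.

Section VectorInequalities.
Context {R : realType} {V : normedModType R}.
Implicit Types a b c : V.

Lemma norm_diff3 a1 b1 c1 a2 b2 c2 :
  `|(a1 + b1 - c1) - (a2 + b2 - c2)| <= `|a1 - a2| + `|b1 - b2| + `|c1 - c2|.
Proof.
have -> : (a1 + b1 - c1) - (a2 + b2 - c2) = (a1 - a2) + (b1 - b2) - (c1 - c2).
  by rewrite !opprD !opprK addrACA (addrACA a1).
by apply: le_trans (ler_normB _ _) _; rewrite lerD2r; exact: ler_normD.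
Qed.

Lemma norm_scale_diff (k l : R) a b :
  `|k *: a - l *: b| <= `|k| * `|a - b| + `|k - l| * `|b|.
Proof.
have -> : k *: a - l *: b = k *: (a - b) + (k - l) *: b.
  by rewrite scalerBr scalerBl addrA subrK.
by apply: le_trans (ler_normD _ _) _; rewrite !normrZ.
Qed.

End VectorInequalities.

Lemma linear_sub {R : pzRingType} {U V : lmodType R} (f : U -> V) : linear f ->
  forall u v, f (u - v) = f u - f v.
Proof.
move=> lf u v; have := lf (-1) v u; rewrite !scaleN1r => H.
by rewrite (addrC u) H (addrC (- f v)).
Qed.

Lemma linear_scale {R : pzRingType} {U V : lmodType R} (f : U -> V) : linear f ->
  forall k u, f (k *: u) = k *: f u.
Proof.
move=> lf k u; have f0 : f 0 = 0 by have := linear_sub lf 0 0; rewrite !subrr.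
by have := lf k u 0; rewrite f0 !addr0.
Qed.

Lemma lin_near_arith {R : realFieldType} (e e1 B2 B3 BT c0 f g h : R) :
  0 <= B2 -> 0 <= B3 -> 0 <= BT -> 0 <= c0 -> 0 <= f -> 0 <= h ->
  0 <= e1 -> e1 <= 1 -> e1 * (2 + BT + 1 + c0) <= e ->
  e1 * f + B2 * g + (e1 * f + B3 * (h + g)) + ((e1 + BT) * f * e1 + (e1 * f + BT * g) * c0)
  <= e * f + (B2 + B3 + BT * c0) * g + (B2 + B3 + BT * c0) * h.
Proof.
move=> B20 B30 BT0 c00 f0 h0 e10 e11 e1k.
have j1 : e1 * (2 + BT + 1 + c0) * f <= e * f by rewrite ler_wpM2r.
have j2 : e1 * f * e1 <= e1 * f * 1 by rewrite ler_wpM2l// mulr_ge0.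
have j3 : 0 <= B2 * h by rewrite mulr_ge0.
have j4 : 0 <= BT * c0 * h by rewrite !mulr_ge0.
by move: j1 j2 j3 j4; lra.
Qed.

Section Linearization.
Context {R : realType} {r : {posnum R}} {n : nat} {Omega : metricType R}.
Notation E := 'rV[R]_n.
Notation C := (Cspace r n).
Notation W := (Wspace r n).
Variables (sigma : R -> Omega -> Omega) (F : Omega -> E -> E -> E) (tau : Omega -> C -> R).
Hypotheses (hsigma : continuous_flow sigma) (hF : H1 F) (hT : H2 tau).
Hypothesis htau : forall w x, 0 <= tau w x <= r%:num.
Variable M : set (Omega * W).
Hypothesis hM : minimal_set sigma F tau M.

Implicit Types (w : Omega) (x : W) (p q : Omega * W) (phi psi : C).

Definition ptau p : R := tau p.1 p.2.
Definition lag p : E := p.2 (- ptau p).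
Definition Lin2 p (v : E) : E := D2F F p.1 (p.2 0) (lag p) v.
Definition Lin3 p (v : E) : E := D3F F p.1 (p.2 0) (lag p) v.
Definition LinT p phi : R := D2tau tau p.1 p.2 phi.
(** The effect on the equation of sliding the delayed argument along the segment at unit speed; the
    variation of the delay multiplies it. *)
Definition slip p : E := Lin3 p (dot p.2 (- ptau p)).
Definition lin p phi : E := Lin2 p (phi 0) + Lin3 p (phi (- ptau p)) - LinT p phi *: slip p.

Lemma linE p phi : linearization F tau p phi = lin p phi.
Proof.
rewrite /linearization /lin /slip /Lin2 /Lin3 /LinT /D2F /D3F /D2tau !sealed_diffE.
by [].
Qed.

Lemma ptau_seg p : - ptau p \in seg r.
Proof.
by rewrite inE /seg/= in_itv/=; have /andP[? ?] := htau p.1 p.2; rewrite /ptau; apply/andP; split; lra.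
Qed.

Lemma snd_to_C_continuous : continuous (fun p : Omega * W => p.2 : C).
Proof.
move=> p; apply/cvgrPdist_lt => e e0.
have := nbhsx_ballx p _ e0; apply: filterS => q [_] /=; rewrite -ball_normE/= => pq.
exact: (le_lt_trans (wnorm_Cnorm (p.2 - q.2)) pq).
Qed.

Lemma to_C_continuous : continuous (fun p : Omega * W => (p.1, p.2 : C)).
Proof.
by move=> p; apply: continuous_pair; [exact: continuous_fst|exact: snd_to_C_continuous].
Qed.

Lemma ptau_continuous : continuous ptau.
Proof.
move=> p; have [ct _ _ _] := hT.
apply: (@continuous_comp _ _ _ (fun p : Omega * W => (p.1, p.2 : C)) (fun q : Omega * C => tau q.1 q.2)); first exact: to_C_continuous.
exact: ct.
Qed.

Lemma base_point_continuous : continuous (fun p : Omega * W => (p.1, p.2 0 : E, lag p)).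
Proof.
move=> p; apply: continuous_pair; last first.
  apply: (@continuous_comp _ _ _ (fun p : Omega * W => (p.1, p.2 : C)) (fun q : Omega * C => q.2 (- tau q.1 q.2) : E)); first exact: to_C_continuous.
  exact: delayed_value_continuous.
apply: continuous_pair; first exact: continuous_fst.
apply/cvgrPdist_lt => e e0.
have := nbhsx_ballx p _ e0; apply: filterS => q [_] /=; rewrite -ball_normE/= => pq.
exact: (le_lt_trans (le_trans (Cnorm_ub (p.2 - q.2) 0) (wnorm_Cnorm (p.2 - q.2))) pq).
Qed.

Lemma Lin2_near p0 e : 0 < e -> \forall p \near p0, forall v, `|Lin2 p v - Lin2 p0 v| <= e * `|v|.
Proof. by move=> e0; exact: (base_point_continuous (D2F_cont hF (p0.1, p0.2 0, lag p0) e0)). Qed.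

Lemma Lin3_near p0 e : 0 < e -> \forall p \near p0, forall v, `|Lin3 p v - Lin3 p0 v| <= e * `|v|.
Proof. by move=> e0; exact: (base_point_continuous (D3F_cont hF (p0.1, p0.2 0, lag p0) e0)). Qed.

Lemma LinT_near p0 e : 0 < e -> \forall p \near p0, forall phi, `|LinT p phi - LinT p0 phi| <= e * `|phi|.
Proof. by move=> e0; exact: (to_C_continuous (D2tau_cont hT (p0.1, p0.2 : C) e0)). Qed.

Lemma Lin2B p u v : Lin2 p (u - v) = Lin2 p u - Lin2 p v.
Proof. exact: (linear_sub (D2F_lin F p.1 (p.2 0) (lag p))). Qed.

Lemma Lin3B p u v : Lin3 p (u - v) = Lin3 p u - Lin3 p v.
Proof. exact: (linear_sub (D3F_lin F p.1 (p.2 0) (lag p))). Qed.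

Lemma LinTB p phi psi : LinT p (phi - psi) = LinT p phi - LinT p psi.
Proof. exact: (linear_sub (D2tau_lin tau p.1 p.2)). Qed.

Lemma Lin2Z p (k : R) v : Lin2 p (k *: v) = k *: Lin2 p v.
Proof. exact: (linear_scale (D2F_lin F p.1 (p.2 0) (lag p))). Qed.

Lemma Lin3Z p (k : R) v : Lin3 p (k *: v) = k *: Lin3 p v.
Proof. exact: (linear_scale (D3F_lin F p.1 (p.2 0) (lag p))). Qed.

Lemma LinTZ p (k : R) phi : LinT p (k *: phi) = k * LinT p phi.
Proof. exact: (linear_scale (D2tau_lin tau p.1 p.2)). Qed.

Lemma Lin2_bounded p : exists2 B, 0 < B & forall v, `|Lin2 p v| <= B * `|v|.
Proof. exact: D2F_bounded. Qed.

Lemma Lin3_bounded p : exists2 B, 0 < B & forall v, `|Lin3 p v| <= B * `|v|.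
Proof. exact: D3F_bounded. Qed.

Lemma LinT_bounded p : exists2 B, 0 < B & forall v, `|LinT p v| <= B * `|v|.
Proof. exact: D2tau_bounded. Qed.

Lemma linB p phi psi : lin p (phi - psi) = lin p phi - lin p psi.
Proof.
rewrite /lin !CfunB Lin2B Lin3B LinTB.
move: (Lin2 p (phi 0)) (Lin2 p (psi 0)) (Lin3 p (phi _)) (Lin3 p (psi _)) (LinT p phi) (LinT p psi) (slip p) => a a' b b' k k' c.
by rewrite scalerBl !opprD !opprK (addrACA a) [in RHS]addrACA.
Qed.

Lemma linZ p (k : R) phi : lin p (k *: phi) = k *: lin p phi.
Proof.
rewrite /lin !CfunZ Lin2Z Lin3Z LinTZ.
move: (Lin2 p (phi 0)) (Lin3 p (phi _)) (LinT p phi) (slip p) => a b l c.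
by rewrite scalerBr scalerDr scalerA.
Qed.

(** Two motions are controlled: the lag moves along the continuous derivative of [p0.2], and the
    derivative itself changes by at most the W^{1,oo} distance. Both use that points of [M] are
    C^1. *)
Lemma dot_lag_near p0 e : M p0 -> 0 < e ->
  \forall p \near p0, M p -> `|dot p.2 (- ptau p) - dot p0.2 (- ptau p0)| <= e.
Proof.
move=> Mp0 e0; have e20 : 0 < e / 2 by rewrite divr_gt0.
have c0 := M_C1 hsigma hF hT htau hM Mp0.
have [d d0 H] := C1seg_expansion c0 e20.
have m0 : 0 < Num.min d (e / 2) by rewrite lt_min d0.
have n1 : \forall p \near p0, `|p.2 - p0.2| < Num.min d (e / 2).
  have := nbhsx_ballx p0 _ m0; apply: filterS => p [_] /=.
  by rewrite -ball_normE/= distrC.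
have n2 : \forall p \near p0, `|ptau p0 - ptau p| < d.
  by have /cvgrPdist_lt /(_ _ d0) := ptau_continuous (x := p0).
apply: filterS2 n1 n2 => p k1 k2 Mp; have cp := M_C1 hsigma hF hT htau hM Mp.
have k3 : `|- ptau p0 - - ptau p| < d by rewrite opprK addrC distrC.
have x0 : `|p0.2 - p0.2| < d by rewrite subrr normr0.
have [k4 _] := H p0.2 c0 x0 _ _ (ptau_seg p0) (ptau_seg p) k3.
have k5 : `|p.2 - p0.2| <= e / 2 by apply: ltW; apply: lt_le_trans k1 _; rewrite ge_min lexx orbT.
have k6 := le_trans (dotB_le cp c0 (ptau_seg p)) k5.
rewrite (splitr e); exact: (le_trans (ler_distD (dot p0.2 (- ptau p)) _ _) (lerD k6 k4)).
Qed.

Lemma slip_near p0 e : M p0 -> 0 < e -> \forall p \near p0, M p -> `|slip p - slip p0| <= e.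
Proof.
move=> Mp0 e0; have [B3 B30 H3] := Lin3_bounded p0.
have c0 := M_C1 hsigma hF hT htau hM Mp0.
pose D := `|dot p0.2 (- ptau p0)| + 1.
have D0 : 0 < D by rewrite ltr_wpDl.
pose e1 := e / 2 / D; pose e2 := Num.min 1 (e / 2 / B3).
have e10 : 0 < e1 by rewrite !divr_gt0.
have e20 : 0 < e2 by rewrite lt_min ltr01 !divr_gt0.
have e2B : B3 * e2 <= e / 2 by rewrite mulrC -ler_pdivlMr// ge_min lexx orbT.
have e21 : e2 <= 1 by rewrite ge_min lexx.
have e1D : e1 * D = e / 2 by rewrite divfK// gt_eqF.
have n1 := Lin3_near p0 e10; have n2 := dot_lag_near Mp0 e20.
apply: filterS2 n1 n2 => p k1 k2 /k2 {}k2; rewrite /slip.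
move: (k1 (dot p.2 (- ptau p))) (H3 (dot p.2 (- ptau p) - dot p0.2 (- ptau p0))); rewrite Lin3B.
have : `|dot p.2 (- ptau p)| <= D.
  apply: le_trans (norm_le_dist _ (dot p0.2 (- ptau p0))) _.
  by rewrite addrC lerD2l; exact: le_trans e21.
move: (dot p.2 _) (dot p0.2 _) k2 => u u0 k2 k3.
move: (Lin3 p u) (Lin3 p0 u) (Lin3 p0 u0) => v v1 v0 k4 k5.
apply: le_trans (ler_distD v1 _ _) _; rewrite (splitr e); apply: lerD.
  by apply: le_trans k4 _; rewrite -e1D ler_pM2l.
by apply: le_trans k5 _; apply: le_trans e2B; rewrite ler_pM2l.
Qed.

(* The last term is the only one that is not small uniformly in [phi] of norm one; it is
   controlled by the Lipschitz constant when [phi] is in [W^{1,oo}]. *)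
Lemma lin_near p0 : M p0 -> exists2 B, 0 < B & forall e, 0 < e -> \forall p \near p0, M p ->
  forall phi psi, `|lin p phi - lin p0 psi| <=
    e * `|phi| + B * `|phi - psi| + B * `|phi (- ptau p) - phi (- ptau p0)|.
Proof.
move=> Mp0.
have [B2 B20 H2] := Lin2_bounded p0; have [B3 B30 H3] := Lin3_bounded p0.
have [BT BT0 HT] := LinT_bounded p0.
pose c0 := `|slip p0|.
pose B := B2 + B3 + BT * c0.
have c00 : 0 <= c0 by exact: normr_ge0.
have BTc : 0 <= BT * c0 by rewrite mulr_ge0// ltW.
exists B; first by rewrite ltr_pwDl// addr_gt0.
(* [k] collects the coefficients of [e1 * |phi|]: 2 from the partial derivatives of [F], [BT + 1]
   and [c0] from the product of the varying delay derivative and [slip]. *)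
move=> e e0; pose k := 2 + BT + 1 + c0.
have k0 : 0 < k by rewrite /k; lra.
pose e1 := Num.min 1 (e / k).
have e10 : 0 < e1 by rewrite lt_min ltr01 divr_gt0.
have e11 : e1 <= 1 by rewrite ge_min lexx.
have e1k : e1 * k <= e by rewrite -ler_pdivlMr// ge_min lexx orbT.
have n1 := Lin2_near p0 e10; have n2 := Lin3_near p0 e10; have n3 := LinT_near p0 e10.
have n4 := slip_near Mp0 e10.
near=> p => Mp phi psi.
have k1 : forall v, `|Lin2 p v - Lin2 p0 v| <= e1 * `|v| by near: p.
have k2 : forall v, `|Lin3 p v - Lin3 p0 v| <= e1 * `|v| by near: p.
have k3 : forall v, `|LinT p v - LinT p0 v| <= e1 * `|v| by near: p.
have k4 : `|slip p - slip p0| <= e1 by move: Mp; near: p.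
have f0 : `|phi 0| <= `|phi| := Cnorm_ub phi 0.
have fd0 : `|phi 0 - psi 0| <= `|phi - psi| := Cnorm_ub (phi - psi) 0.
have ft : `|phi (- ptau p)| <= `|phi| := Cnorm_ub phi _.
have fdt : `|phi (- ptau p0) - psi (- ptau p0)| <= `|phi - psi| := Cnorm_ub (phi - psi) _.
have t1 : `|Lin2 p (phi 0) - Lin2 p0 (psi 0)| <= e1 * `|phi| + B2 * `|phi - psi|.
  apply: le_trans (ler_distD (Lin2 p0 (phi 0)) _ _) _; apply: lerD.
    by apply: le_trans (k1 _) _; rewrite ler_pM2l.
  by rewrite -Lin2B; apply: le_trans (H2 _) _; rewrite ler_pM2l.
have t2 : `|Lin3 p (phi (- ptau p)) - Lin3 p0 (psi (- ptau p0))| <=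
    e1 * `|phi| + B3 * (`|phi (- ptau p) - phi (- ptau p0)| + `|phi - psi|).
  apply: le_trans (ler_distD (Lin3 p0 (phi (- ptau p))) _ _) _; apply: lerD.
    by apply: le_trans (k2 _) _; rewrite ler_pM2l.
  rewrite -Lin3B; apply: le_trans (H3 _) _; rewrite ler_pM2l//.
  by apply: le_trans (ler_distD (phi (- ptau p0)) _ _) _; rewrite lerD2l.
have t3a : `|LinT p phi| <= (e1 + BT) * `|phi|.
  have := HT phi; have := k3 phi; move: (LinT p phi) (LinT p0 phi) => a b h1 h2.
  have := ler_normD (a - b) b; rewrite subrK => /le_trans; apply.
  by rewrite mulrDl lerD.
have t3b : `|LinT p phi - LinT p0 psi| <= e1 * `|phi| + BT * `|phi - psi|.
  have := HT (phi - psi); rewrite LinTB; have := k3 phi.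
  move: (LinT p phi) (LinT p0 phi) (LinT p0 psi) => a b c h1 h2.
  exact: (le_trans (ler_distD b _ _) (lerD h1 h2)).
have t3 : `|LinT p phi *: slip p - LinT p0 psi *: slip p0| <=
    (e1 + BT) * `|phi| * e1 + (e1 * `|phi| + BT * `|phi - psi|) * c0.
  apply: le_trans (norm_scale_diff _ _ _ _) _; apply: lerD; first by apply: ler_pM.
  by apply: ler_wpM2r.
apply: le_trans (norm_diff3 _ _ _ _ _ _) _.
apply: le_trans (lerD (lerD t1 t2) t3) _.
exact: (lin_near_arith _ (ltW B20) (ltW B30) (ltW BT0) c00 (normr_ge0 _) (normr_ge0 _) (ltW e10) e11 e1k).
Unshelve. all: by end_near. Qed.

End Linearization.

Lemma vfield_linear_arith {R : realFieldType} (e e1 e2 e3 D Lt B3 K d N X : R) : 0 < d ->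
  0 <= N -> 0 <= K ->
  e1 * (2 + D * Lt) <= e / 3 -> B3 * Lt * e3 <= e / 3 -> B3 * D * e2 <= e / 3 -> B3 * Lt <= d^-1 ->
  X <= e1 * (N + (1 + D * Lt) * N) + B3 * (K * (Lt * N) + e3 * (Lt * N) + e2 * N * D) ->
  X <= (e + K / d) * N.
Proof.
move=> d0 N0 K0 h1 h2 h3 h4 /le_trans; apply.
have j1 := ler_wpM2r N0 h1; have j2 := ler_wpM2r N0 h2; have j3 := ler_wpM2r N0 h3.
have j4 := ler_wpM2r (mulr_ge0 K0 N0) h4.
by move: j1 j2 j3 j4; lra.
Qed.

(** * First-order expansion of the vector field, uniformly over the minimal set *)

Section UniformLinearization.
Context {R : realType} {r : {posnum R}} {n : nat} {Omega : metricType R}.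
Notation E := 'rV[R]_n.
Notation C := (Cspace r n).
Notation W := (Wspace r n).
Variables (sigma : R -> Omega -> Omega) (F : Omega -> E -> E -> E) (tau : Omega -> C -> R).
Hypotheses (hsigma : continuous_flow sigma) (hF : H1 F) (hT : H2 tau).
Hypothesis htau : forall w x, 0 <= tau w x <= r%:num.
Variable M : set (Omega * W).
Hypothesis hM : minimal_set sigma F tau M.

Notation vfield := (vfield F tau).
Notation lin := (lin F tau).
Notation Lin2 := (Lin2 F tau).
Notation Lin3 := (Lin3 F tau).
Notation LinT := (LinT tau).
Notation lag := (lag tau).
Notation ptau := (ptau tau).
Notation slip := (slip F tau).
Implicit Types (w : Omega) (x : W) (p q : Omega * W) (phi psi : C).

Lemma M_compact : compact M. Proof. by have [_ _ cM _] := hM. Qed.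

(* On the compact set [M] the topologies of [C] and [W^{1,oo}] coincide. *)
Lemma M_C_W_near p0 e : M p0 -> 0 < e -> exists2 d : R, 0 < d & forall p, M p ->
  `|(p.2 : C) - (p0.2 : C)| < d -> `|p.2 - p0.2| < e.
Proof.
move=> Mp0 e0.
apply: (compact_unif (K := M) (P := fun d p => `|(p.2 : C) - (p0.2 : C)| < d -> `|p.2 - p0.2| < e) M_compact).
  by move=> d d' p _ dd H pd; apply: H; exact: (lt_le_trans pd dd).
move=> p Mp; have [pp0|pp0] := eqVneq p.2 p0.2.
  exists 1 => //; have := nbhsx_ballx p _ e0; apply: filterS => q [_] /=.
  by rewrite -ball_normE/= distrC pp0.
have c0 : 0 < `|(p.2 : C) - (p0.2 : C)|.
  rewrite normr_gt0 subr_eq0; apply: contra_neq pp0; exact: W_ext.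
have c20 : 0 < `|(p.2 : C) - (p0.2 : C)| / 2 by rewrite divr_gt0.
exists (`|(p.2 : C) - (p0.2 : C)| / 2) => //.
have := nbhsx_ballx p _ c20; apply: filterS => q [_] /=; rewrite -ball_normE/= => pq k.
have k1 : `|(p.2 : C) - (q.2 : C)| < `|(p.2 : C) - (p0.2 : C)| / 2.
  exact: (le_lt_trans (wnorm_Cnorm (p.2 - q.2)) pq).
have := le_lt_trans (ler_distD (q.2 : C) (p.2 : C) (p0.2 : C)) (ltrD k1 k).
by rewrite -splitr ltxx.
Qed.

Lemma lin_bounded : exists2 L, 0 < L & forall p, M p -> forall phi, `|lin p phi| <= L * `|phi|.
Proof.
have [d d0 H] : exists2 d, 0 < d & forall p, M p -> M p -> forall phi, `|lin p phi| <= d^-1 * `|phi|.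
  apply: (compact_unif (K := M) (P := fun d p => M p -> forall phi, `|lin p phi| <= d^-1 * `|phi|) M_compact).
    move=> d d' p d'0 dd H Mp phi; apply: le_trans (H Mp phi) _.
    by rewrite ler_wpM2r// lef_pV2// posrE// (lt_le_trans d'0).
  move=> p0 Mp0; have [B B0 H] := lin_near hsigma hF hT htau hM Mp0.
  exists (1 + 3 * B)^-1; first by rewrite invr_gt0 addr_gt0// mulr_gt0.
  apply: filterS (H 1 ltr01) => p Hp Mp phi; rewrite invrK.
  have := Hp Mp phi 0; rewrite subr0.
  have -> : lin p0 0 = 0.
    by have := linB F tau p0 0 0; rewrite !subrr.
  rewrite subr0 => /le_trans; apply.
  have k1 : `|phi (- ptau p) - phi (- ptau p0)| <= 2 * `|phi|.
    apply: le_trans (ler_normB _ _) _; rewrite mulrDl mul1r.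
    by apply: lerD; exact: Cnorm_ub.
  have k2 := ler_wpM2l (ltW B0) k1.
  move: k1 k2; move: (`|phi|) (`|phi (- ptau p) - phi (- ptau p0)|) => f g k1 k2.
  have -> : (1 + 3 * B) * f = 1 * f + B * f + B * (2 * f) by ring.
  by rewrite lerD2l.
exists d^-1; first by rewrite invr_gt0.
by move=> p Mp; exact: H.
Qed.

(** The lag moves with the point, so the estimate cannot hold for the sup norm of the argument; a
    Lipschitz argument turns the motion of the lag into a small error. *)
Lemma lin_unif_continuous e : 0 < e -> exists2 d : R, 0 < d & forall p q, M p -> M q -> ball p d q ->
  forall x, `|lin p (x : C) - lin q (x : C)| <= e * `|x|.
Proof.
move=> e0.
have [d d0 H] : exists2 d, 0 < d & forall p, M p -> M p -> forall q, M q -> ball p d q -> forall x, `|lin p (x : C) - lin q (x : C)| <= e * `|x|.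
  apply: (compact_unif (K := M) (P := fun d p => M p -> forall q, M q -> ball p d q -> forall x, `|lin p (x : C) - lin q (x : C)| <= e * `|x|) M_compact).
    by move=> d d' p d'0 dd H Mp q Mq pq; apply: H => //; exact: (le_ball dd).
  move=> p0 Mp0; have [B B0 H] := lin_near hsigma hF hT htau hM Mp0.
  have e40 : 0 < e / 4 by rewrite divr_gt0.
  have eB : 0 < e / 4 / B by rewrite divr_gt0.
  have n2 : \forall p \near p0, `|ptau p0 - ptau p| < e / 4 / B.
    by have /cvgrPdist_lt /(_ _ eB) := ptau_continuous hT (x := p0).
  have : \forall p \near p0, M p -> forall x, `|lin p (x : C) - lin p0 (x : C)| <= (e / 2) * `|x|.
    apply: filterS2 (H _ e40) n2 => p Hp tp Mp x.
    apply: le_trans (Hp Mp x x) _; rewrite subrr normr0 mulr0 addr0.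
    have k1 : B * `|x (- ptau p) - x (- ptau p0)| <= (e / 4) * `|x|.
      rewrite mulrC -ler_pdivlMr// mulrAC.
      apply: le_trans (wnorm_lip _ _ _) _; rewrite mulrC ler_wpM2r//.
      by rewrite opprK addrC; exact: ltW.
    have k2 : e / 4 * `|(x : C)| <= e / 4 * `|x| by rewrite ler_pM2l// wnorm_Cnorm.
    apply: le_trans (lerD k2 k1) _; rewrite -mulrDl.
    by rewrite (_ : e / 4 + e / 4 = e / 2)//; field.
  move=> /nbhs_ballP[d /= d0 dP]; have d20 : 0 < d / 2 by rewrite divr_gt0.
  exists (d / 2) => //; have := nbhsx_ballx p0 _ d20; apply: filterS => p pd Mp q Mq pq x.
  have k1 := dP p (le_ball (ltW_half d0) pd) Mp x.
  have qd : ball p0 d q by rewrite (splitr d); exact: ball_triangle pd pq.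
  have k2 := dP q qd Mq x; rewrite distrC in k2.
  apply: le_trans (ler_distD (lin p0 x) _ _) _.
  by rewrite (splitr e) mulrDl; exact: lerD k1 k2.
exists d => // p q Mp; exact: H.
Qed.

(** The deviation eta = psi - x is evaluated at the perturbed lag u instead of the lag s of x. Since
    |eta(u) - eta(s)| <= K |u - s| and |u - s| = O(|eta|), this error is of higher order only when
    the Lipschitz constant [K] of the deviation is small as well; hence the term [K / d] in the
    bound, and hence stability in the W^{1,oo} norm. *)
Lemma vfield_linear_near p0 e : M p0 -> 0 < e -> exists2 d : R, 0 < d &
  forall p, M p -> ball p0 d p -> forall psi K, 0 <= K -> `|psi - p.2| < d -> lipC (psi - p.2) K ->
    `|vfield p.1 psi - vfield p.1 p.2 - lin p (psi - p.2)| <= (e + K / d) * `|psi - p.2|.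
Proof.
move=> Mp0 e0; have e30 : 0 < e / 3 by rewrite divr_gt0.
have c0 := M_C1 hsigma hF hT htau hM Mp0.
have [dt1 dt10 [Lt Lt0 HLt]] := tau_loc_lip hT p0.1 (p0.2 : C).
have [B B0 HB] := Lin3_bounded tau hF p0.
pose B3 := 1 + B; have B30 : 0 < B3 by rewrite addr_gt0.
pose D := 1 + `|p0.2|; have D0 : 0 < D by rewrite ltr_pwDl.
have DL0 : 0 < 2 + D * Lt by rewrite addr_gt0// mulr_gt0.
(* Accuracies for the expansions of [F], of [tau] and of the segment. Each is divided by the
   constant that multiplies it in the end, so that each contributes at most [e / 3]. *)
pose e1 := e / 3 / (2 + D * Lt); have e10 : 0 < e1 by rewrite divr_gt0.
pose e2 := e / 3 / (B3 * D); have e20 : 0 < e2 by rewrite divr_gt0// mulr_gt0.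
pose e3 := e / 3 / (B3 * Lt); have e30' : 0 < e3 by rewrite divr_gt0// mulr_gt0.
have h1 : e1 * (2 + D * Lt) <= e / 3 by rewrite divfK// gt_eqF.
have h2 : B3 * Lt * e3 <= e / 3 by rewrite mulrC divfK// gt_eqF// mulr_gt0.
have h3 : B3 * D * e2 <= e / 3 by rewrite mulrC divfK// gt_eqF// mulr_gt0.
have [dF dF0 HF] := F_linear_approx hF p0.1 (p0.2 0) (lag p0) e10.
have [dt2 dt20 HT] := tau_linear_approx hT p0.1 (p0.2 : C) e20.
have [dX dX0 HX] := C1seg_expansion c0 e30'.
have /cvgrPdist_lt /(_ dF dF0) /ball2P[db db0 Hb] := delayed_value_continuous hT (x := (p0.1, p0.2 : C)).
have /nbhs_ballP[dL /= dL0 HL3] := Lin3_near hF hT p0 ltr01.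
pose m := Num.min (Num.min (Num.min dt1 dt2) (Num.min dF db)) (Num.min (Num.min dX dL) 1).
have m0 : 0 < m by rewrite !lt_min dt10 dt20 dF0 db0 dX0 dL0 ltr01.
have [m1 m2 m3 m4] : [/\ m <= dt1, m <= dt2, m <= dF & m <= db] by rewrite /m !ge_min !lexx !orbT.
have [m5 m6 m7] : [/\ m <= dX, m <= dL & m <= 1] by rewrite /m !ge_min !lexx !orbT.
(* [m / 2] leaves room for a triangle inequality, [dX / Lt] keeps the two lags within the range of
   the segment expansion, and the last bound lets [d^-1] dominate the coefficient [B3 * Lt] of
   [K]. *)
pose d := Num.min (m / 2) (Num.min (dX / Lt) (B3 * Lt)^-1).
have d0 : 0 < d by rewrite !lt_min !divr_gt0// invr_gt0 mulr_gt0.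
have dm : d <= m / 2 by rewrite ge_min lexx.
have dmm := le_trans dm (ltW_half m0).
have dXL : d <= dX / Lt by rewrite !ge_min lexx !orbT.
have dB : B3 * Lt <= d^-1.
  by rewrite -[B3 * Lt]invrK lef_pV2 ?posrE ?invr_gt0 ?mulr_gt0// !ge_min lexx !orbT.
exists d => // p Mp pball psi K K0 pd pK; have [/= wd xd] := pball.
have cp := M_C1 hsigma hF hT htau hM Mp.
have xd' : `|p.2 - p0.2| < d by move: xd; rewrite -ball_normE/= distrC.
have xCd : `|(p.2 : C) - (p0.2 : C)| < d := le_lt_trans (wnorm_Cnorm (p.2 - p0.2)) xd'.
have psim : `|psi - (p0.2 : C)| < m.
  rewrite (splitr m); apply: le_lt_trans (ler_distD (p.2 : C) _ _) _.
  exact: (ltrD (lt_le_trans pd dm) (lt_le_trans xCd dm)).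
have xm : `|(p.2 : C) - (p0.2 : C)| < m := lt_le_trans xCd dmm.
have wm := le_ball dmm wd.
set s := - ptau p; set u := - tau p.1 psi.
have ss : s \in seg r := ptau_seg htau p.
have us : u \in seg r.
  by rewrite inE /seg/= in_itv/= /u; have /andP[t1 t2] := htau p.1 psi; rewrite lerN2 t2 oppr_le0 t1.
have usN : `|u - s| <= Lt * `|psi - p.2|.
  have := HLt p.1 psi p.2 (le_ball m1 wm) (lt_le_trans psim m1) (lt_le_trans xm m1).
  by rewrite -[in X in X -> _]normrN opprB /u /s opprK addrC.
have suX : `|s - u| < dX.
  rewrite distrC; apply: le_lt_trans usN _; rewrite mulrC -ltr_pdivlMr//.
  exact: lt_le_trans pd dXL.
have [_ hx] := HX p.2 cp (lt_le_trans xd' (le_trans dmm m5)) s u ss us suX.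
have ht := HT p.1 psi p.2 (le_ball m2 wm) (lt_le_trans psim m2) (lt_le_trans xm m2).
have hb1 := Hb p.1 psi (le_ball m4 wm) (lt_le_trans psim m4); rewrite /= distrC in hb1.
have hb2 := Hb p.1 p.2 (le_ball m4 wm) (lt_le_trans xm m4); rewrite /= distrC in hb2.
have ha1 := le_lt_trans (Cnorm_ub (psi - p0.2) 0) (lt_le_trans psim m3).
have ha2 := le_lt_trans (Cnorm_ub ((p.2 : C) - p0.2) 0) (lt_le_trans xm m3).
have hf := HF p.1 _ _ _ _ (le_ball m3 wm) ha1 hb1 ha2 hb2.
have Lin3b v : `|Lin3 p v| <= B3 * `|v|.
  have k1 := HL3 p (le_ball (le_trans dmm m6) pball) v.
  apply: le_trans (norm_le_dist _ (Lin3 p0 v)) _; rewrite /B3 mulrDl.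
  exact: lerD k1 (HB v).
have dotD : `|dot p.2 s| <= D.
  apply: le_trans (dot_le cp ss) _; apply: le_trans (norm_le_dist _ p0.2) _.
  by rewrite /D lerD2r; apply: ltW; apply: lt_le_trans xd' (le_trans dmm m7).
have xus : `|p.2 u - p.2 s| <= D * (Lt * `|psi - p.2|).
  apply: le_trans (wnorm_lip _ _ _) _; apply: ler_pM => //.
  apply: le_trans (norm_le_dist _ p0.2) _.
  by rewrite /D lerD2r; apply: ltW; apply: lt_le_trans xd' (le_trans dmm m7).
have eta s' : `|psi s' - p.2 s'| <= `|psi - p.2| := Cnorm_ub (psi - p.2) s'.
pose l := LinT p (psi - p.2).
have rho : `|(psi u - p.2 s) - ((psi s - p.2 s) - l *: dot p.2 s)| <=
    K * (Lt * `|psi - p.2|) + e3 * (Lt * `|psi - p.2|) + e2 * `|psi - p.2| * D.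
  (* The three terms are the change of the deviation between the two lags, the first-order error of
     the C^1 segment, and the error in linearizing the delay times the slope. *)
  have -> : (psi u - p.2 s) - ((psi s - p.2 s) - l *: dot p.2 s) =
      ((psi - p.2) u - (psi - p.2) s) + (p.2 u - p.2 s - (u - s) *: dot p.2 s) +
      (u - s + l) *: dot p.2 s.
    rewrite !CfunB; move: (psi u) (psi s) (p.2 u) (p.2 s) (dot p.2 s) => a b a' b' c.
    by apply/rowP => i; rewrite !mxE; ring.
  apply: le_trans (ler_normD _ _) _; apply: lerD.
    apply: le_trans (ler_normD _ _) _; apply: lerD.
      by apply: le_trans (pK _ _) _; rewrite ler_wpM2l.
    by apply: le_trans hx _; rewrite ler_wpM2l// ltW.
  rewrite normrZ; apply: ler_pM => //.
  rewrite -normrN; apply: le_trans ht; rewrite le_eqVlt; apply/orP; left; apply/eqP; congr (`|_|).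
  by rewrite /u /s /l /ptau /LinT; ring.
apply: (vfield_linear_arith d0 (normr_ge0 _) K0 h1 h2 h3 dB).
have idV (a b c c' g h : E) : a - b - (c + g - h) = (a - b - (c + c')) + (c' - (g - h)).
  by apply/rowP => i; rewrite !mxE; ring.
have E1 : vfield p.1 psi - vfield p.1 p.2 - lin p (psi - p.2) = _ :=
  idV _ _ (Lin2 p ((psi - p.2) 0)) (Lin3 p (psi u - p.2 s)) (Lin3 p ((psi - p.2) s)) (l *: slip p).
rewrite E1; apply: le_trans (ler_normD _ _) _; apply: lerD.
  apply: le_trans hf _; rewrite ler_pM2l//; apply: lerD; first exact: eta.
  apply: le_trans (ler_distD (p.2 u) _ _) _; rewrite mulrDl mul1r -mulrA.
  by apply: lerD; [exact: eta|exact: xus].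
rewrite /slip -Lin3Z -!Lin3B; apply: le_trans (Lin3b _) _; rewrite ler_pM2l//.
Qed.

Lemma vfield_linear_approx e : 0 < e -> exists2 d : R, 0 < d &
  forall p, M p -> forall psi K, 0 <= K -> `|psi - p.2| < d -> lipC (psi - p.2) K ->
    `|vfield p.1 psi - vfield p.1 p.2 - lin p (psi - p.2)| <= (e + K / d) * `|psi - p.2|.
Proof.
move=> e0.
pose P (d : R) p := M p -> forall psi K, 0 <= K -> `|psi - p.2| < d -> lipC (psi - p.2) K ->
    `|vfield p.1 psi - vfield p.1 p.2 - lin p (psi - p.2)| <= (e + K / d) * `|psi - p.2|.
have [d d0 H] : exists2 d, 0 < d & forall p, M p -> P d p.
  apply: (compact_unif (K := M) (P := P) M_compact).
    move=> d d' p d'0 dd H Mp psi K K0 pd pK.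
    apply: le_trans (H Mp psi K K0 (lt_le_trans pd dd) pK) _.
    apply: ler_wpM2r; first exact: normr_ge0.
    by rewrite lerD2l ler_wpM2l// lef_pV2// posrE// (lt_le_trans d'0).
  move=> p0 Mp0; have [d d0 H] := vfield_linear_near Mp0 e0.
  exists d => //; have := nbhsx_ballx p0 _ d0; apply: filterS => p pd Mp; exact: H.
by exists d => // p Mp; exact: H.
Qed.

End UniformLinearization.

Lemma continuous_max0 {R : realType} : continuous (fun t : R => Num.max t 0).
Proof. by move=> t; apply: (@continuous_max _ _ id (fun=> 0)); [exact: cvg_id|exact: cvg_cst]. Qed.

Lemma near_max0 {R : realType} (P : R -> Prop) (t0 : R) :
  (\forall t \near Num.max t0 0, P t) -> \forall t \near t0, P (Num.max t 0).
Proof. exact: (@continuous_max0 R t0). Qed.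

Section GronwallGlobal.
Context {R : realType} {V : normedModType R}.

(** [gronwall] for bounds valid globally, with [A] decreasing to [a]. *)
Lemma gronwall_le (d : R -> V) (a c L T : R) : 0 <= T -> 0 <= L -> continuous d ->
  (forall t, t <= 0 -> `|d t| <= a) -> c <= a ->
  (forall t, 0 <= t -> t < T ->
     exists2 d', rderiv d t d' & forall m, (forall s, s <= t -> `|d s| <= m) ->
       `|d'| <= L * m + c) ->
  forall t, t <= T -> `|d t| <= a * expR ((L + 1) * T).
Proof.
move=> T0 L0 cd da ca H t tT.
have e0 : 0 < expR ((L + 1) * T) by rewrite expR_gt0.
apply/ler_addgt0Pr => e ep; pose A := a + e / expR ((L + 1) * T).
have aA : a < A by rewrite ltrDl divr_gt0.
have -> : a * expR ((L + 1) * T) + e = A * expR ((L + 1) * T).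
  by rewrite /A [RHS]mulrDl divfK// gt_eqF.
apply: (@gronwall _ _ d a A c L (A * expR ((L + 1) * T)) T) => //.
  exact: le_trans ca (ltW aA).
by move=> s s0 sT _; exact: H.
Qed.

End GronwallGlobal.

Section LinearGrowth.
Context {R : realType} {r : {posnum R}} {n : nat}.
Notation E := 'rV[R]_n.
Notation C := (Cspace r n).
Notation W := (Wspace r n).
Notation histC := (@histC R r n).
Implicit Types (y : R -> E) (t : R) (G : R -> C -> E) (x : W).

Lemma linear_growth_bound G x L T y : 0 <= L ->
  (forall t phi, 0 <= t -> `|G t phi| <= L * `|phi|) -> 0 <= T -> gsol G x T y ->
  forall t, t <= T -> `|y t| <= `|x : C| * expR ((L + 1) * T).
Proof.
move=> L0 GL T0 [cy y0 dy]; apply: (@gronwall_le _ _ y `|x : C| 0 L T) => //.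
- by move=> t t0; rewrite y0//; exact: Cnorm_ub.
- move=> t t0 tT; exists (G t (histC y t)); first exact: dy.
  move=> m Hm; rewrite addr0; apply: le_trans (GL _ _ t0) _.
  by apply: ler_wpM2l => //; apply: histC_le => // s _; exact: Hm.
Qed.

Lemma linear_growth_global G x L : regular_rhs G -> 0 <= L ->
  (forall t phi, 0 <= t -> `|G t phi| <= L * `|phi|) -> exists y, forall T, gsol G x T y.
Proof.
move=> rG L0 GL; apply: gsol_global => // T0; apply: contrapT => N.
pose S := [set T | exists y, gsol G x T y].
have ub T : S T -> T <= T0.
  move=> [y sy]; rewrite leNgt; apply/negP => TT; apply: N; exists y.
  exact: gsol_mono (ltW TT) sy.
have [h h0 [y1 sy1]] := picard_existence x rG.
have hS : has_sup S by split; [exists h, y1|exists T0].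
pose b := sup S.
have b0 : 0 < b by apply: lt_le_trans h0 _; apply: sup_upper_bound => //; exists y1.
have [||T bT [y sy]] := @gsol_extend _ _ _ G x b rG b0.
- move=> T Tb; have bT0 : 0 < b - T by rewrite subr_gt0.
  have [T' [y sy]] := sup_adherent bT0 hS; rewrite opprB addrC subrK => TT.
  by exists y; apply: gsol_mono (ltW TT) sy.
- exists (L * (`|x : C| * expR ((L + 1) * b))) => T y Tb sy t t0 tT.
  have [cy _ _] := sy; apply: le_trans (GL _ _ t0) _; apply: ler_wpM2l => //.
  apply: histC_le => // s _ st.
  have T0' : 0 <= T by apply: le_trans t0 (ltW tT).
  apply: le_trans (linear_growth_bound L0 GL T0' sy _) _; first exact: le_trans st (ltW tT).
  apply: ler_wpM2l => //; rewrite ler_expR; apply: ler_wpM2l; first by rewrite addr_ge0.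
  exact: ltW.
have : T <= b by apply: sup_upper_bound => //; exists y.
by rewrite leNgt bT.
Qed.

End LinearGrowth.

(** * The linearized equation along the minimal set *)

Section VariationalEquation.
Context {R : realType} {r : {posnum R}} {n : nat} {Omega : metricType R}.
Notation E := 'rV[R]_n.
Notation C := (Cspace r n).
Notation W := (Wspace r n).
Notation histC := (@histC R r n).
Variables (sigma : R -> Omega -> Omega) (F : Omega -> E -> E -> E) (tau : Omega -> C -> R).
Hypotheses (hsigma : continuous_flow sigma) (hF : H1 F) (hT : H2 tau).
Hypothesis htau : forall w x, 0 <= tau w x <= r%:num.
Variable M : set (Omega * W).
Hypothesis hM : minimal_set sigma F tau M.

Notation usol := (usol sigma F tau).
Notation Pi := (Pi sigma F tau).
Notation lin := (lin F tau).
Notation ptau := (ptau tau).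
Notation zsol := (zsol sigma F tau).
Notation wsol := (wsol sigma F tau).
Notation variational_solution := (variational_solution sigma F tau).
Implicit Types (w : Omega) (y z : R -> E) (x v : W) (p q : Omega * W) (phi psi : C).

(** Orbits in [M] are continuous in time for the W^{1,oo} norm: continuity in C holds for any
    solution, and [M_C_W_near] upgrades it. *)
Lemma Pi_near p (t0 e : R) : M p -> 0 <= t0 -> 0 < e ->
  \forall t \near t0, ball (Pi t0 p) e (Pi (Num.max t 0) p).
Proof.
move=> Mp t00 e0.
have [y sy] := (beta_infty hsigma hF hT htau p.1 p.2).1 (M_beta hM Mp).
have [cy _ _] := sy 0.
have hE t : 0 <= t -> usol t p.1 p.2 = histC y t :> C.
  by move=> tt; apply: (usol_histC hsigma hF hT htau (sy (t + 1)) tt); rewrite ltrDl.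
have [d d0 H] := M_C_W_near hM (M_Pi hM t00 Mp) e0.
have n1 : \forall t \near Num.max t0 0, ball (sigma t0 p.1) e (sigma t p.1).
  by rewrite (max_l t00); have /cvg_ballP /(_ e e0) := @flow_cont _ _ _ hsigma p.1 t0.
have n2 : \forall t \near Num.max t0 0, `|histC y t0 - histC y t| < d.
  by rewrite (max_l t00); have /cvgrPdist_lt /(_ d d0) := @continuous_histC R r n y cy t0.
have m1 : \forall t \near t0, ball (sigma t0 p.1) e (sigma (Num.max t 0) p.1).
  exact: (near_max0 n1).
have m2 : \forall t \near t0, `|histC y t0 - histC y (Num.max t 0)| < d.
  exact: (near_max0 n2).
apply: filterS2 m1 m2 => t k1 k2.
have t0' : 0 <= Num.max t 0 by rewrite le_max lexx orbT.
split => //=; rewrite -ball_normE/= distrC.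
apply: (H (Pi (Num.max t 0) p) (M_Pi hM t0' Mp)).
have -> : ((Pi (Num.max t 0) p).2 : C) = histC y (Num.max t 0) by exact: hE.
have -> : ((Pi t0 p).2 : C) = histC y t0 by exact: hE.
by rewrite distrC.
Qed.

(** The semiflow is meaningful at nonnegative times only, while [regular_rhs] asks for continuity in
    all times; the coefficients are therefore frozen before time 0. *)
Definition linear_rhs p (t : R) (phi : C) : E := lin (Pi (Num.max t 0) p) phi.

Lemma linear_rhsE p t phi : 0 <= t -> linear_rhs p t phi = lin (Pi t p) phi.
Proof. by move=> t0; rewrite /linear_rhs max_l. Qed.

Lemma linear_rhs_regular p : M p -> regular_rhs (linear_rhs p).
Proof.
move=> Mp; have max0 t : 0 <= Num.max t (0 : R) by rewrite le_max lexx orbT.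
have [L L0 HL] := lin_bounded hsigma hF hT htau hM.
split; last first.
  move=> t0 x0 K t00; exists 1 => //; exists L; first exact: ltW.
  move=> t phi psi _ _ _ _ _; rewrite /linear_rhs -linB; apply: HL; exact: M_Pi.
move=> [t0 phi0]; rewrite /continuous_at/=; apply/cvgrPdist_le => e e0.
have e3 : e / 4 + (e / 4 + e / 4) <= e by lra.
set p0 := Pi (Num.max t0 0) p.
have Mp0 : M p0 by exact: M_Pi.
have [B B0 H] := lin_near hsigma hF hT htau hM Mp0.
have f0 : 0 < `|phi0| + 1 by rewrite ltr_wpDl.
pose e1 := e / 4 / (`|phi0| + 1).
have e10 : 0 < e1 by rewrite !divr_gt0.
have e40 : 0 < e / 4 by rewrite divr_gt0.
have eB : 0 < e / 4 / B by rewrite divr_gt0.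
have /nbhs_ballP[d1 /= d10 N1] := H e1 e10.
have [d2 d20 N2] : exists2 d2 : R, 0 < d2 & forall q, ball p0 d2 q -> `|phi0 (- ptau q) - phi0 (- ptau p0)| < e / 4 / B.
  have /cvgrPdist_lt /(_ _ eB) /nbhs_ballP[d /= d0 N] := @Cfun_continuous _ _ _ phi0 (- ptau p0).
  have /cvgrPdist_lt /(_ _ d0) /nbhs_ballP[d' /= d'0 N'] := ptau_continuous hT (x := p0).
  exists d' => // q qd; rewrite distrC; apply: N; rewrite /ball/= opprK addrC distrC.
  exact: N'.
pose d := Num.min d1 d2.
have d0 : 0 < d by rewrite lt_min d10.
have n1 : \forall t \near t0, ball p0 d (Pi (Num.max t 0) p).
  have [t00|/ltW t00] := leP 0 t0.
    by rewrite /p0 (max_l t00); exact: Pi_near.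
  have m0 : \forall t \near Num.max t0 0, ball (Pi 0 p) d (Pi (Num.max t 0) p).
    by rewrite (max_r t00); exact: Pi_near.
  have m1 : \forall t \near t0, ball (Pi 0 p) d (Pi (Num.max (Num.max t 0) 0) p).
    exact: (near_max0 m0).
  rewrite /p0 (max_r t00); apply: filterS m1 => t.
  by rewrite (max_l (max0 t)).
have /nbhs_ballP[d3 /= d30 N3] := n1.
(* The factor 3: [B * |phi0 - phi|] occurs once in the bound of [lin_near] and twice when [phi] is
   replaced by [phi0] at the two lags. *)
pose d4 := Num.min d3 (Num.min 1 (e / 4 / (3 * B))).
have d40 : 0 < d4 by rewrite !lt_min d30 ltr01 !divr_gt0// mulr_gt0.
have := nbhsx_ballx (t0, phi0) _ d40; apply: filterS => -[t phi] [/= td phid].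
have {}phid : `|phi0 - phi| < d4 by move: phid; rewrite -ball_normE.
have q1 := N3 t (le_ball (_ : d4 <= d3) td); rewrite ge_min lexx in q1.
have {}q1 := q1 isT.
have p1 : `|phi0 - phi| <= 1 by apply: ltW; apply: lt_le_trans phid _; rewrite !ge_min lexx !orbT.
have p2 : 3 * B * `|phi0 - phi| <= e / 4.
  rewrite mulrC -ler_pdivlMr ?mulr_gt0//; apply: ltW; apply: lt_le_trans phid _.
  by rewrite !ge_min lexx !orbT.
set q := Pi (Num.max t 0) p in q1 *.
have Mq : M q by exact: M_Pi.
have k1 := N1 q (le_ball (_ : d <= d1) q1) Mq phi phi0; rewrite ge_min lexx in k1.
have {}k1 := k1 isT.
have k2 := N2 q (le_ball (_ : d <= d2) q1); rewrite ge_min lexx orbT in k2.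
have {}k2 := k2 isT.
rewrite distrC; apply: le_trans k1 _.
have nf : `|phi| <= `|phi0| + 1.
  by apply: le_trans (norm_le_dist _ phi0) _; rewrite addrC lerD2l distrC.
have j1 : e1 * `|phi| <= e / 4.
  by apply: le_trans (_ : e1 * (`|phi0| + 1) <= _); [rewrite ler_pM2l|rewrite divfK// gt_eqF].
have j3 : `|phi (- ptau q) - phi (- ptau p0)| <= e / 4 / B + (`|phi0 - phi| + `|phi0 - phi|).
  have h s : `|phi0 s - phi s| <= `|phi0 - phi| := Cnorm_ub (phi0 - phi) s.
  apply: le_trans (ler_distD (phi0 (- ptau q)) _ _) _.
  rewrite (distrC (phi _)) addrC [leRHS]addrA; apply: lerD; last exact: h.
  apply: le_trans (ler_distD (phi0 (- ptau p0)) _ _) _; apply: lerD; [exact: ltW|exact: h].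
have j4 := ler_wpM2l (ltW B0) j3.
rewrite (distrC phi phi0).
move: {k2 nf j3 p1 phid} p2 j1 j4; rewrite mulrDr mulrCA divff ?gt_eqF// mulr1.
move: (e1 * _) (`|phi0 - phi|) (`|phi (- ptau q) - _|) => a g h p2 j1 j4.
apply: le_trans (lerD (lerD j1 (lexx _)) j4) _.
rewrite -addrA (_ : B * g + (e / 4 + B * (g + g)) = e / 4 + 3 * B * g); last by ring.
exact: (le_trans (lerD (lexx _) (lerD (lexx _) p2)) e3).
Qed.

Lemma linear_rhs_growth : exists2 L, 0 < L & forall p, M p ->
  forall t phi, 0 <= t -> `|linear_rhs p t phi| <= L * `|phi|.
Proof.
have [L L0 HL] := lin_bounded hsigma hF hT htau hM.
by exists L => // p Mp t phi t0; apply: HL; apply: M_Pi => //; rewrite le_max lexx orbT.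
Qed.

Lemma linear_sol_ex p v : M p -> exists z, forall T, gsol (linear_rhs p) v T z.
Proof.
move=> Mp; have [L L0 HL] := linear_rhs_growth.
exact: (linear_growth_global v (linear_rhs_regular Mp) (ltW L0) (HL p Mp)).
Qed.

Lemma gsol_variational p v z : M p -> (forall T, gsol (linear_rhs p) v T z) ->
  variational_solution p v z.
Proof.
move=> Mp sz; have [cz z0 _] := sz 0.
have [cG _] := linear_rhs_regular Mp.
split.
- by move=> s; rewrite inE /seg/= in_itv/= => /andP[_ s0]; rewrite z0.
- by apply: continuous_subspaceT => ?; exact: cz.
- move=> t t0; rewrite linE.
  have -> : lin (Pi t p) (histC z t) = linear_rhs p t (histC z t) by rewrite /linear_rhs max_l.
  have : has_deriv_within [set u | 0 <= u /\ (u%:E < +oo)%E] z t (linear_rhs p t (histC z t)).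
    apply: (@rderiv_has_deriv _ _ z (fun t => linear_rhs p t (histC z t)) 0 +oo%E cz).
    - exact: continuous_rhs.
    - by move=> u u0 _; have [_ _ dz] := sz (u + 1); apply: dz; rewrite // ltrDl.
    - by [].
    - exact: ltry.
  apply: has_deriv_within_sub => u; rewrite /= in_itv/= andbT => u0; split => //; exact: ltry.
Qed.

Lemma variational_gsol p v z : M p -> variational_solution p v z ->
  forall T, gsol (linear_rhs p) v T (fun t => z (Num.max t (- r%:num))).
Proof.
move=> Mp [z0 cz dz] T; set Z := (fun t => z _).
have r0 : 0 < r%:num by [].
have cZ : continuous Z.
  apply: (@continuous_comp_within _ _ _ z (fun t => Num.max t (- r%:num)) cz).
    by move=> t; apply: (@continuous_max _ _ id (fun=> - r%:num)); [exact: cvg_id|exact: cvg_cst].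
  by move=> t; rewrite /= in_itv/= andbT le_max lexx orbT.
have ZE t : - r%:num <= t -> Z t = z t by move=> t1; rewrite /Z max_l.
split => //.
  move=> t t0; have cE : Num.max t (- r%:num) = clamp r t by rewrite /clamp min_l// maxC.
  by rewrite /Z cE z0 ?clamp_seg// Cfun_clamp.
move=> t t0 _.
have hE : Defs.histC z t = histC Z t.
  rewrite /Defs.histC; congr insubd; apply/funext => s.
  by rewrite ZE//; have := clamp_geN (r := r) s; move: t0; lra.
have := dz t t0; rewrite hE linE => H.
have {}H : rderiv z t (linear_rhs p t (histC Z t)).
  rewrite /linear_rhs max_l//; apply: has_deriv_within_rderiv H; near=> h.
  have h0 : 0 < h by near: h; exact: nbhs_right_gt.
  by rewrite /= in_itv/= andbT addr_ge0// ltW.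
apply: rderiv_eq H; last by apply: ZE; move: r0 t0; lra.
near=> h; have h0 : 0 < h by near: h; exact: nbhs_right_gt.
by apply: ZE; move: r0 t0 h0; lra.
Unshelve. all: by end_near. Qed.

Lemma zsol_gsol p v z t : M p -> (forall T, gsol (linear_rhs p) v T z) -> - r%:num <= t ->
  zsol p v t = z t.
Proof.
move=> Mp sz rt; have ex := ex_intro (variational_solution p v) z (gsol_variational Mp sz).
have /(variational_gsol Mp) sz' : variational_solution p v (zsol p v).
  by rewrite /Defs.zsol; exact: (xgetPex 0 ex).
have := gsol_unique (linear_rhs_regular Mp) (sz' (t + 1)) (sz (t + 1)) (t := t).
by rewrite max_l//; apply; rewrite ltrDl.
Qed.

Lemma wsol_histC p v z t : M p -> (forall T, gsol (linear_rhs p) v T z) -> 0 <= t ->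
  wsol t p v = histC z t :> C.
Proof.
move=> Mp sz t0; have [cz _ _] := sz 0.
have hE : histC (zsol p v) t = histC z t.
  rewrite /Defs.histC; congr insubd; apply/funext => s; apply: zsol_gsol => //.
  by have := clamp_geN (r := r) s; move: t0; lra.
have tt : t < t + 1 by rewrite ltrDl.
have [K K0 zK] := gsol_lip (linear_rhs_regular Mp).1 (sz (t + 1)) tt.
by rewrite -hE; apply: (@histWE _ _ _ _ _ K); rewrite hE; apply: histC_lip => //; exact: ltW.
Qed.

Lemma wsolZ p v t (k : R) : M p -> 0 <= t -> wsol t p (k *: v) = k *: wsol t p v.
Proof.
move=> Mp t0; have [z sz] := linear_sol_ex v Mp; have [cz z0 _] := sz 0.
have ckz : continuous (fun t => k *: z t) by move=> u; apply: cvgZl_tmp; exact: cz.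
have hE u : histC (fun t => k *: z t) u = k *: histC z u.
  by apply: C_ext => s _ _; rewrite CfunZ !histC_cont.
have sz' T : gsol (linear_rhs p) (k *: v) T (fun t => k *: z t).
  split => //; first by move=> u u0; rewrite z0// WfunZ CfunZ.
  move=> u u0 uT; rewrite hE /linear_rhs linZ; apply: rderivZ.
  by have [_ _ dz] := sz T; exact: dz.
by apply: W_ext; rewrite (wsol_histC Mp sz' t0) hE WfunZ (wsol_histC Mp sz t0).
Qed.

Lemma wsol_bound T : 0 <= T -> exists2 B, 0 < B & forall p v, M p -> forall t, 0 <= t -> t <= T ->
  `|wsol t p v| <= B * `|v|.
Proof.
move=> T0; have [L L0 HL] := linear_rhs_growth.
pose ex := expR ((L + 1) * T).
have ex1 : 1 <= ex by rewrite /ex -[leLHS]expR0 ler_expR mulr_ge0// addr_ge0// ltW.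
exists ((L + 1) * ex); first by rewrite mulr_gt0 ?addr_gt0// (lt_le_trans ltr01).
move=> p v Mp t t0 tT; have [z sz] := linear_sol_ex v Mp; have [cz z0 _] := sz 0.
have vb : `|(v : C)| <= `|v| := wnorm_Cnorm v.
have zb s : s <= T -> `|z s| <= ex * `|v|.
  move=> sT; apply: le_trans (linear_growth_bound (ltW L0) (HL p Mp) T0 (sz T) sT) _.
  by rewrite mulrC; apply: ler_wpM2l => //; exact: (le_trans ler01 ex1).
have [v0|v0] := eqVneq `|v| 0.
  have -> : v = 0 *: v by apply/eqP; rewrite scale0r -normr_eq0 v0.
  by rewrite wsolZ// !scale0r !normr0 mulr0.
have vp : 0 < `|v| by rewrite lt_def v0 normr_ge0.
have K0 : 0 < (L + 1) * ex * `|v| by rewrite !mulr_gt0// ?addr_gt0// (lt_le_trans ltr01).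
have zl := @gsol_lip_bound _ _ _ (linear_rhs p) v T z (L * (ex * `|v|)) T0 (sz T).
have {}zl : lipto z (Num.max `|v| (L * (ex * `|v|))) T.
  apply: zl => s s0 sT; apply: le_trans (HL p Mp _ _ s0) _; apply: ler_wpM2l; first exact: ltW.
  by apply: histC_le => // u _ us; apply: zb; exact: le_trans us (ltW sT).
have mb : Num.max `|v| (L * (ex * `|v|)) <= (L + 1) * ex * `|v|.
  rewrite ge_max; apply/andP; split.
    rewrite ler_peMl// mulr_ege1// lerDr; exact: ltW.
  by rewrite -mulrA; apply: ler_wpM2r; [rewrite mulr_ge0// (le_trans ler01)|rewrite lerDl].
have hE := wsol_histC Mp sz t0.
apply: wnorm_le => //.
  rewrite hE; apply: histC_le => // s _ st; apply: le_trans (zb s (le_trans st tT)) _.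
  rewrite -mulrA; apply: ler_peMl; last by rewrite lerDr ltW.
  by apply: mulr_ge0 => //; exact: (le_trans ler01 ex1).
move=> s u; rewrite hE !histC_cont//; apply: le_trans (zl _ _ _ _) _.
- by have := clamp_le0 (r := r) s; move: tT; lra.
- by have := clamp_le0 (r := r) u; move: tT; lra.
rewrite opprD addrACA subrr add0r; apply: ler_pM => //; last exact: clamp_lip.
by rewrite le_max normr_ge0.
Qed.

End VariationalEquation.

(** * Uniform contraction along the minimal set *)

Section LipschitzBallCompact.
Context {R : realType} {r : {posnum R}} {n : nat}.
Notation E := 'rV[R]_n.
Notation C := (Cspace r n).

Lemma ultra_bounded_cvg {T : Type} (U : set_system T) (UU : UltraFilter U) (f : T -> R) a b :
  U [set v | a <= f v <= b] -> exists p, forall e, 0 < e -> U [set v | `|f v - p| < e].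
Proof.
move=> Uab; have PF := @ultra_proper _ _ UU.
have [|p [_ clp]] := @segment_compact R a b (f @ U) _.
  have -> : (f @ U) `[a, b]%classic = U [set v | a <= f v <= b]; last by [].
  by congr U; apply/seteqP; split => v; rewrite /= in_itv.
exists p => e e0; have [//|UC] := in_ultra_setVsetC [set v | `|f v - p| < e] UU.
have nb : nbhs p (ball p e) by apply: nbhsx_ballx.
have UC' : (f @ U) (~` [set u | `|u - p| < e]) by exact: UC.
have [u [/= h1 h2]] := clp _ _ UC' nb; exfalso; apply: h1.
by move: h2; rewrite /ball/= distrC.
Qed.

(** The unit ball of W^{1,oo} as a subset of C, by [wnorm_le] and [wnorm_lip]. *)
Definition lip_ball : set C := [set v | `|v| <= 1 /\ lipC v 1].

Lemma entry_le (u : E) i j : `|u i j| <= `|u|.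
Proof. by rewrite [leRHS]/Num.Def.normr/= mx_normrE; exact: (le_bigmax _ _ (i, j)). Qed.

Lemma row_le (u : E) k : 0 <= k -> (forall j, `|u 0 j| <= k) -> `|u| <= k.
Proof.
move=> k0 H; rewrite [leLHS]/Num.Def.normr/= mx_normrE; apply: bigmax_le => //.
by move=> [i j] _; rewrite (ord1 i).
Qed.

(* Ascoli: pointwise limits along an ultrafilter of 1-Lipschitz functions are uniform. *)
Lemma lip_ball_compact : compact lip_ball.
Proof.
rewrite compact_ultra => U UU UB; have PF := @ultra_proper _ _ UU.
have FU : Filter U by exact: filter_filter.
have /choice[f Hf] : forall s : R, exists p : E, forall e, 0 < e -> U [set v : C | `|v s - p| <= e].
  move=> s; have /choice[p Hp] : forall j, exists p : R, forall e, 0 < e -> U [set v : C | `|v s 0 j - p| < e].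
    move=> j; apply: (@ultra_bounded_cvg _ _ UU (fun v : C => v s 0 j) (-1) 1).
    apply: filterS UB => v [v1 _]; rewrite /= -ler_norml.
    by apply: le_trans (entry_le _ _ _) _; apply: le_trans (Cnorm_ub v s) v1.
  exists (\row_j p j) => e e0.
  have := @filter_forall _ _ _ U FU (fun j => Hp j e e0); apply: (@filterS _ U FU) => v Hv /=.
  by apply: row_le => [|j]; [exact: ltW|rewrite !mxE; exact: ltW (Hv j)].
have limle (A B : E) (k : R) : (forall e, 0 < e -> `|A - B| <= k + e) -> `|A - B| <= k.
  by move=> H; apply/ler_addgt0Pr.
have flip s t : `|f s - f t| <= `|s - t|.
  apply: limle => e e0; have e20 : 0 < e / 2 by rewrite divr_gt0.
  have [v [[_ vl] [h1 h2]]] := filter_ex (filterI UB (filterI (Hf s _ e20) (Hf t _ e20))).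
  have h3 := vl s t; rewrite mul1r in h3; rewrite /= in h1 h2; rewrite distrC in h1.
  have := le_trans (ler_distD (v s) (f s) (f t)) (lerD h1 (le_trans (ler_distD (v t) (v s) (f t)) (lerD h3 h2))).
  by move/le_trans; apply; rewrite addrCA -splitr.
have fclamp : f \o clamp r = f.
  apply/funext => s /=; apply/eqP; rewrite -subr_eq0 -normr_le0; apply: limle => e e0.
  have e20 : 0 < e / 2 by rewrite divr_gt0.
  have [v [h1 h2]] := filter_ex (filterI (Hf (clamp r s) _ e20) (Hf s _ e20)).
  rewrite /= Cfun_clamp distrC in h1; rewrite /= in h2.
  by have := le_trans (ler_distD (v s) _ _) (lerD h1 h2); rewrite add0r -splitr.
have fl1 s t : `|f s - f t| <= 1 * `|s - t| by rewrite mul1r.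
have fin : f \in @contseg R r n by rewrite inE; split => //; exact: (lip_continuous fl1).
pose v0 : C := MkCspace fin.
have v0E s : v0 s = f s by [].
exists v0; split.
  split; last by move=> s t; exact: fl1.
  apply: Cnorm_le => s; rewrite v0E -[f s]subr0; apply: limle => e e0.
  have [v [[v1 _] /= h]] := filter_ex (filterI UB (Hf s e e0)).
  rewrite subr0; apply: le_trans (norm_le_dist _ (v s)) _; rewrite addrC distrC.
  by apply: lerD h; apply: le_trans (Cnorm_ub v s) v1.
move=> P /nbhs_ballP[e /= e0 eP].
have e40 : 0 < e / 4 by rewrite divr_gt0.
have e3 : e / 4 + (e / 4 + e / 4) < e by lra.
(* Near each [s0] three shares of [e / 4] suffice: the limit between [s] and [s0], the pointwise
   limit at [s0], and [v] between [s0] and [s]. Compactness of the segment then gives one set of the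
   ultrafilter for all [s]. *)
have : U [set v : C | `[- r%:num, 0]%classic `<=` [set s | `|f s - v s| <= e / 4 + (e / 4 + e / 4)]].
  have /compact_near_coveringP cK := @segment_compact R (- r%:num) 0.
  apply: (cK _ U (fun (v : C) s => `|f s - v s| <= e / 4 + (e / 4 + e / 4))) => s0 _.
  exists ([set s | `|s0 - s| < e / 4], [set v | lip_ball v /\ `|v s0 - f s0| <= e / 4]) => /=.
    split; first by exists (e / 4).
    by apply: filterI UB (Hf s0 _ e40).
  move=> [s v] /= [h1 [[_ vl] h2]].
  apply: le_trans (ler_distD (f s0) _ _) _; apply: lerD.
    by rewrite distrC; apply: le_trans (flip _ _) _; exact: ltW.
  rewrite distrC in h2; apply: le_trans (ler_distD (v s0) _ _) _; apply: lerD h2 _.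
  by apply: le_trans (vl _ _) _; rewrite mul1r; exact: ltW.
apply: (@filterS _ U FU) => v Hv; apply: eP; rewrite -ball_normE/=.
apply: le_lt_trans e3; apply: supnorm_le => s ss.
rewrite CfunB v0E; apply: Hv; by rewrite -inE.
Qed.

End LipschitzBallCompact.

Section AbstractDecay.
Context {R : realType}.

(** The time [T] of the next contraction depends on the state. Its upper bound [N] limits the growth
    in between to [B * expR (b * N)]; its lower bound [r] ensures that finitely many steps reach any
    given time, which is what the induction counts. *)
Lemma abstract_decay {X : Type} (S : set X) (a : X -> R -> R) (r N b B : R) :
  0 < r -> 0 <= b -> 0 <= B -> (forall x t, S x -> 0 <= a x t) ->
  (forall x t, S x -> 0 <= t -> t <= N -> a x t <= B * a x 0) ->
  (forall x, S x -> exists2 T, r <= T <= N & expR (b * T) * a x T <= a x 0 / 2 /\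
     exists2 x', S x' & forall s, 0 <= s -> a x' s = a x (T + s)) ->
  forall x t, S x -> 0 <= t -> a x t <= B * expR (b * N) * expR (- b * t) * a x 0.
Proof.
move=> r0 b0 B0 a0 aB step.
have key (k : nat) x t : S x -> 0 <= t -> t <= k%:R * r -> a x t <= B * expR (b * N) * expR (- b * t) * a x 0.
  elim: k x t => [|k IH] x t Sx t0 tk.
    have -> : t = 0 by apply/eqP; rewrite eq_le t0 andbT; move: tk; rewrite mul0r.
    have [T /andP[rT TN] _] := step x Sx.
    have N0 : 0 <= N by rewrite (le_trans _ TN)// (le_trans (ltW r0)).
    rewrite mulr0 expR0 mulr1; apply: le_trans (aB x 0 Sx (lexx _) N0) _.
    apply: ler_wpM2r; first exact: a0.
    by rewrite ler_peMr// -[leLHS]expR0 ler_expR mulr_ge0.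
  have [tN|Nt] := leP t N.
    apply: le_trans (aB x t Sx t0 tN) _; apply: ler_wpM2r; first exact: a0.
    rewrite -mulrA ler_peMr// -expRD -[leLHS]expR0 ler_expR.
    by rewrite mulNr -mulrBr mulr_ge0// subr_ge0.
  have [T /andP[rT TN] [h1 [x' Sx' hx']]] := step x Sx.
  have tT0 : 0 <= t - T by rewrite subr_ge0 (le_trans TN)// ltW.
  have tTk : t - T <= k%:R * r.
    by move: tk rT; rewrite -natr1 mulrDl mul1r; lra.
  have := IH x' (t - T) Sx' tT0 tTk; rewrite !hx'// addr0 addrC subrK => h2.
  apply: (le_trans h2).
  have -> : expR (- b * (t - T)) = expR (- b * t) * expR (b * T) by rewrite -expRD; congr expR; ring.
  have E0 : 0 <= B * expR (b * N) * expR (- b * t) by rewrite !mulr_ge0 ?expR_ge0.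
  rewrite mulrA -mulrA; apply: ler_wpM2l => //; apply: le_trans h1 _.
  by rewrite ler_pdivrMr// ler_peMr ?ler1n// a0.
move=> x t Sx t0; apply: (key (Num.truncn (t / r)).+1) => //.
have tr0 : 0 <= t / r by rewrite divr_ge0// ltW.
by rewrite -ler_pdivrMr// ltW//; have /andP[] := truncn_itv tr0.
Qed.

End AbstractDecay.

Section DelayedGronwall.
Context {R : realType} {r : {posnum R}} {n : nat}.
Notation E := 'rV[R]_n.
Notation C := (Cspace r n).
Notation W := (Wspace r n).
Notation histC := (@histC R r n).

Lemma hist_wnorm_le (v : W) (d : R -> E) t k : continuous d -> v = histC d t :> C -> 0 <= k ->
  (forall s, t - r%:num <= s -> s <= t -> `|d s| <= k) ->
  (forall s u, t - r%:num <= s -> s <= u -> u <= t -> `|d u - d s| <= k * (u - s)) ->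
  `|v| <= k.
Proof.
move=> cd vE k0 dk dl; apply/ler_addgt0Pr => e e0.
have ke : 0 < k + e by rewrite ltr_wpDl.
have val s : v s = d (t + clamp r s) by rewrite vE histC_cont.
have kke : k <= k + e by rewrite lerDl ltW.
have r1 s : t - r%:num <= t + clamp r s by rewrite lerD2l clamp_geN.
have r2 s : t + clamp r s <= t by rewrite gerDl clamp_le0.
apply: wnorm_le => //.
  apply: le_trans kke; apply: Cnorm_le => s; rewrite val; exact: dk.
move=> s u; wlog su : s u / clamp r s <= clamp r u.
  move=> Hw; have [/Hw//|/ltW/Hw] := leP (clamp r s) (clamp r u).
  by rewrite distrC (distrC s).
rewrite !val distrC; have su' : t + clamp r s <= t + clamp r u by rewrite lerD2l.
apply: le_trans (dl _ _ (r1 _) su' (r2 _)) _; rewrite opprD addrACA subrr add0r.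
apply: ler_pM => //; first by rewrite subr_ge0.
by rewrite distrC; apply: le_trans (clamp_lip r _ _); exact: ler_norm.
Qed.

(** The bound on the derivative inside Gronwall is itself a Lipschitz bound, so the sup estimate
    becomes one in W^{1,oo}. The forcing [c <= a] is absorbed by passing from the factor [L] to
    [L + 1]. *)
Lemma gronwall_lip (d : R -> E) (a c L T : R) : 0 <= T -> 0 <= L -> continuous d ->
  (forall t, t <= 0 -> `|d t| <= a) -> c <= a ->
  (forall t, 0 <= t -> t < T ->
     exists2 d', rderiv d t d' & forall m, (forall s, s <= t -> `|d s| <= m) ->
       `|d'| <= L * m + c) ->
  let k := (L + 1) * expR ((L + 1) * T) * a in
  [/\ a <= k, forall t, t <= T -> `|d t| <= k &
      forall s u, 0 <= s -> s <= u -> u <= T -> `|d u - d s| <= k * (u - s)].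
Proof.
move=> T0 L0 cd da ca H k.
have a0 : 0 <= a := le_trans (normr_ge0 _) (da 0 (lexx _)).
have G := gronwall_le T0 L0 cd da ca H.
have L1 : 1 <= L + 1 by rewrite lerDr.
have ex1 : 1 <= expR ((L + 1) * T).
  by rewrite -[leLHS]expR0 ler_expR mulr_ge0// (le_trans ler01).
have kE : k = L * (a * expR ((L + 1) * T)) + a * expR ((L + 1) * T) by rewrite /k; ring.
have aex : a <= a * expR ((L + 1) * T) by rewrite ler_peMr.
have exk : a * expR ((L + 1) * T) <= k.
  by rewrite kE lerDr mulr_ge0// mulr_ge0// ltW// expR_gt0.
split; first exact: le_trans exk.
  by move=> t tT; apply: le_trans (G t tT) _.
move=> s u s0 su uT; apply: mean_value_cst => // t st tu.
have t0 := le_trans s0 st; have tT := lt_le_trans tu uT.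
have [d' dd' Hd'] := H t t0 tT; exists d' => //.
apply: le_trans (Hd' (a * expR ((L + 1) * T)) _) _.
  by move=> v vt; apply: G; exact: le_trans vt (ltW tT).
by rewrite kE lerD2l (le_trans ca).
Qed.

End DelayedGronwall.

Section UniformContraction.
Context {R : realType} {r : {posnum R}} {n : nat} {Omega : metricType R}.
Notation E := 'rV[R]_n.
Notation C := (Cspace r n).
Notation W := (Wspace r n).
Notation histC := (@histC R r n).
Variables (sigma : R -> Omega -> Omega) (F : Omega -> E -> E -> E) (tau : Omega -> C -> R).
Hypotheses (hsigma : continuous_flow sigma) (hF : H1 F) (hT : H2 tau).
Hypothesis htau : forall w x, 0 <= tau w x <= r%:num.
Variable M : set (Omega * W).
Hypothesis hM : minimal_set sigma F tau M.

Notation Pi := (Pi sigma F tau).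
Notation lin := (lin F tau).
Notation wsol := (wsol sigma F tau).
Notation linear_rhs := (linear_rhs sigma F tau).
Notation upper_lyapunov := (upper_lyapunov sigma F tau).
Implicit Types (w : Omega) (y z : R -> E) (x v : W) (p q : Omega * W) (phi psi : C).

Lemma Pi_unif_near p0 T e : M p0 -> 0 <= T -> 0 < e ->
  exists2 d : R, 0 < d & forall p, ball p0 d p ->
    forall t, 0 <= t -> t <= T -> ball (Pi t p0) e (Pi t p).
Proof.
move=> Mp0 T0 e0; have e20 : 0 < e / 2 by rewrite divr_gt0.
have e2 : e / 2 < e by move: e0; lra.
have [d1 d10 H1] := @flow_unif _ _ _ hsigma p0.1 T e e0.
have [d2 d20 H2] := usol_near hsigma hF hT htau T0 e20 (M_beta hM Mp0).
pose d := Num.min (Num.min d1 d2) (e / 2).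
have d0 : 0 < d by rewrite !lt_min d10 d20.
have dd1 : d <= d1 by rewrite !ge_min lexx.
have dd2 : d <= d2 by rewrite !ge_min lexx orbT.
have dd3 : d <= e / 2 by rewrite !ge_min lexx orbT.
exists d => // -[w x] [/= wd xd].
have {}xd : `|x - p0.2| < d by move: xd; rewrite -ball_normE/= distrC.
move=> t t0 tT; split => /=; first exact: (H1 _ (le_ball dd1 wd)).
have [_ /(_ t t0 tT) [_ k]] := H2 w x (le_ball dd2 wd) (le_lt_trans (wnorm_Cnorm (x - p0.2)) (lt_le_trans xd dd2)).
rewrite -ball_normE/= distrC; apply: (le_lt_trans k).
by rewrite gt_max e2/=; apply: (lt_trans _ e2); exact: (lt_le_trans xd dd3).
Qed.

(** Initial segments close in C suffice, since after one delay the whole segment at time [T] lies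
    where the difference solves an equation. This admits the compactness of [lip_ball] in C. *)
Lemma wsol_near p0 v0 T e : M p0 -> r%:num <= T -> 0 < e ->
  exists2 d : R, 0 < d & forall p, M p -> ball p0 d p ->
    forall v, `|(v : C) - (v0 : C)| < d -> `|wsol T p v - wsol T p0 v0| <= e.
Proof.
move=> Mp0 rT e0; have T0 : 0 <= T by apply: le_trans rT.
have [L L0 HL] := lin_bounded hsigma hF hT htau hM.
have [B B0 HB] := wsol_bound hsigma hF hT htau hM T0.
pose ex := (L + 1) * expR ((L + 1) * T).
have ex0 : 0 < ex by rewrite mulr_gt0 ?expR_gt0// addr_gt0.
pose a := e / ex; have a0 : 0 < a by rewrite divr_gt0.
have Bv0 : 0 < B * (`|v0| + 1) by rewrite mulr_gt0// ltr_wpDl.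
(* The change of the coefficients acts on the reference segment, whose W^{1,oo} norm is at most
   [B * |v0|] up to time [T]; the result must not exceed [a]. *)
pose e1 := a / (B * (`|v0| + 1)); have e10 : 0 < e1 by rewrite divr_gt0.
have [d1 d10 H1] := lin_unif_continuous hsigma hF hT htau hM e10.
have [d2 d20 H2] := Pi_unif_near Mp0 T0 d10.
exists (Num.min d2 a); first by rewrite lt_min d20.
have dd1 : Num.min d2 a <= d2 by rewrite ge_min lexx.
have dd2 : Num.min d2 a <= a by rewrite ge_min lexx orbT.
move=> p Mp pd v vd.
have [z sz] := linear_sol_ex hsigma hF hT htau hM v Mp.
have [z0 sz0] := linear_sol_ex hsigma hF hT htau hM v0 Mp0.
have [cz zv dz] := sz T; have [cz0 z0v dz0] := sz0 T.
have cd : continuous (fun t => z t - z0 t) by move=> t; apply: cvgB; [exact: cz|exact: cz0].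
have da t : t <= 0 -> `|z t - z0 t| <= a.
  move=> t0; rewrite zv// z0v//; apply: le_trans (Cnorm_ub ((v : C) - v0) t) _.
  exact: ltW (lt_le_trans vd dd2).
have [|k1 k2 k3] := @gronwall_lip _ _ (fun t => z t - z0 t) a a L T T0 (ltW L0) cd da (lexx a).
  move=> t t0 tT.
  exists (linear_rhs p t (histC z t) - linear_rhs p0 t (histC z0 t)).
    by apply: rderivB; [exact: dz|exact: dz0].
  move=> m Hm; rewrite !(linear_rhsE _ _ _ _ _ t0).
  apply: le_trans (ler_distD (lin (Pi t p) (histC z0 t)) _ _) _.
  rewrite -(linB F tau); apply: lerD.
    apply: le_trans (HL _ (M_Pi hM t0 Mp) _) _; apply: ler_wpM2l; first exact: ltW.
    by apply: histCB_le => // s _ ts; exact: Hm.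
  have hE := wsol_histC hsigma hF hT htau hM Mp0 sz0 t0.
  have wb := HB p0 v0 Mp0 t t0 (ltW tT).
  rewrite -hE distrC; apply: le_trans (H1 _ _ (M_Pi hM t0 Mp0) (M_Pi hM t0 Mp) _ _) _.
    exact: (H2 p (le_ball dd1 pd) t t0 (ltW tT)).
  rewrite /e1 mulrAC ler_pdivrMr// ler_pM2l//; apply: (le_trans wb).
  by rewrite ler_pM2l// lerDl.
have kE : ex * a = e by rewrite /a mulrC divfK// gt_eqF.
rewrite kE in k2 k3.
have h1 := wsol_histC hsigma hF hT htau hM Mp sz T0.
have h2 := wsol_histC hsigma hF hT htau hM Mp0 sz0 T0.
move: (wsol T p v) (wsol T p0 v0) h1 h2 => u1 u2 h1 h2.
have h12 : Wfun (u1 - u2) = histC (fun t => z t - z0 t) T.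
  by rewrite WfunB h1 h2; apply: C_ext => s _ _; rewrite CfunB !histC_cont.
apply: (hist_wnorm_le cd h12 (ltW e0)).
- by move=> s _ sT; exact: k2.
- by move=> s u s1 su uT; apply: k3 => //; apply: le_trans s1; rewrite subr_ge0.
Qed.

Lemma lyapunov_pointwise (b T0 : R) p v : (upper_lyapunov M < (- b)%:E)%E -> M p ->
  exists2 T, T0 <= T & expR (b * T) * `|wsol T p v| < 4^-1.
Proof.
move=> hb Mp; have [v0|v0] := eqVneq v 0.
  have t0 : 0 <= Num.max T0 0 by rewrite le_max lexx orbT.
  exists (Num.max T0 0); first by rewrite le_max lexx.
  have -> : v = 0 *: v by rewrite v0 scaler0.
  by rewrite (wsolZ hsigma hF hT htau hM)// scale0r normr0 mulr0 invr_gt0.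
have : (limf_esup (fun t : R => (t^-1)%:E * lne (`|wsol t p v|)%:E)%E +oo%R < (- b)%:E)%E.
  apply: le_lt_trans hb; apply: ereal_sup_ubound; exists (p, v) => //.
rewrite limf_esupE => /ereal_inf_lt[_ /= [A [S [Sr HS]] <-]].
rewrite -lteN2 -EFinN opprK => /ereal_between[c bc cy].
have {}cy : (ereal_sup [set ((t^-1)%:E * lne (`|wsol t p v|)%:E)%E | t in A] <= (- c)%:E)%E.
  by rewrite -leeN2 -EFinN opprK ltW.
(* [S + 1] enters the tail given by the limsup, 1 makes [T] positive, and [4 / (c - b)] gives exp((c
   - b) T) >= 1 + (c - b) T > 4. *)
pose T := Num.max (Num.max T0 1) (Num.max (S + 1) (4 / (c - b))).
have T1 : 1 <= T by rewrite !le_max lexx orbT.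
have Tp : 0 < T by apply: lt_le_trans T1.
exists T; first by rewrite !le_max lexx.
have AT : A T by apply: HS; apply: (@lt_le_trans _ _ (S + 1)); [rewrite ltrDl|rewrite !le_max lexx/= !orbT].
have cb : 0 < c - b by rewrite subr_gt0.
have cbT : 4 <= (c - b) * T by rewrite mulrC -ler_pdivrMr// !le_max lexx !orbT.
have : ((T^-1)%:E * lne (`|wsol T p v|)%:E <= (- c)%:E)%E.
  by apply: le_trans cy; apply: ereal_sup_ubound; exists T.
have [->|w0] := eqVneq (wsol T p v) 0; first by rewrite normr0 mulr0 invr_gt0.
have wp : 0 < `|wsol T p v| by rewrite normr_gt0.
rewrite lne_EFin// -EFinM lee_fin ler_pdivrMl// => hl.
have -> : `|wsol T p v| = expR (ln `|wsol T p v|) by rewrite lnK// posrE.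
rewrite -expRD; apply: (@le_lt_trans _ _ (expR (- ((c - b) * T)))).
  have -> : - ((c - b) * T) = b * T + T * - c by ring.
  by rewrite ler_expR lerD2l.
rewrite expRN ltf_pV2 ?posrE ?expR_gt0//.
by apply: lt_le_trans (expR_ge1Dx _); apply: le_lt_trans cbT _; rewrite ltrDr.
Qed.

(** A time that works strictly for one pair works for all nearby pairs by [wsol_near]. Compactness
    of [M] times [lip_ball] then bounds the times, and homogeneity in [v] reduces to the unit
    sphere. *)
Lemma lyapunov_uniform (b : R) : (upper_lyapunov M < (- b)%:E)%E ->
  exists2 N, r%:num <= N & forall p v, M p ->
    exists2 T, r%:num <= T <= N & expR (b * T) * `|wsol T p v| <= 4^-1 * `|v|.
Proof.
move=> hb.
(* [d^-1] bounds the time. The direction is taken in C, where the ball is compact, and [v] is the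
   same function seen in W^{1,oo}. *)
pose P (d : R) (q : (Omega * W) * C) := M q.1 -> forall v, (v = q.2 :> C) ->
  exists2 T, r%:num <= T <= d^-1 & expR (b * T) * `|wsol T q.1 v| <= 4^-1.
have [||d d0 H] := @compact_unif R _ (M `*` lip_ball) P (compact_setX (M_compact hM) lip_ball_compact).
- move=> d d' q d'0 dd' H Mq v vq; have [T /andP[rT Td] HT] := H Mq v vq.
  exists T => //; rewrite rT (le_trans Td)// lef_pV2// posrE//; exact: lt_le_trans dd'.
- move=> [p0 phi0] [/= Mp0 [_ lphi0]].
  pose v0 : W := MkWspace (lipC_in lphi0).
  have [T rT HT] := lyapunov_pointwise r%:num v0 hb Mp0.
  have T0 : 0 < T by apply: lt_le_trans rT.
  have E0 := expR_gt0 (b * T).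
  (* The strict inequality at the reference pair leaves this slack for [wsol T]. *)
  pose e := (4^-1 - expR (b * T) * `|wsol T p0 v0|) / expR (b * T).
  have e0 : 0 < e by rewrite divr_gt0// subr_gt0.
  have [d d0 H] := wsol_near v0 Mp0 rT e0.
  exists T^-1; first by rewrite invr_gt0.
  have := nbhsx_ballx (p0, phi0) _ d0; apply: filterS => -[p phi] [/= pd phid] Mp v vphi.
  exists T; first by rewrite invrK rT lexx.
  have vd : `|(v : C) - v0| < d by rewrite vphi distrC; move: phid; rewrite -ball_normE.
  have k := H p Mp pd v vd.
  have k2 : `|wsol T p v| <= e + `|wsol T p0 v0|.
    apply: le_trans (lerD k (lexx _)); exact: norm_le_dist.
  apply: le_trans (ler_wpM2l (ltW E0) k2) _.
  by rewrite mulrDr mulrC divfK ?gt_eqF// subrK.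
have rd : r%:num <= Num.max r%:num d^-1 by rewrite le_max lexx.
exists (Num.max r%:num d^-1) => // p v Mp.
have [->|v0] := eqVneq v 0.
  exists r%:num; first by rewrite lexx.
  have -> : (0 : W) = 0 *: v by rewrite scale0r.
  rewrite (wsolZ hsigma hF hT htau hM)//.
  by rewrite !scale0r !normr0 !mulr0.
have vp : 0 < `|v| by rewrite normr_gt0.
have ub : lip_ball (`|v|^-1 *: v : W).
  split.
    apply: (le_trans (wnorm_Cnorm _)); rewrite normrZ normfV normr_id mulVf// gt_eqF//.
  move=> s t; apply: (le_trans (W_lip (`|v|^-1 *: v) s t)).
  by rewrite normrZ normfV normr_id mulVf// gt_eqF.
have [T /andP[rT Td] HT] := H (p, (`|v|^-1 *: v : W) : C) (conj Mp ub) Mp (`|v|^-1 *: v) erefl.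
exists T; first by rewrite rT le_max Td orbT.
have T0 : 0 <= T by apply: le_trans rT.
move: HT; rewrite /= (wsolZ hsigma hF hT htau hM)// normrZ normfV normr_id mulrCA.
by rewrite ler_pdivrMl// (mulrC `|v|).
Qed.

End UniformContraction.

(** * Nonlinear exponential stability *)

Section ExponentialStability.
Context {R : realType} {r : {posnum R}} {n : nat} {Omega : metricType R}.
Notation E := 'rV[R]_n.
Notation C := (Cspace r n).
Notation W := (Wspace r n).
Notation histC := (@histC R r n).
Variables (sigma : R -> Omega -> Omega) (F : Omega -> E -> E -> E) (tau : Omega -> C -> R).
Hypotheses (hsigma : continuous_flow sigma) (hF : H1 F) (hT : H2 tau).
Hypothesis htau : forall w x, 0 <= tau w x <= r%:num.
Variable M : set (Omega * W).
Hypothesis hM : minimal_set sigma F tau M.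

Notation beta := (beta sigma F tau).
Notation usol := (usol sigma F tau).
Notation Pi := (Pi sigma F tau).
Notation vfield := (vfield F tau).
Notation rhs := (rhs sigma F tau).
Notation lin := (lin F tau).
Notation wsol := (wsol sigma F tau).
Notation linear_rhs := (linear_rhs sigma F tau).
Implicit Types (w : Omega) (y z : R -> E) (x v : W) (p q : Omega * W) (phi psi : C).

(** A qualitative bound that must precede the quantitative one: it gives existence up to [N] and
    keeps the solution in the tube where the vector field is Lipschitz. *)
Lemma usol_unif_near N e : 0 <= N -> 0 < e -> exists2 d : R, 0 < d &
  forall p x, M p -> `|x - p.2| < d -> (N%:E < beta p.1 x)%E /\
    forall t, 0 <= t -> t <= N -> `|usol t p.1 x - usol t p.1 p.2| <= e.
Proof.
move=> N0 e0; have e20 : 0 < e / 2 by rewrite divr_gt0.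
pose P (d : R) p := M p -> forall x, `|x - p.2| < d -> (N%:E < beta p.1 x)%E /\
  forall t, 0 <= t -> t <= N -> `|usol t p.1 x - usol t p.1 p.2| <= e.
have [||d d0 H] := @compact_unif R _ M P (M_compact hM).
- by move=> d d' p d'0 dd' H Mp x xd; apply: H => //; exact: lt_le_trans dd'.
- move=> p0 Mp0; have [d0 d00 H] := usol_near hsigma hF hT htau N0 e20 (M_beta hM Mp0).
  pose d := Num.min d0 (e / 2) / 2.
  have m0 : 0 < Num.min d0 (e / 2) by rewrite lt_min d00.
  have d0' : 0 < d by rewrite divr_gt0.
  have dm : d <= Num.min d0 (e / 2) := ltW_half m0.
  have md : Num.min d0 (e / 2) <= d0 by rewrite ge_min lexx.
  have me : Num.min d0 (e / 2) <= e / 2 by rewrite ge_min lexx orbT.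
  have ee : e / 2 + e / 2 = e by rewrite -splitr.
  have near w x : ball p0.1 d w -> `|x - p0.2| < Num.min d0 (e / 2) -> (N%:E < beta w x)%E /\
      forall t, 0 <= t -> t <= N -> `|usol t w x - usol t p0.1 p0.2| <= e / 2.
    move=> wd xd; have [|k1 k2] := H w x _ (le_lt_trans (wnorm_Cnorm (x - p0.2)) (lt_le_trans xd md)).
      exact: le_ball (le_trans dm md) _ wd.
    split => // t t0 tN; have [_ k] := k2 t t0 tN; apply: (le_trans k).
    by rewrite ge_max lexx/=; exact: (le_trans (ltW xd) me).
  exists d => //; have := nbhsx_ballx p0 _ d0'; apply: filterS => -[w x1] [/= wd xd1] Mp x /= xd.
  have {}xd1 : `|x1 - p0.2| < d by move: xd1; rewrite -ball_normE/= distrC.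
  have [k1 k2] : (N%:E < beta w x)%E /\
      forall t, 0 <= t -> t <= N -> `|usol t w x - usol t p0.1 p0.2| <= e / 2.
    apply: near => //; apply: (le_lt_trans (ler_distD x1 _ _)).
    by rewrite (splitr (Num.min d0 (e / 2))); exact: (ltrD xd xd1).
  have [_ k3] := near w x1 wd (lt_le_trans xd1 dm).
  split => // t t0 tN; apply: (le_trans (ler_distD (usol t p0.1 p0.2) _ _)).
  by rewrite -ee; apply: (lerD (k2 t t0 tN)); rewrite distrC; exact: k3.
exists d => // p x Mp; exact: (H p Mp Mp x).
Qed.

Lemma gsol_pair p x N : M p -> (N%:E < beta p.1 x)%E -> exists T y y0,
  [/\ N < T, gsol (rhs p.1) x T y, forall T, gsol (rhs p.1) p.2 T y0 &
    forall t, 0 <= t -> t <= N -> usol t p.1 x = histC y t :> C /\ usol t p.1 p.2 = histC y0 t :> C].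
Proof.
move=> Mp /ereal_between[T NT /(beta_gsol hsigma hF hT htau)[y sy]].
have [y0 sy0] := (beta_infty hsigma hF hT htau p.1 p.2).1 (M_beta hM Mp).
exists T, y, y0; split => // t t0 tN; have tT := le_lt_trans tN NT.
split; first exact: (usol_histC hsigma hF hT htau sy t0 tT).
exact: (usol_histC hsigma hF hT htau (sy0 T) t0 tT).
Qed.

(** Inside the tube, Gronwall applies with the solution in [M] as the side of known Lipschitz
    constant: the norm bound [B] of [M]. The resulting constant [K] does not depend on the point. *)
Lemma usol_lipschitz N : 0 <= N -> exists2 d : R, 0 < d & exists2 K, 0 < K &
  forall p x, M p -> `|x - p.2| < d -> (N%:E < beta p.1 x)%E /\
    forall t, 0 <= t -> t <= N -> `|usol t p.1 x - usol t p.1 p.2| <= K * `|x - p.2|.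
Proof.
move=> N0; have [B B0 MB] := M_bounded hM.
pose Kc := (fun p => (p.1, p.2 : C)) @` M.
have cKc : compact Kc.
  apply: continuous_compact; last exact: M_compact hM.
  by apply: continuous_subspaceT => p; exact: to_C_continuous.
have [d1 d10 [L L0 HL]] := vfield_unif_lip hF hT B cKc.
have d20 : 0 < d1 / 2 by rewrite divr_gt0.
have d21 : d1 / 2 < d1 by rewrite ltr_pdivrMr// ltr_pMr// ltr1n.
have [d d0 H] := usol_unif_near N0 d20.
exists d => //; pose K := (L + 1) * expR ((L + 1) * N).
have K0 : 0 < K by rewrite mulr_gt0 ?expR_gt0// addr_gt0.
exists K => // p x Mp xd; have [Nb Hu] := H p x Mp xd; split => //.
have [T [y [y0 [NT sy sy0 hE]]]] := gsol_pair Mp Nb.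
have [cy yx dy] := sy; have [cy0 y00 dy0] := sy0 T.
have cd : continuous (fun t => y t - y0 t) by move=> t; apply: cvgB; [exact: cy|exact: cy0].
have da t : t <= 0 -> `|y t - y0 t| <= `|x - p.2|.
  move=> t0; rewrite yx// y00//; apply: le_trans (wnorm_Cnorm (x - p.2)).
  exact: (Cnorm_ub (Wfun (x - p.2)) t).
have [|k1 k2 k3] := @gronwall_lip _ _ (fun t => y t - y0 t) `|x - p.2| 0 L N N0 (ltW L0) cd da (normr_ge0 _).
  move=> t t0 tN; exists (rhs p.1 t (histC y t) - rhs p.1 t (histC y0 t)).
    by apply: rderivB; [apply: dy => //; exact: lt_trans NT|apply: dy0 => //; exact: lt_trans NT].
  move=> m Hm; rewrite addr0; have [h1 h2] := hE t t0 (ltW tN).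
  have Kt : Kc (sigma t p.1, histC y0 t).
    by exists (Pi t p); [exact: M_Pi|rewrite /= h2].
  have lh : lipC (histC y0 t) B.
    move=> s u; rewrite -h2; apply: le_trans (wnorm_lip _ _ _) _.
    by apply: ler_wpM2r => //; exact: (MB _ (M_Pi hM t0 Mp)).
  have b0 : `|histC y0 t - histC y0 t| < d1 by rewrite subrr normr0.
  have b1 : `|histC y t - histC y0 t| < d1.
    rewrite -h1 -h2 -WfunB; apply: (le_lt_trans (wnorm_Cnorm _)).
    exact: (le_lt_trans (Hu t t0 (ltW tN))).
  rewrite distrC; apply: le_trans (HL _ _ Kt (sigma t p.1) _ (histC y t) (ballxx _ d10) b0 b1 lh) _.
  apply: ler_wpM2l; first exact: ltW.
  by rewrite distrC; apply: histCB_le => // s _ st; exact: Hm.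
move=> t t0 tN; have [h1 h2] := hE t t0 tN.
have Kp : 0 <= K * `|x - p.2| by rewrite mulr_ge0// ltW.
have lip : lipto (fun s => y s - y0 s) (K * `|x - p.2|) N.
  apply: lipto_glue => // s u s0 u0; rewrite !yx// !y00//.
  have := wnorm_lip (x - p.2) s u; rewrite WfunB !CfunB => k.
  by apply: (le_trans k); apply: ler_wpM2r.
move: (usol t p.1 x) (usol t p.1 p.2) h1 h2 => u1 u2 h1 h2.
have h12 : Wfun (u1 - u2) = histC (fun t => y t - y0 t) t.
  by rewrite WfunB h1 h2; apply: C_ext => s _ _; rewrite CfunB !histC_cont.
apply: (hist_wnorm_le cd h12 Kp).
  by move=> s _ st; apply: k2; exact: le_trans tN.
move=> s u _ su ut; have uN := le_trans ut tN.
apply: le_trans (lip u s uN (le_trans su uN)) _.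
by rewrite ger0_norm ?subr_ge0.
Qed.

Lemma deviation_arith (e K d D : R) : 0 < e -> 0 < K -> 0 < d -> 0 < D ->
  D <= d * e / (2 * K * K) -> (e / (2 * K) + K * D / d) * K <= e.
Proof.
move=> e0 K0 d0 D0; rewrite ler_pdivlMr ?mulr_gt0// => H.
rewrite mulrDl; have -> : e / (2 * K) * K = e / 2 by field; rewrite ?gt_eqF.
have -> : K * D / d * K = (D * (2 * K * K)) / d / 2 by field; rewrite ?gt_eqF.
have k : D * (2 * K * K) / d <= e by rewrite ler_pdivrMr// (mulrC e).
by rewrite [leRHS]splitr lerD2l ler_pM2r// invr_gt0.
Qed.

(** The error y - y0 - z solves the linearized equation up to the remainder of
    [vfield_linear_approx]. Both the size and the Lipschitz constant of y - y0 are at most [K * D]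
    by [usol_lipschitz], so the remainder is o(D) and Gronwall preserves this. *)
Lemma usol_linearized N e : r%:num <= N -> 0 < e -> exists2 d : R, 0 < d &
  forall p x, M p -> `|x - p.2| < d -> forall T, r%:num <= T -> T <= N ->
    `|usol T p.1 x - usol T p.1 p.2 - wsol T p (x - p.2)| <= e * `|x - p.2|.
Proof.
move=> rN e0; have N0 : 0 <= N by apply: le_trans rN.
have [L L0 HL] := lin_bounded hsigma hF hT htau hM.
have [d1 d10 [K K0 HK]] := usol_lipschitz N0.
pose ex := (L + 1) * expR ((L + 1) * N).
have ex0 : 0 < ex by rewrite mulr_gt0 ?expR_gt0// addr_gt0.
(* [e'] anticipates the Gronwall factor [ex]. Half of it pays for the term [e] of the expansion and
   half, through the choice of [d3], for its term [K / d]. *)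
pose e' := e / ex; have e'0 : 0 < e' by rewrite divr_gt0.
have exe : ex * e' = e by rewrite mulrC divfK// gt_eqF.
have e10 : 0 < e' / (2 * K) by rewrite divr_gt0// mulr_gt0.
have [d2 d20 Hd2] := vfield_linear_approx hsigma hF hT htau hM e10.
pose d3 := d2 * e' / (2 * K * K).
have d30 : 0 < d3.
  apply: divr_gt0; first exact: mulr_gt0.
  apply: mulr_gt0 => //; exact: mulr_gt0.
pose d4 := Num.min (Num.min d1 d3) (d2 / K).
have d40 : 0 < d4 by rewrite !lt_min d10 d30 divr_gt0.
have d41 : d4 <= d1 by rewrite !ge_min lexx.
have d43 : d4 <= d3 by rewrite !ge_min lexx orbT.
have d42 : K * d4 <= d2 by rewrite mulrC -ler_pdivlMr// ge_min lexx orbT.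
have arith := deviation_arith e'0 K0 d20 d40 d43.
exists d4 => // p x Mp xd.
have [Nb Hu] := HK p x Mp (lt_le_trans xd d41).
have [S [y [y0 [NS sy sy0 hE]]]] := gsol_pair Mp Nb.
have [z sz] := linear_sol_ex hsigma hF hT htau hM (x - p.2) Mp.
have [cy yx dy] := sy; have [cy0 y00 dy0] := sy0 S; have [cz zx dz] := sz S.
pose D := `|x - p.2|.
have D0 : 0 <= D by exact: normr_ge0.
have cd : continuous (fun t => y t - y0 t - z t).
  by move=> t; apply: cvgB; [apply: cvgB; [exact: cy|exact: cy0]|exact: cz].
have a0 : 0 <= e' * D by rewrite mulr_ge0// ltW.
have da t : t <= 0 -> `|y t - y0 t - z t| <= e' * D.
  move=> t0; rewrite yx// y00// zx// WfunB CfunB subrr normr0; exact: a0.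
have [|k1 k2 k3] := @gronwall_lip _ _ (fun t => y t - y0 t - z t) (e' * D) (e' * D) L N N0 (ltW L0) cd da (lexx _).
  move=> t t0 tN; have tS := lt_trans tN NS; have [h1 h2] := hE t t0 (ltW tN).
  exists (rhs p.1 t (histC y t) - rhs p.1 t (histC y0 t) - linear_rhs p t (histC z t)).
    by apply: rderivB; [apply: rderivB; [exact: dy|exact: dy0]|exact: dz].
  move=> m Hm; rewrite !(linear_rhsE _ _ _ _ _ t0).
  have hu := Hu t t0 (ltW tN).
  have hK : `|histC y t - (Pi t p).2| <= K * D.
    by rewrite -h1 -WfunB; apply: (le_trans (wnorm_Cnorm _)); exact: hu.
  have hlip : lipC (histC y t - (Pi t p).2) (K * D).
    move=> s u; rewrite -h1 -WfunB; apply: (le_trans (wnorm_lip _ _ _)).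
    by apply: ler_wpM2r => //; exact: hu.
  have KD0 : 0 <= K * D by rewrite mulr_ge0// ltW.
  have KDd : K * D < d2 by apply: lt_le_trans d42; rewrite ltr_pM2l.
  have := Hd2 (Pi t p) (M_Pi hM t0 Mp) (histC y t) (K * D) KD0 (le_lt_trans hK KDd) hlip.
  have -> : vfield (Pi t p).1 (histC y t) = rhs p.1 t (histC y t) by [].
  have -> : vfield (Pi t p).1 (Pi t p).2 = rhs p.1 t (histC y0 t) by rewrite /= h2.
  move=> hv.
  have {}hv : `|rhs p.1 t (histC y t) - rhs p.1 t (histC y0 t) - lin (Pi t p) (histC y t - (Pi t p).2)| <= e' * D.
    apply: (le_trans hv); apply: le_trans (_ : (e' / (2 * K) + K * d4 / d2) * (K * D) <= _).
      apply: ler_pM => //; first by rewrite addr_ge0 ?(ltW e10)// divr_ge0// ltW.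
      by rewrite lerD2l ler_pM2r ?invr_gt0// ler_pM2l// ltW.
    by rewrite mulrA ler_wpM2r.
  apply: (le_trans (ler_distD (lin (Pi t p) (histC y t - (Pi t p).2)) _ _)).
  rewrite addrC; apply: lerD => //.
  rewrite -(linB F tau); apply: le_trans (HL _ (M_Pi hM t0 Mp) _) _.
  apply: ler_wpM2l; first exact: ltW.
  have -> : histC y t - (Pi t p).2 - histC z t = histC (fun t => y t - y0 t - z t) t.
    apply: C_ext => s _ _; have := congr1 (fun f : C => f s) h2.
    by rewrite !CfunB !histC_cont// => <-.
  by apply: histC_le => // s _ st; exact: Hm.
move=> T rT TN; have T0 : 0 <= T by apply: le_trans rT.
have [h1 h2] := hE T T0 TN; have h3 := wsol_histC hsigma hF hT htau hM Mp sz T0.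
have kE : ex * (e' * D) = e * D by rewrite mulrA exe.
rewrite -/ex kE in k2 k3.
move: (usol T p.1 x) (usol T p.1 p.2) (wsol T p (x - p.2)) h1 h2 h3 => u1 u2 u3 h1 h2 h3.
have h12 : Wfun (u1 - u2 - u3) = histC (fun t => y t - y0 t - z t) T.
  by rewrite !WfunB h1 h2 h3; apply: C_ext => s _ _; rewrite !CfunB !histC_cont.
have eD : 0 <= e * D by rewrite mulr_ge0// ltW.
apply: (hist_wnorm_le cd h12 eD).
  by move=> s _ st; apply: k2; exact: le_trans TN.
by move=> s u s1 su ut; apply: k3 => //; [apply: le_trans s1; rewrite subr_ge0|exact: le_trans TN].
Qed.

End ExponentialStability.

Section AsymptoticStability.
Context {R : realType} {r : {posnum R}} {n : nat} {Omega : metricType R}.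
Notation E := 'rV[R]_n.
Notation C := (Cspace r n).
Notation W := (Wspace r n).
Variables (sigma : R -> Omega -> Omega) (F : Omega -> E -> E -> E) (tau : Omega -> C -> R).
Hypotheses (hsigma : continuous_flow sigma) (hF : H1 F) (hT : H2 tau).
Hypothesis htau : forall w x, 0 <= tau w x <= r%:num.
Variable M : set (Omega * W).
Hypothesis hM : minimal_set sigma F tau M.

Notation beta := (beta sigma F tau).
Notation usol := (usol sigma F tau).
Notation Pi := (Pi sigma F tau).
Notation rhs := (rhs sigma F tau).
Notation wsol := (wsol sigma F tau).
Notation upper_lyapunov := (upper_lyapunov sigma F tau).
Implicit Types (w : Omega) (y z : R -> E) (x v : W) (p q : Omega * W) (phi psi : C).

(** Each return to [S] takes at least time r, so [k] returns extend the solution to time k r. *)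
Lemma beta_infty_recurrent (S : set (Omega * W)) :
  (forall q, S q -> exists2 T, r%:num <= T & (T%:E < beta q.1 q.2)%E /\ S (Pi T q)) ->
  forall q, S q -> beta q.1 q.2 = +oo%E.
Proof.
move=> HS.
have key (k : nat) q : S q -> exists y, gsol (rhs q.1) q.2 (k%:R * r%:num) y.
  elim: k q => [|k IH] q Sq; have [T rT [Tb ST]] := HS q Sq; have T0 : 0 <= T by apply: le_trans rT.
    have [y sy] := beta_gsol hsigma hF hT htau Tb; exists y.
    by apply: gsol_mono sy; rewrite mul0r.
  have [T' TT' /(beta_gsol hsigma hF hT htau)[y sy]] := ereal_between Tb.
  have [y2 s2] := IH _ ST; rewrite -(rhs_shift F tau hsigma q.1 T) in s2.
  have g := gsol_glue T0 (gsol_mono (ltW TT') sy) (usol_histC hsigma hF hT htau sy T0 TT') s2.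
  by eexists; apply: gsol_mono g; rewrite -natr1 mulrDl mul1r addrC lerD2r.
move=> q Sq; apply/(beta_infty hsigma hF hT htau).
apply: gsol_global; first exact: rhs_regular.
move=> T; have [y sy] := key (Num.truncn (Num.max T 0 / r%:num)).+1 q Sq; exists y.
apply: gsol_mono sy; apply: le_trans (_ : Num.max T 0 <= _); first by rewrite le_max lexx.
have tr0 : 0 <= Num.max T 0 / r%:num by rewrite divr_ge0// le_max lexx orbT.
by rewrite -ler_pdivrMr// ltW//; have /andP[] := truncn_itv tr0.
Qed.

Lemma exp_stability b : 0 <= b -> (upper_lyapunov M < (- b)%:E)%E ->
  exists2 d : R, 0 < d & exists2 k, 0 < k & forall p x, M p -> `|x - p.2| < d ->
    beta p.1 x = +oo%E /\ forall t, 0 <= t ->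
      `|usol t p.1 x - usol t p.1 p.2| <= k * expR (- b * t) * `|x - p.2|.
Proof.
move=> b0 hb; have q4 : 4^-1 + 4^-1 <= 2^-1 :> R by lra.
have [N rN HN] := lyapunov_uniform hsigma hF hT htau hM hb.
have r0 : 0 < r%:num by []; have N0 : 0 <= N by apply: le_trans rN.
have EN := expR_gt0 (b * N).
(* Multiplied by exp(b T) with T <= N, the remainder of the linearization is still at most 1/4 of
   the initial distance. *)
have e0 : 0 < 4^-1 / expR (b * N) by rewrite divr_gt0// invr_gt0.
have [d1 d10 [K K0 HK]] := usol_lipschitz hsigma hF hT htau hM N0.
have [d2 d20 H2] := usol_linearized hsigma hF hT htau hM rN e0.
pose d := Num.min d1 d2; have d0 : 0 < d by rewrite lt_min d10.
have dd1 : d <= d1 by rewrite ge_min lexx.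
have dd2 : d <= d2 by rewrite ge_min lexx orbT.
have step p x : M p -> `|x - p.2| < d -> exists2 T, r%:num <= T <= N &
    expR (b * T) * `|usol T p.1 x - usol T p.1 p.2| <= `|x - p.2| / 2.
  move=> Mp xd; have [T /andP[rT TN] h1] := HN p (x - p.2) Mp.
  have T0 : 0 <= T by apply: le_trans rT.
  exists T; first by rewrite rT.
  have h2 := H2 p x Mp (lt_le_trans xd dd2) T rT TN.
  have ET := expR_gt0 (b * T).
  have ETN : expR (b * T) <= expR (b * N) by rewrite ler_expR ler_wpM2l.
  have h3 : expR (b * T) * (4^-1 / expR (b * N) * `|x - p.2|) <= 4^-1 * `|x - p.2|.
    rewrite mulrA ler_wpM2r// mulrCA ger_pMr ?invr_gt0//.
    by rewrite ler_pdivrMr// mul1r.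
  have h4 := norm_le_dist (usol T p.1 x - usol T p.1 p.2) (wsol T p (x - p.2)).
  apply: (le_trans (ler_wpM2l (ltW ET) h4)); rewrite mulrDr.
  apply: (le_trans (lerD (le_trans (ler_wpM2l (ltW ET) h2) h3) h1)).
  by rewrite -mulrDl mulrC; exact: (ler_wpM2l (normr_ge0 _) q4).
(* The states for [abstract_decay] are pairs of a point of [M] and a nearby segment in the same
   fibre; the contraction returns them to the tube. *)
pose S := [set q : (Omega * W) * W | M q.1 /\ `|q.2 - q.1.2| < d].
have contr p x T : M p -> `|x - p.2| < d -> 0 <= T ->
    expR (b * T) * `|usol T p.1 x - usol T p.1 p.2| <= `|x - p.2| / 2 ->
    S (Pi T p, usol T p.1 x).
  move=> Mp xd T0 h; split; first exact: M_Pi.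
  have : `|usol T p.1 x - usol T p.1 p.2| <= `|x - p.2| / 2.
    apply: (le_trans _ h); rewrite ler_peMl// -[leLHS]expR0 ler_expR.
    exact: mulr_ge0.
  move/le_lt_trans; apply; apply: le_lt_trans xd.
  by rewrite ler_pdivrMr// ler_peMr// ler1n.
have binf p x : M p -> `|x - p.2| < d -> beta p.1 x = +oo%E.
  move=> Mp xd; apply: (@beta_infty_recurrent [set q | exists2 p, M p & p.1 = q.1 /\ `|q.2 - p.2| < d] _ (p.1, x)).
    move=> [w x1] [p1 Mp1 [/= wE x1d]]; rewrite -wE.
    have [T /andP[rT TN] h] := step p1 x1 Mp1 x1d.
    have T0 : 0 <= T by apply: le_trans rT.
    exists T => //; split.
      have [Nb _] := HK p1 x1 Mp1 (lt_le_trans x1d dd1).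
      by apply: le_lt_trans Nb; rewrite lee_fin.
    have [m1 m2] := contr p1 x1 T Mp1 x1d T0 h.
    by exists (Pi T p1).
  by exists p.
have ENK : 0 < K * expR (b * N) by exact: mulr_gt0.
exists d => //; exists (K * expR (b * N)) => // p x Mp xd; split; first exact: binf.
move=> t t0; have D0 : `|x - p.2| = `|usol 0 p.1 x - usol 0 p.1 p.2|.
  by rewrite !(usol0 hsigma hF hT htau).
rewrite D0; pose a (q : (Omega * W) * W) s := `|usol s q.1.1 q.2 - usol s q.1.1 q.1.2|.
suff G (u : (Omega * W) * W) (s : R) : S u -> 0 <= s -> a u s <= K * expR (b * N) * expR (- b * s) * a u 0.
  exact: (G (p, x) t (conj Mp xd) t0).
move: u s; apply: (@abstract_decay R _ S a r%:num N b K r0 b0 (ltW K0)); rewrite /a => //.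
- move=> [p1 x1] s [/= Mp1 x1d] s0 sN; rewrite !(usol0 hsigma hF hT htau).
  by have [_ k] := HK p1 x1 Mp1 (lt_le_trans x1d dd1); exact: k.
- move=> [p1 x1] [/= Mp1 x1d]; have [T /andP[rT TN] h] := step p1 x1 Mp1 x1d.
  have T0 : 0 <= T by apply: le_trans rT.
  exists T; first by rewrite rT.
  rewrite !(usol0 hsigma hF hT htau); split => //.
  exists (Pi T p1, usol T p1.1 x1); first exact: contr.
  move=> s s0 /=.
  exact: (congr2 (fun u1 u2 : W => `|u1 - u2|)
    (usol_after hsigma hF hT htau T0 s0 (binf p1 x1 Mp1 x1d))
    (usol_after hsigma hF hT htau T0 s0 (M_beta hM Mp1))).
Qed.

End AsymptoticStability.

(** * Continuity of the fibres *)

Section FibreCover.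
Context {R : realType} {Omega : metricType R} {V : normedModType R}.

(** Near a point of [K] over a different base point the condition becomes vacuous, since such points
    stay at a positive distance from [w0]; over [w0] itself the inequality is open. Compactness
    makes the radius uniform. *)
Lemma section_upper_semicontinuous (K : set (Omega * V)) (w0 : Omega) (y : V) rho : compact K ->
  (forall x, K (w0, x) -> rho < `|x - y|) ->
  \forall w \near w0, forall x, K (w, x) -> rho < `|x - y|.
Proof.
move=> cK H0; pose P (d : R) (p : Omega * V) := ball w0 d p.1 -> K p -> rho < `|p.2 - y|.
have [||d d0 H] := @compact_unif R _ K P cK.
- by move=> d d' p d'0 dd' H wd; apply: H; exact: le_ball wd.
- move=> [w x]; case: (eqVneq w0 w) => [<-|wE] Kp.
    have g0 : 0 < `|x - y| - rho by rewrite subr_gt0; exact: H0.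
    exists 1 => //; have := nbhsx_ballx (w0, x) _ g0; apply: filterS => -[w1 x1] [/= _ x1d] _ _.
    move: x1d; rewrite -ball_normE/= => x1d.
    have := le_lt_trans (ler_distD x1 x y) (ltr_leD x1d (lexx `|x1 - y|)).
    by rewrite -addrA ltrDl addrC subr_gt0.
  have e0 : 0 < mdist w0 w / 2 by rewrite divr_gt0// mdist_gt0.
  exists (mdist w0 w / 2) => //.
  have := nbhsx_ballx (w, x) _ e0; apply: filterS => -[w1 x1] [/= w1d _] wd _; exfalso.
  have := ball_triangle wd (ball_sym w1d); rewrite -splitr ballEmdist/= ltxx.
  by [].
by have := nbhsx_ballx w0 _ d0; apply: filterS => w wd x Kx; exact: (H (w, x)).
Qed.

(* The set of balls of a finite cover that a fibre meets is upper semicontinuous, so it is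
   locally constant where its cardinality is minimal. *)
Lemma locally_close_fibres (K : set (Omega * V)) rho : compact K -> K !=set0 -> 0 < rho ->
  exists w0, exists2 d : R, 0 < d & forall w1 w2, ball w0 d w1 -> ball w0 d w2 ->
    forall x1, K (w1, x1) -> exists2 x2, K (w2, x2) & `|x2 - x1| <= 2 * rho.
Proof.
move=> cK [[wk xk] _] rho0.
have cV : compact (snd @` K).
  by apply: continuous_compact cK; apply: continuous_subspaceT => p; exact: continuous_snd.
move: cV; rewrite compact_cover => /(_ V setT (fun y => ball y rho)).
move=> [||D' _ cov].
- by move=> y _; exact: ball_open.
- by move=> x _; exists x => //; exact: ballxx.
pose s := finmap.enum_fset D'.
pose Q w (i : 'I_(size s)) := exists2 x, K (w, x) & `|x - nth 0 s i| <= rho.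
pose J w : {set 'I_(size s)} := finset (fun i => `[< Q w i >]).
have [w0 minw0] : exists w0, forall w, (#|J w0| <= #|J w|)%N.
  have ex : exists k, `[< exists w, #|J w| = k >] by exists #|J wk|; apply/asboolP; exists wk.
  case: (ex_minnP ex) => k /asboolP[w0 <-] mink; exists w0 => w.
  by apply: mink; apply/asboolP; exists w.
have : \forall w \near w0, forall i, i \notin J w0 -> i \notin J w.
  apply: filter_forall => i; have [iJ|iJ] := boolP (i \in J w0); first exact: filterE.
  have N x : K (w0, x) -> rho < `|x - nth 0 s i|.
    move=> Kx; rewrite ltNge; apply: contra iJ => xi.
    by rewrite inE; apply/asboolP; exists x.
  apply: filterS (section_upper_semicontinuous cK N) => w Hw _.
  by rewrite inE; apply/asboolP => -[x Kx]; rewrite leNgt Hw.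
move=> /nbhs_ballP[d /= d0 H]; exists w0; exists d => //.
have JE w : ball w0 d w -> J w = J w0.
  move=> wd; apply/eqP; rewrite eqEcard minw0 andbT; apply/fintype.subsetP => i.
  by apply: contraTT; exact: H.
move=> w1 w2 wd1 wd2 x1 Kx1.
have [y /= yD yx1] := cov x1 (ex_intro2 _ _ (w1, x1) Kx1 erefl).
have ys : (index y s < size s)%N by rewrite index_mem.
have yE : nth 0 s (Ordinal ys) = y by rewrite /= nth_index// -index_mem.
have {}yx1 : `|y - x1| <= rho by move: yx1; rewrite -ball_normE/= => /ltW.
have : Ordinal ys \in J w1 by rewrite inE; apply/asboolP; exists x1; rewrite ?yE 1?distrC.
rewrite (JE _ wd1) -(JE _ wd2) inE => /asboolP[x2 Kx2]; rewrite yE => x2y.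
exists x2 => //; apply: le_trans (ler_distD y _ _) _.
by rewrite mulr_natl mulr2n lerD.
Qed.

End FibreCover.

Section FibreContinuity.
Context {R : realType} {r : {posnum R}} {n : nat} {Omega : metricType R}.
Notation E := 'rV[R]_n.
Notation C := (Cspace r n).
Notation W := (Wspace r n).
Variables (sigma : R -> Omega -> Omega) (F : Omega -> E -> E -> E) (tau : Omega -> C -> R).
Hypotheses (hsigma : continuous_flow sigma) (hF : H1 F) (hT : H2 tau).
Hypothesis htau : forall w x, 0 <= tau w x <= r%:num.
Hypotheses (hOmega : compact [set: Omega]) (hmin : minimal_flow sigma).
Variable M : set (Omega * W).
Hypothesis hM : minimal_set sigma F tau M.

Notation usol := (usol sigma F tau).
Notation upper_lyapunov := (upper_lyapunov sigma F tau).
Implicit Types (w : Omega) (x y : W) (p q : Omega * W).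

Lemma sigma_continuous t : continuous (sigma t).
Proof.
have [cs _ _] := hsigma => w.
apply: (@continuous_comp _ _ _ (fun w => (t, w)) (fun q : R * Omega => sigma q.1 q.2)); last exact: cs.
by apply: continuous_pair; [exact: cvg_cst|exact: cvg_id].
Qed.

Lemma sigmaK t : cancel (sigma t) (sigma (- t)).
Proof. by have [_ s0 sD] := hsigma => w; rewrite -sD addNr s0. Qed.

Lemma sigmaNK t : cancel (sigma (- t)) (sigma t).
Proof. by have [_ s0 sD] := hsigma => w; rewrite -sD subrr s0. Qed.

(* The alpha-limit set of [w] contains a full orbit, which is dense. *)
Lemma backward_visit (O : set Omega) w T : open O -> O !=set0 ->
  exists2 t, T <= t & O (sigma (- t) w).
Proof.
move=> oO O0; have [_ s0 sD] := hsigma.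
have [w1 [_ cl]] := hOmega (fmap_proper_filter (fun t => sigma (- t) w) (@proper_pinfty_nbhs R))
  (@filterT _ _ (fmap_filter (fun t => sigma (- t) w) (@proper_pinfty_nbhs R))).
have [w2 [Ow [s _ /= sE]]] := hmin w1 O0 oO; rewrite -sE in Ow.
have nO : nbhs w1 (sigma s @^-1` O).
  by apply: sigma_continuous; apply: open_nbhs_nbhs.
have nA : ((fun t => sigma (- t) w) @ +oo%R) [set u | exists2 t, T + s <= t & u = sigma (- t) w].
  by exists (T + s); split; [exact: num_real|move=> t /ltW Tt; exists t].
have [_ [[t Tt ->] /= Ot]] := cl _ _ nA nO.
exists (t - s); first by rewrite lerBrDr.
by rewrite opprB sD.
Qed.

Lemma exp_small (k b e : R) : 0 < b -> 0 < e -> 0 < k ->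
  exists2 T0, 0 <= T0 & forall t, T0 <= t -> k * expR (- b * t) < e.
Proof.
move=> b0 e0 k0; exists (k / e / b); first by rewrite !divr_ge0// ltW.
move=> t; rewrite ler_pdivrMr// => ht.
rewrite mulNr expRN ltr_pdivrMr ?expR_gt0// mulrC -ltr_pdivrMr//.
by apply: lt_le_trans (expR_ge1Dx _); rewrite (mulrC b); apply: le_lt_trans ht _; rewrite ltrDr.
Qed.

(** Pull back by a long time T to p1 in [M], over a base point where fibres are close. For w near
    the base of p0, some y in the fibre over sigma(-T) w is close to p1. Its image at time T is
    compared with p0 through the solution from y over the base of p1: continuity in the base point
    handles the first difference, exponential stability the second. The segment y need not lie in
    the fibre over p1, only in its tube. *)
Lemma fibre_lower_semicontinuous b p0 e : 0 < b -> (upper_lyapunov M < (- b)%:E)%E -> M p0 -> 0 < e ->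
  exists2 d : R, 0 < d & forall w, ball p0.1 d w -> exists2 x, M (w, x) & `|x - p0.2| < e.
Proof.
move=> b0 hb Mp0 e0.
have [dl dl0 [k k0 stab]] := exp_stability hsigma hF hT htau hM (ltW b0) hb.
have q0 : 0 < dl / 4 by rewrite divr_gt0.
have dlE : 2 * (dl / 4) = dl / 2 by field.
have dl2 : dl / 2 < dl by rewrite ltr_pdivrMr// ltr_pMr// ltr1n.
have e8 : 0 < e / 8 by rewrite divr_gt0.
have e2 : 0 < e / 2 by rewrite divr_gt0.
have e82 : e / 8 + e / 8 + e / 2 <= e by lra.
have [ws [ds ds0 close]] := locally_close_fibres (M_compact hM) (ex_intro _ p0 Mp0) q0.
rewrite dlE in close.
have [T0 T00 small] := exp_small b0 e2 (mulr_gt0 k0 dl0).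
pose O := (ball ws ds)°%classic.
have Ows : O !=set0 by exists ws; exact: nbhsx_ballx.
have [T T0T OT] := backward_visit p0.1 T0 (@open_interior _ _) Ows.
have TT : 0 <= T := le_trans T00 T0T.
have [p1 Mp1 p1E] := M_Pi_surj hsigma hF hT htau hM TT Mp0.
have w1E : sigma (- T) p0.1 = p1.1 by rewrite -p1E /=; exact: sigmaK.
rewrite w1E in OT.
(* The radius in the base must be found before [y] is known, hence uniformly over all candidates in
   [M]. The restriction to [dl / 2] places them in the stability tube of [p1], where solutions exist
   for all times; candidates at distance [dl] or more are excluded together with a neighbourhood. *)
pose P (d : R) q := `|q.2 - p1.2| <= dl / 2 -> forall w, ball p1.1 d w ->
  `|usol T w q.2 - usol T p1.1 q.2| <= e / 8 + e / 8.
have [||d d0 H] := @compact_unif R _ M P (M_compact hM).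
- by move=> d d' q d'0 dd' H h w wd; apply: H => //; exact: le_ball wd.
- move=> q Mq; have [qd|qd] := ltP `|q.2 - p1.2| dl; last first.
    have g0 : 0 < dl / 2 by rewrite divr_gt0.
    exists 1 => //; have := nbhsx_ballx q _ g0; apply: filterS => -[w x] [/= _ xd] h; exfalso.
    move: xd; rewrite -ball_normE/= => xd; move: qd; apply/negP; rewrite -ltNge.
    apply: (le_lt_trans (ler_distD x _ _)); rewrite (splitr dl).
    exact: (ltr_leD xd h).
  have [qb _] := stab p1 q.2 Mp1 qd.
  have [d' d'0 near] := usol_near hsigma hF hT htau TT e8 qb.
  pose d := Num.min d' (e / 8).
  have d0 : 0 < d by rewrite lt_min d'0.
  have dd' : d <= d' by rewrite ge_min lexx.
  have de : d <= e / 8 by rewrite ge_min lexx orbT.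
  exists d => //; have := nbhsx_ballx q _ d0; apply: filterS => -[w x] [/= _ xd] _ w2 w2d.
  have {}xd : `|x - q.2| < d by move: xd; rewrite -ball_normE/= distrC.
  have k1 w3 : ball p1.1 d w3 -> `|usol T w3 x - usol T p1.1 q.2| <= e / 8.
    move=> w3d; have [_ /(_ T TT (lexx T)) [_ k1]] := near w3 x (le_ball dd' w3d)
      (le_lt_trans (wnorm_Cnorm (x - q.2)) (lt_le_trans xd dd')).
    apply: (le_trans k1); rewrite ge_max lexx/=; exact: (le_trans (ltW xd) de).
  apply: (le_trans (ler_distD (usol T p1.1 q.2) _ _)); apply: (lerD (k1 _ w2d)).
  by rewrite distrC; apply: k1; exact: ballxx.
have nb : \forall w \near p0.1, O (sigma (- T) w) /\ ball p1.1 d (sigma (- T) w).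
  have nbo : nbhs (sigma (- T) p0.1) (O `&` ball p1.1 d).
    rewrite w1E; apply: filterI; last exact: nbhsx_ballx.
    by apply: open_nbhs_nbhs; split => //; exact: open_interior.
  exact: (@sigma_continuous (- T) p0.1 _ nbo).
have /nbhs_ballP[d2 /= d20 Hd2] := nb; exists d2 => // w wd.
have [Ow wp1] := Hd2 w wd.
have [y My yd] := close p1.1 (sigma (- T) w) (interior_subset OT) (interior_subset Ow) p1.2
  (eq_ind p1 M Mp1 _ (surjective_pairing p1)).
have Mx := M_Pi hM TT My.
exists (usol T (sigma (- T) w) y).
  by move: Mx; rewrite /Defs.Pi/= sigmaNK.
have h1 := H (sigma (- T) w, y) My yd (sigma (- T) w) wp1.
have [_ /(_ T TT) h2] := stab p1 y Mp1 (le_lt_trans yd dl2).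
have h3 : `|usol T p1.1 y - usol T p1.1 p1.2| < e / 2.
  apply: (le_lt_trans h2); apply: (le_lt_trans _ (small T T0T)).
  rewrite mulrAC; apply: ler_wpM2r; first exact: expR_ge0.
  by apply: ler_wpM2l; [exact: ltW|exact: (le_trans yd (ltW dl2))].
have h4 : p0.2 = usol T p1.1 p1.2 by rewrite -p1E.
rewrite h4; apply: (le_lt_trans (ler_distD (usol T p1.1 y) _ _)).
exact: (lt_le_trans (ler_ltD h1 h3) e82).
Qed.

End FibreContinuity.

(** * The domain of attraction *)

Lemma near_attraction_arith {R : realFieldType} (k dl B1 B2 N E e1 e2 : R) : 0 <= k -> 0 <= dl ->
  0 <= B1 -> 0 <= B2 -> 0 <= N -> 0 <= e1 -> E * e1 = 1 -> 0 <= e2 -> e2 <= 1 ->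
  let k' := (k * dl + dl + B1 + B2 + 1) * E in
  k * e2 * dl <= k' * (1 + N) * (e1 * e2) /\ (dl + N) + B1 + B2 <= (k' * (1 + N) * e1).
Proof.
move=> k0 dl0 B10 B20 N0 e10 Ee e20 e21 k'.
have kd : 0 <= k * dl by exact: mulr_ge0.
have -> : k' * (1 + N) * (e1 * e2) = (k * dl + dl + B1 + B2 + 1) * (1 + N) * e2.
  by transitivity ((k * dl + dl + B1 + B2 + 1) * (1 + N) * e2 * (E * e1)); [rewrite /k'; ring|rewrite Ee mulr1].
have -> : k' * (1 + N) * e1 = (k * dl + dl + B1 + B2 + 1) * (1 + N).
  by transitivity ((k * dl + dl + B1 + B2 + 1) * (1 + N) * (E * e1)); [rewrite /k'; ring|rewrite Ee mulr1].
set a := k * dl + dl + B1 + B2 + 1.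
have a1 : 1 <= a by rewrite /a; lra.
have aN : a + N <= a * (1 + N) by rewrite mulrDr mulr1 lerD2l ler_peMl.
split; last by apply: le_trans aN; rewrite /a; lra.
by rewrite mulrAC; apply: ler_wpM2r => //; apply: le_trans aN; rewrite /a; lra.
Qed.

Section AttractionDomain.
Context {R : realType} {r : {posnum R}} {n : nat} {Omega : metricType R}.
Notation E := 'rV[R]_n.
Notation C := (Cspace r n).
Notation W := (Wspace r n).
Variables (sigma : R -> Omega -> Omega) (F : Omega -> E -> E -> E) (tau : Omega -> C -> R).
Hypotheses (hsigma : continuous_flow sigma) (hF : H1 F) (hT : H2 tau).
Hypothesis htau : forall w x, 0 <= tau w x <= r%:num.
Hypotheses (hOmega : compact [set: Omega]) (hmin : minimal_flow sigma).
Variable M : set (Omega * W).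
Hypothesis hM : minimal_set sigma F tau M.

Notation beta := (beta sigma F tau).
Notation usol := (usol sigma F tau).
Notation upper_lyapunov := (upper_lyapunov sigma F tau).
Notation D := (attraction_domain sigma F tau M).
Implicit Types (w : Omega) (x y : W) (p q : Omega * W).

Lemma attraction_domainP q : D q <-> beta q.1 q.2 = +oo%E /\ exists2 xb, M (q.1, xb) &
  forall e, 0 < e -> exists2 S, 0 <= S & forall t, S <= t -> `|usol t q.1 q.2 - usol t q.1 xb| < e.
Proof.
split=> -[qb [xb Mx H]]; split => //; exists xb => //.
  move=> e e0; have /cvgr0Pnorm_lt /(_ e e0) [S [_ HS]] := H.
  exists (Num.max 0 (S + 1)); first by rewrite le_max lexx.
  move=> t; rewrite ge_max => /andP[_ St].
  by have := HS t; rewrite normr_id; apply; apply: lt_le_trans St; rewrite ltrDl.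
apply/cvgrPdist_lt => e e0; have [S S0 HS] := H e e0.
exists S; split; first exact: num_real.
by move=> t /ltW St; rewrite sub0r normrN normr_id; exact: HS.
Qed.

Lemma exp_attraction w x xb b k : 0 < b -> beta w x = +oo%E -> M (w, xb) ->
  (forall t, 0 <= t -> `|usol t w x - usol t w xb| <= k * expR (- b * t)) -> D (w, x).
Proof.
move=> b0 xb_inf Mx H; apply/attraction_domainP; split => //; exists xb => // e e0.
have k0 : 0 < k + 1.
  have := H 0 (lexx _); rewrite mulr0 expR0 mulr1 => h.
  by rewrite ltr_wpDl// (le_trans _ h).
have [S S0 HS] := exp_small b0 e0 k0; exists S => // t St.
apply: le_lt_trans (HS t St); apply: (le_trans (H t (le_trans S0 St))).
by rewrite ler_pM2r ?expR_gt0// lerDl.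
Qed.

(** As continuity in time may fail in W^{1,oo}, the bound comes from the supremum and the Lipschitz
    constant of the solution on [-r, T]. *)
Lemma usol_bounded w x T : 0 <= T -> beta w x = +oo%E -> exists2 B, 0 <= B &
  forall t, 0 <= t -> t <= T -> `|usol t w x| <= B.
Proof.
move=> T0 /(beta_infty hsigma hF hT htau)[y sy]; have [cy _ _] := sy 0.
have TT : T < T + 1 by rewrite ltrDl.
have [K K0 yK] := gsol_lip (rhs_regular hsigma hF hT w).1 (sy (T + 1)) TT.
have [B B0 yB] := @bounded_on_segment _ _ y (- r%:num) T cy.
have m0 : 0 <= Num.max K B by rewrite le_max (ltW K0).
exists (Num.max K B) => // t t0 tT.
have hE := usol_histC hsigma hF hT htau (sy (T + 1)) t0 (le_lt_trans tT TT).
apply: (hist_wnorm_le cy hE m0).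
  move=> s rs st; rewrite le_max; apply/orP; right; apply: yB.
    by apply: le_trans rs; rewrite lerDr.
  exact: le_trans tT.
move=> s u _ su ut; have uT := le_trans ut tT.
apply: le_trans (yK u s uT (le_trans su uT)) _.
rewrite ger0_norm ?subr_ge0//; apply: ler_wpM2r; first by rewrite subr_ge0.
by rewrite le_max lexx.
Qed.

(* Only the supremum distance of the initial segments has to be small: the equation
   smooths them within one delay. *)
Lemma attraction_near b p0 : 0 < b -> (upper_lyapunov M < (- b)%:E)%E -> D p0 ->
  exists2 d : R, 0 < d & exists2 k, 0 < k & forall w x, ball p0.1 d w -> `|(x : C) - (p0.2 : C)| < d ->
    beta w x = +oo%E /\ exists2 xb, M (w, xb) &
      forall t, 0 <= t -> `|usol t w x - usol t w xb| <= k * (1 + `|x - p0.2|) * expR (- b * t).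
Proof.
move=> b0 hb /attraction_domainP[pb [xb0 Mx0 H]].
have [dl dl0 [k k0 stab]] := exp_stability hsigma hF hT htau hM (ltW b0) hb.
have dl4 : 0 < dl / 4 by rewrite divr_gt0.
have dlE : dl / 4 + dl / 4 + dl / 4 < dl by lra.
have dlle : dl / 4 <= dl by lra.
(* At [T] the reference solution is near [M] and a full delay has elapsed. Three shares of [dl / 4]
   then bring the perturbed solution into the tube: perturbation, attraction, and continuity of the
   fibre. *)
have [S S0 HS] := H _ dl4; pose T := Num.max S r%:num.
have T0 : 0 <= T by rewrite le_max S0.
have rT : r%:num <= T by rewrite le_max lexx orbT.
have hST : S <= T by rewrite le_max lexx.
have [d1 d10 Hd1] := usol_near hsigma hF hT htau T0 dl4 pb.
have [d2 d20 Hd2] := fibre_lower_semicontinuous hsigma hF hT htau hOmega hmin hM b0 hb (M_Pi hM T0 Mx0) dl4.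
have /cvg_ballP /(_ _ d20) /nbhs_ballP[d3 /= d30 Hd3] := @sigma_continuous _ _ _ hsigma T p0.1.
have [B1 B10 HB1] := usol_bounded T0 pb.
have [B2 B20 HB2] := M_bounded hM.
(* [k * dl] serves the decay after [T]; the other terms serve [0, T], where solutions are merely
   bounded and the distance of the initial segments still counts, hence the factor [1 + |x - p0.2|].
   The exponential converts decay counted from [T] into decay counted from 0. *)
pose k' := (k * dl + dl + B1 + B2 + 1) * expR (b * T).
have k'0 : 0 < k'.
  rewrite mulr_gt0 ?expR_gt0// ltr_wpDl// !addr_ge0 ?mulr_ge0//; exact: ltW.
exists (Num.min d1 d3); first by rewrite lt_min d10.
exists k'; first exact: k'0.
move=> w x wd xd.
have dd1 : Num.min d1 d3 <= d1 by rewrite ge_min lexx.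
have dd3 : Num.min d1 d3 <= d3 by rewrite ge_min lexx orbT.
have [Tb near] := Hd1 w x (le_ball dd1 wd) (lt_le_trans xd dd1).
have [x' Mx' x'd] := Hd2 (sigma T w) (Hd3 w (le_ball dd3 wd)).
have close : `|usol T w x - x'| < dl.
  have h1 := (near T T0 (lexx T)).1 rT; have h2 := HS T hST.
  apply: (lt_trans _ dlE); apply: (le_lt_trans (ler_distD (usol T p0.1 p0.2) _ _)).
  rewrite -addrA; apply: (ler_ltD h1); apply: (le_lt_trans (ler_distD (usol T p0.1 xb0) _ _)).
  by apply: (ltrD h2); rewrite distrC; exact: x'd.
have [bT dec] := stab (sigma T w, x') (usol T w x) Mx' close.
have binf : beta w x = +oo%E.
  have [T' TT' /(beta_gsol hsigma hF hT htau)[y sy]] := ereal_between Tb.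
  exact: (beta_glue hsigma hF hT htau T0 TT' sy bT).
(* The nearby point of [M] was found at time [T]; surjectivity of the semiflow on [M] and
   injectivity of the base flow pull it back to a point over [w]. *)
split => //; have [[w' xb] Mq] := M_Pi_surj hsigma hF hT htau hM T0 Mx'.
rewrite /Defs.Pi/= => -[/(can_inj (sigmaK hsigma T)) w'E]; rewrite w'E in Mq *.
move=> xE; exists xb => // t t0.
have e10 : 0 <= expR (- (b * T)) by exact: expR_ge0.
have Ee : expR (b * T) * expR (- (b * T)) = 1 by rewrite -expRD subrr expR0.
have [tT|/ltW Tt] := leP t T.
  have [_ arith] := near_attraction_arith (ltW k0) (ltW dl0) B10 (ltW B20) (normr_ge0 (x - p0.2)) e10 Ee ler01 (lexx _).
  apply: (le_trans (_ : _ <= dl + `|x - p0.2| + B1 + B2)); last first.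
    apply: (le_trans arith); apply: ler_wpM2l; first by rewrite mulr_ge0 ?(ltW k'0)// addr_ge0.
    by rewrite ler_expR mulNr lerN2 ler_wpM2l// ltW.
  have h1 := (near t t0 tT).2; have h2 := HB1 t t0 tT.
  have h3 := HB2 _ (M_Pi hM t0 Mq).
  have h4 : Num.max (dl / 4) `|x - p0.2| <= dl + `|x - p0.2|.
    by rewrite ge_max lerDr (ltW dl0) andbT; apply: (le_trans dlle); rewrite lerDl.
  apply: (le_trans (ler_normB _ _)); apply: (lerD _ h3).
  by apply: (le_trans (norm_le_dist _ (usol t p0.1 p0.2))); exact: (lerD (le_trans h1 h4) h2).
have s0 : 0 <= t - T by rewrite subr_ge0.
have tE : T + (t - T) = t by rewrite addrC subrK.
have h := dec (t - T) s0.
have e21 : expR (- b * (t - T)) <= 1.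
  by rewrite -[leRHS]expR0 ler_expR mulNr oppr_le0 mulr_ge0// ltW.
have [arith _] := near_attraction_arith (ltW k0) (ltW dl0) B10 (ltW B20) (normr_ge0 (x - p0.2)) e10 Ee (expR_ge0 _) e21.
have u1 := usol_after hsigma hF hT htau T0 s0 binf.
have u2 := usol_after hsigma hF hT htau T0 s0 (M_beta hM Mq).
rewrite /= xE tE in u2; rewrite tE in u1.
rewrite /= u1 u2 in h; apply: (le_trans h).
have -> : expR (- b * t) = expR (- (b * T)) * expR (- b * (t - T)).
  by rewrite -expRD; congr expR; ring.
apply: le_trans arith; apply: ler_wpM2l; last exact: ltW.
by rewrite mulr_ge0 ?expR_ge0// ltW.
Qed.

End AttractionDomain.

Lemma locally_constant {R : realType} (P : R -> Prop) :
  (forall t0, P t0 -> \forall t \near t0, P t) -> (forall t0, ~ P t0 -> \forall t \near t0, ~ P t) ->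
  forall s t, P s -> P t.
Proof.
move=> oP oN s t Ps.
have cR : connected [set: R] by apply/connected_intervalP => x y _ _ z _.
have op (Q : R -> Prop) : (forall t0, Q t0 -> \forall t \near t0, Q t) -> open [set t | Q t].
  by move=> oQ; rewrite openE => t0; exact: oQ.
have -> : P t = [set: R] t; last by [].
rewrite -(cR [set t | P t]) //.
- by exists s.
- by exists [set t | P t]; [exact: op|rewrite setTI].
- by exists [set t | P t]; [rewrite -openC; exact: op|rewrite setTI].
Qed.

Section AttractionTopology.
Context {R : realType} {r : {posnum R}} {n : nat} {Omega : metricType R}.
Notation E := 'rV[R]_n.
Notation C := (Cspace r n).
Notation W := (Wspace r n).
Notation histC := (@histC R r n).
Variables (sigma : R -> Omega -> Omega) (F : Omega -> E -> E -> E) (tau : Omega -> C -> R).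
Hypotheses (hsigma : continuous_flow sigma) (hF : H1 F) (hT : H2 tau).
Hypothesis htau : forall w x, 0 <= tau w x <= r%:num.
Hypotheses (hOmega : compact [set: Omega]) (hmin : minimal_flow sigma).
Variable M : set (Omega * W).
Hypothesis hM : minimal_set sigma F tau M.

Notation beta := (beta sigma F tau).
Notation usol := (usol sigma F tau).
Notation Pi := (Pi sigma F tau).
Notation upper_lyapunov := (upper_lyapunov sigma F tau).
Notation D := (attraction_domain sigma F tau M).
Implicit Types (w : Omega) (x y : W) (p q : Omega * W).

Lemma attraction_invariant p t : 0 <= t -> D p -> D (Pi t p).
Proof.
move=> t0 /attraction_domainP[pb [xb Mx H]]; apply/attraction_domainP; split.
  exact: (beta_after hsigma hF hT htau t0 pb).
exists (usol t p.1 xb); first exact: (M_Pi hM t0 Mx).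
move=> e e0; have [S S0 HS] := H e e0; exists S; [exact: S0|move=> s Ss].
have s0 := le_trans S0 Ss.
have u1 := usol_after hsigma hF hT htau t0 s0 pb.
have u2 := usol_after hsigma hF hT htau t0 s0 (M_beta hM Mx).
have Sts : S <= t + s by apply: le_trans Ss _; rewrite lerDr.
exact: (eq_ind_r (fun z => z < e) (HS (t + s) Sts) (congr2 (fun a c : W => `|a - c|) u1 u2)).
Qed.

Variable b : R.
Hypotheses (b0 : 0 < b) (hb : (upper_lyapunov M < (- b)%:E)%E).

(** Stronger than openness in W^{1,oo}: needed in [clopen_orbit], where the orbit moves continuously
    in C only. *)
Lemma attraction_C_open p0 : D p0 -> exists2 d : R, 0 < d & forall w x,
  ball p0.1 d w -> `|(x : C) - (p0.2 : C)| < d -> D (w, x).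
Proof.
move=> Dp; have [d d0 [k k0 H]] := attraction_near hsigma hF hT htau hOmega hmin hM b0 hb Dp.
exists d; first exact: d0.
move=> w x wd xd; have [xb [y My Hy]] := H w x wd xd.
exact: (exp_attraction b0 xb My Hy).
Qed.

Lemma near_of_balls p0 (P : Omega * W -> Prop) (d : R) : 0 < d ->
  (forall w x, ball p0.1 d w -> `|x - p0.2| < d -> P (w, x)) -> \forall p \near p0, P p.
Proof.
move=> d0 H; have := nbhsx_ballx p0 _ d0; apply: filterS => -[w x] [/= wd xd].
by apply: H => //; move: xd; rewrite -ball_normE/= distrC.
Qed.

Lemma attraction_open : open D.
Proof.
rewrite openE => p0 Dp; have [d d0 H] := attraction_C_open Dp.
apply: (near_of_balls d0) => w x wd xd.
exact: (H w x wd (le_lt_trans (wnorm_Cnorm (x - p0.2)) xd)).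
Qed.

Lemma attraction_uniform (P : set (Omega * W)) : compact P -> P `<=` D ->
  exists k, forall w x, P (w, x) -> exists2 xb, M (w, xb) &
    forall t, 0 <= t -> `|usol t w x - usol t w xb| <= k * expR (- b * t).
Proof.
move=> cP PD.
pose Q (d : R) p := exists2 xb, M (p.1, xb) &
  forall t, 0 <= t -> `|usol t p.1 p.2 - usol t p.1 xb| <= d^-1 * expR (- b * t).
have [||d d0 H] := @compact_unif R _ P Q cP.
- move=> d d' p d'0 dd' [xb Mx H]; exists xb => // t t0; apply: (le_trans (H t t0)).
  by rewrite ler_pM2r ?expR_gt0// lef_pV2// posrE//; exact: lt_le_trans dd'.
- move=> p Pp.
  have [d d0 [k k0 H]] := attraction_near hsigma hF hT htau hOmega hmin hM b0 hb (PD p Pp).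
  have k2 : 0 < k * (1 + 1) by rewrite mulr_gt0.
  exists (k * (1 + 1))^-1; first by rewrite invr_gt0.
  have m0 : 0 < Num.min d 1 by rewrite lt_min d0/=.
  apply: (near_of_balls m0) => w x wd xd.
  have md : Num.min d 1 <= d by rewrite ge_min lexx.
  have m1 : Num.min d 1 <= 1 by rewrite ge_min lexx orbT.
  have [_ [xb Mx Hx]] := H w x (le_ball md wd)
    (le_lt_trans (wnorm_Cnorm (x - p.2)) (lt_le_trans xd md)).
  exists xb => // t t0; apply: (le_trans (Hx t t0)); rewrite /= invrK.
  rewrite ler_pM2r ?expR_gt0// ler_pM2l// lerD2l; exact: (ltW (lt_le_trans xd m1)).
by exists d^-1 => w x Pwx; exact: (H (w, x) Pwx).
Qed.

(** * Relatively clopen subsets of the domain of attraction *)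

Section Clopen.
Variable B : set (Omega * W).
Hypothesis Bnear : forall p, B p -> \forall q \near p, D q -> B q.
Hypothesis Bfar : forall p, D p -> ~ B p -> \forall q \near p, ~ B q.

Lemma clopen_path (g : R -> Omega * W) : continuous g -> (forall t, D (g t)) ->
  forall s t, B (g s) -> B (g t).
Proof.
move=> cg Dg; apply: locally_constant => t0 Bt.
  have n1 : \forall t \near t0, D (g t) -> B (g t) by exact: (cg t0 _ (Bnear Bt)).
  by apply: filterS n1 => t Ht; exact: (Ht (Dg t)).
exact: (cg t0 _ (Bfar (Dg t0) Bt)).
Qed.

(** Extends paths on [0, 1] to the whole line, as [locally_constant] requires. *)
Definition unit_clamp (t : R) : R := Num.max (Num.min t 1) 0.

Lemma unit_clamp_continuous : continuous unit_clamp.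
Proof.
move=> t; apply: (@continuous_comp _ _ _ (fun t : R => Num.min t 1) (fun t => Num.max t 0)).
  by apply: (@continuous_min _ _ id (fun=> 1)); [exact: cvg_id|exact: cvg_cst].
exact: continuous_max0.
Qed.

Lemma unit_clamp_ge0 t : 0 <= unit_clamp t.
Proof. by rewrite le_max lexx orbT. Qed.

Lemma unit_clamp_le1 t : unit_clamp t <= 1.
Proof. by rewrite ge_max ler01 ge_min lexx orbT. Qed.

Lemma unit_clamp0 : unit_clamp 0 = 0.
Proof. by rewrite /unit_clamp min_l// maxxx. Qed.

Lemma unit_clamp1 : unit_clamp 1 = 1.
Proof. by rewrite /unit_clamp minxx max_l. Qed.

Lemma clopen_segment w x0 x1 :
  (forall c, 0 <= c -> c <= 1 -> D (w, x0 + c *: (x1 - x0))) -> B (w, x0) <-> B (w, x1).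
Proof.
move=> HD; pose g t := (w, x0 + unit_clamp t *: (x1 - x0)).
have cg : continuous g.
  move=> t; apply: (@continuous_pair R Omega W (fun=> w) (fun t => x0 + unit_clamp t *: (x1 - x0))).
    exact: cvg_cst.
  apply: cvgD; first exact: cvg_cst.
  by apply: cvgZr_tmp; exact: unit_clamp_continuous.
have Dg t : D (g t) by exact: (HD _ (unit_clamp_ge0 t) (unit_clamp_le1 t)).
have g0 : g 0 = (w, x0) by rewrite /g unit_clamp0 scale0r addr0.
have g1 : g 1 = (w, x1) by rewrite /g unit_clamp1 scale1r addrC subrK.
by rewrite -g0 -g1; split; exact: clopen_path.
Qed.

(** The orbit may be discontinuous in W^{1,oo}. Nearby points of it are joined instead by two
    continuous paths: a straight segment in one fibre from u(s0) to u(s), then a motion of the base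
    point with u(s) fixed. Along both, the base point and the segment stay close to those at s0, the
    segment in C, so both lie in the domain by [attraction_C_open]. *)
Lemma clopen_orbit p t : D p -> 0 <= t -> B p <-> B (Pi t p).
Proof.
move=> Dp t0; have pb : beta p.1 p.2 = +oo%E by have [] := Dp.
have [y sy] := (beta_infty hsigma hF hT htau p.1 p.2).1 pb.
have [cy _ _] := sy 0.
have max0 s : 0 <= Num.max s (0 : R) by rewrite le_max lexx orbT.
have hE s : 0 <= s -> usol s p.1 p.2 = histC y s :> C.
  by move=> s0; apply: (usol_histC hsigma hF hT htau (sy (s + 1)) s0); rewrite ltrDl.
have local (s0 : R) : 0 <= s0 -> \forall s \near s0, B (Pi s0 p) <-> B (Pi (Num.max s 0) p).
  move=> s00; have DP := attraction_invariant s00 Dp.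
  have [d d0 H] := attraction_C_open DP.
  have n1 : \forall s \near s0, ball (sigma s0 p.1) d (sigma s p.1).
    by have /cvg_ballP /(_ d d0) := @flow_cont _ _ _ hsigma p.1 s0.
  have n2 : \forall s \near s0, `|histC y s0 - histC y s| < d.
    by have /cvgrPdist_lt /(_ d d0) := @continuous_histC R r n y cy s0.
  have n12 : \forall s \near s0, ball (sigma s0 p.1) d (sigma s p.1) /\ `|histC y s0 - histC y s| < d.
    exact: (filterI n1 n2).
  have /nbhs_ballP[e /= e0 He] := n12.
  have := nbhsx_ballx s0 _ e0; apply: filterS => s1 s1e; pose s := Num.max s1 0.
  have se : `|s0 - s| < e.
    rewrite /s; have [s1p|s1n] := leP 0 s1; first exact: s1e.
    have : `|s0 - s1| < e by exact: s1e.
    rewrite subr0 (ger0_norm s00); apply: le_lt_trans; apply: le_trans (ler_norm _).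
    by rewrite lerDl oppr_ge0 ltW.
  have sd : `|(usol s p.1 p.2 : C) - (usol s0 p.1 p.2 : C)| < d.
    by rewrite (hE s (max0 _)) (hE s0 s00) distrC; exact: (He s se).2.
  have step1 : B (Pi s0 p) <-> B (sigma s0 p.1, usol s p.1 p.2).
    apply: clopen_segment => c c0 c1; apply: H; first exact: ballxx.
    apply: le_lt_trans sd.
    have -> : Wfun (usol s0 p.1 p.2 + c *: (usol s p.1 p.2 - usol s0 p.1 p.2)) - Wfun (usol s0 p.1 p.2)
        = c *: (Wfun (usol s p.1 p.2) - Wfun (usol s0 p.1 p.2)).
      rewrite -!WfunB -WfunZ; congr Wfun; by rewrite addrAC subrr add0r.
    by rewrite normrZ (ger0_norm c0) ler_piMl.
  apply: (iff_trans step1); pose g u := (sigma (s0 + unit_clamp u * (s - s0)) p.1, usol s p.1 p.2).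
  have cg : continuous g.
    move=> u; apply: (@continuous_pair R Omega W (fun u => sigma (s0 + unit_clamp u * (s - s0)) p.1)
      (fun=> usol s p.1 p.2)); last exact: cvg_cst.
    apply: (@continuous_comp _ _ _ (fun u => s0 + unit_clamp u * (s - s0)) (fun u => sigma u p.1)).
      by apply: cvgD; [exact: cvg_cst|apply: cvgMr_tmp; exact: unit_clamp_continuous].
    exact: flow_cont.
  have Dg u : D (g u).
    apply: H sd; apply: (He _ _).1; rewrite /ball/= opprD addrA subrr sub0r normrN normrM.
    rewrite (ger0_norm (unit_clamp_ge0 u)) (distrC s); apply: le_lt_trans se.
    by rewrite ler_piMl// unit_clamp_le1.
  have g0 : g 0 = (sigma s0 p.1, usol s p.1 p.2) by rewrite /g unit_clamp0 mul0r addr0.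
  have g1 : g 1 = Pi s p by rewrite /g unit_clamp1 mul1r addrC subrK.
  rewrite -g0 -/s -g1; split; exact: clopen_path.
pose P s := B (Pi (Num.max s 0) p).
have localP (s0 : R) : \forall s \near s0, P s0 <-> P s.
  have := local (Num.max s0 0) (max0 _) => /near_max0; apply: filterS => s.
  by rewrite (max_l (max0 s)).
have P0 : P 0 = B p by rewrite /P maxxx (Pi0 hsigma hF hT htau).
have Pt : P t = B (Pi t p) by rewrite /P max_l.
have lc : forall u v, P u -> P v.
  apply: locally_constant => u Pu.
    by apply: filterS (localP u) => s Hs; apply/Hs.
  by apply: filterS (localP u) => s Hs /Hs.
by rewrite -P0 -Pt; split; exact: lc.
Qed.

(** Follow the orbit until it is in the tube, then a straight segment in the fibre to the attracting
    point of [M]. The tube is a ball in each fibre, so the segment stays in it and consists of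
    attracted points. *)
Lemma clopen_reaches_minimal p : D p -> exists2 q, M q & B p <-> B q.
Proof.
move=> Dp; have [dl dl0 [k k0 stab]] := exp_stability hsigma hF hT htau hM (ltW b0) hb.
have /attraction_domainP[pb [xb Mx H]] := Dp; have [S S0 HS] := H dl dl0.
have MS := M_Pi hM S0 Mx; exists (Pi S (p.1, xb)); first exact: MS.
apply: (iff_trans (clopen_orbit Dp S0)); apply: iff_sym; apply: clopen_segment => c c0 c1.
have close (u v : W) : `|v - u| < dl -> `|(u + c *: (v - u)) - u| < dl.
  move=> uv; rewrite addrAC subrr add0r normrZ (ger0_norm c0); apply: le_lt_trans uv.
  by rewrite ler_piMl.
have cl := close _ _ (HS S (lexx S)).
have [binf dec] := stab (sigma S p.1, usol S p.1 xb) _ MS cl.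
apply: (exp_attraction (k := k * dl) b0 binf MS) => u u0.
apply: (le_trans (dec u u0)); rewrite mulrAC; apply: ler_wpM2r; first exact: expR_ge0.
exact: (ler_wpM2l (ltW k0) (ltW cl)).
Qed.

End Clopen.

Lemma M_sub_attraction : M `<=` D.
Proof.
move=> -[w x] Mp; apply: (exp_attraction (k := 0) b0 (M_beta hM Mp) Mp) => t t0.
by rewrite subrr normr0 mul0r.
Qed.

Lemma attraction_connected : connected D.
Proof.
move=> B [p0 Bp0] [U oU BU] [K cK BK].
have BD : B `<=` D by rewrite BU => p [].
have Bnear p : B p -> \forall q \near p, D q -> B q.
  rewrite BU => -[Dp Up]; have nU : nbhs p U by apply: open_nbhs_nbhs.
  by apply: filterS nU => q Uq Dq.
have Bfar p : D p -> ~ B p -> \forall q \near p, ~ B q.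
  rewrite BK => Dp NB; have nK : nbhs p (~` K).
    by apply: open_nbhs_nbhs; split; [rewrite openC|move=> Kp; apply: NB].
  by apply: filterS nK => q NK [].
have orbit := clopen_orbit Bnear Bfar.
have reach := clopen_reaches_minimal Bnear Bfar.
have MB : M `&` B = M.
  have [_ _ cM minM] := hM; apply: minM.
  - by have [q Mq [/(_ Bp0) Bq _]] := reach p0 (BD _ Bp0); exists q.
  - move=> p [Mp Bp]; split; first exact: (M_beta hM Mp).
    by move=> t t0; split; [exact: M_Pi|apply/(orbit p t (BD _ Bp) t0)].
  (* Since [M] lies in the domain, relative closedness of [B] becomes plain closedness within
     [M]. *)
  - have -> : M `&` B = M `&` K; last exact: compact_closedI.
    by rewrite BK setIA; congr (_ `&` _); apply/setIidPl; exact: M_sub_attraction.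
  - by move=> p [].
apply/seteqP; split; [exact: BD|move=> p Dp].
have [q Mq [_ qp]] := reach p Dp; apply: qp.
by move: Mq; rewrite -MB => -[].
Qed.

End AttractionTopology.

Theorem proposition5p8 (R : realType) (r : {posnum R}) (n : nat) (hn : (1 <= n)%N)
  (Omega : metricType R) (hOmega : compact [set: Omega])
  (sigma : R -> Omega -> Omega)
  (hsigma : continuous_flow sigma) (hmin : minimal_flow sigma)
  (F : Omega -> 'rV[R]_n -> 'rV[R]_n -> 'rV[R]_n) (hF : H1 F)
  (tau : Omega -> Cspace r n -> R)
  (htau : forall w x, 0 <= tau w x <= r%:num) (hH2 : H2 tau)
  (M : set (Omega * Wspace r n)) (hM : minimal_set sigma F tau M)
  (hlambda : (upper_lyapunov sigma F tau M < 0)%E) :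
  [/\ open (attraction_domain sigma F tau M),
      connected (attraction_domain sigma F tau M) &
      positively_invariant sigma F tau (attraction_domain sigma F tau M)] /\
  forall b : R, 0 < b -> (b%:E < - upper_lyapunov sigma F tau M)%E ->
  forall P : set (Omega * Wspace r n),
    compact P -> P `<=` attraction_domain sigma F tau M ->
  exists k : R, forall w x, P (w, x) ->
  exists2 xb, M (w, xb) &
    forall t, 0 <= t ->
      `|usol sigma F tau t w x - usol sigma F tau t w xb| <= k * expR (- b * t).
Proof.
(* The topological claims use some positive rate, which strict negativity of the exponent
   provides. *)
have ex : exists2 b : R, 0 < b & (upper_lyapunov sigma F tau M < (- b)%:E)%E.
  have : (0%:E < - upper_lyapunov sigma F tau M)%E by rewrite oppe_gt0.
  move=> /ereal_between[b b0 hb]; exists b => //.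
  by rewrite -lteN2 -EFinN opprK.
have [b0 b00 hb0] := ex; split; [split|].
- exact: (attraction_open hsigma hF hH2 htau hOmega hmin hM b00 hb0).
- exact: (attraction_connected hsigma hF hH2 htau hOmega hmin hM b00 hb0).
- move=> p Dp; split; first by have [] := Dp.
  by move=> t t0; exact: (attraction_invariant hsigma hF hH2 htau hM t0 Dp).
- move=> b b1 hb P cP PD.
  have {}hb : (upper_lyapunov sigma F tau M < (- b)%:E)%E by rewrite -lteN2 -EFinN opprK.
  exact: (attraction_uniform hsigma hF hH2 htau hOmega hmin hM b1 hb cP PD).
Qed.
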